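(* Let $n\ge 1$ and let $P(D)$ be any nonzero linear constant-coefficient differential operator on $\mathbb{R}^n$ (complex coefficients allowed) with symbol the polynomial $P(\xi)$, $\xi\in\mathbb{R}^n$. Then the weight $|P(\xi)|$ belongs to the Muckenhoupt class $A_p$ for some $p$, and for every $p\in[1,\infty)$ with $|P|\in A_p$ and every $\rho\in\mathbb{R}$ the following holds with $s=np>0$. There is a measurable subset $S\subseteq Q_0$ of full measure, $|S|=|Q_0|$, such that for every $\xi_0\in S$ there is a constant $C$ (independent of $u$ and $f$) such that for every $f\in H^{\rho+s}(T^n)$ the conjugated equation $$e^{-i(x,\xi_0)}P(D)\big(e^{i(x,\xi_0)}u\big)=f$$ has a solution $u\in H^\rho(T^n)$ on the torus $T^n$ satisfying $$\|u\|_\rho\le C\,\|f\|_{\rho+s}.$$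
   Context: Notation: $D=\big(\tfrac1i\partial_{x_1},\dots,\tfrac1i\partial_{x_n}\big)$; $(x,\xi)$ is the Euclidean inner product; $|E|$ is the Lebesgue measure of $E$; $Q_0\subset\mathbb{R}^n$ is the cube of unit edge length centered at the origin. If $P(\xi)=\sum_\alpha c_\alpha\xi^\alpha$ then $P(D)=\sum_\alpha c_\alpha D^\alpha$. Torus: $T^n=(\mathbb{R}/2\pi\mathbb{Z})^n$, with Fourier coefficients $\hat f(m)$, $m\in\mathbb{Z}^n$, taken with respect to the characters $e^{i(m,x)}$. For $s\in\mathbb{R}$, $H^s(T^n)$ is the space of (periodic) distributions $f$ with $\|f\|_s=\big(\sum_{m\in\mathbb{Z}^n}|\hat f(m)|^2(1+|m|^2)^s\big)^{1/2}<\infty$. For periodic $u$, the expression $e^{-i(x,\xi_0)}P(D)(e^{i(x,\xi_0)}u)$, computed on $\mathbb{R}^n$, is again periodic (it equals $P(D+\xi_0)u$), and the equation is understood on $T^n$. Muckenhoupt classes: a weight is a locally integrable function $w$ on $\mathbb{R}^n$ with $w>0$ almost everywhere. For $1<p<\infty$, $w\in A_p$ iff $$\sup_B\Big(\frac1{|B|}\int_B w\,dx\Big)\Big(\frac1{|B|}\int_B w^{-\frac1{p-1}}\,dx\Big)^{p-1}<\infty,$$ the supremum being over all balls $B\subset\mathbb{R}^n$; $w\in A_1$ iff there is a constant $C$ with $\frac1{|B|}\int_B w\,dx\le C\,\mathrm{ess\,inf}_B\, w$ for all balls $B$. *)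

(* Defs.v *)
From HB Require Import structures.
From mathcomp Require Import all_boot all_order all_algebra.
From mathcomp Require Import all_classical all_reals all_analysis.
From mathcomp Require Import ess_sup_inf complex.
From mathcomp Require Import (canonicals, coercions) mpoly.

Set Implicit Arguments.
Unset Strict Implicit.
Unset Printing Implicit Defensive.

Import Order.TTheory GRing.Theory Num.Theory.
Import numFieldNormedType.Exports.

Local Open Scope classical_set_scope.
Local Open Scope ring_scope.

(* The product (= Borel) sigma-algebra on R^n. *)
Definition rV_display : measure_display.
Proof. exact: default_measure_display. Qed.

Section measurable_rV.
Context {R : realType} (n : nat).

Let coord (i : 'I_n) (x : 'rV[R]_n) : R := x ord0 i.

Let rV_set0 : g_sigma_preimage coord set0.
Proof. exact: sigma_algebra0. Qed.

Let rV_setC A : g_sigma_preimage coord A -> g_sigma_preimage coord (~` A).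
Proof. exact: sigma_algebraC. Qed.

Let rV_bigcup (F : (set 'rV[R]_n)^nat) :
  (forall i, g_sigma_preimage coord (F i)) ->
  g_sigma_preimage coord (\bigcup_i F i).
Proof. exact: sigma_algebra_bigcup. Qed.

HB.instance Definition _ := @isMeasurable.Build rV_display
  'rV[R]_n (g_sigma_preimage coord) rV_set0 rV_setC rV_bigcup.

End measurable_rV.

Section lebesgue_rV.
Context {R : realType}.

Lemma measurable_coord n (i : 'I_n) :
  measurable_fun [set: 'rV[R]_n] (fun x : 'rV[R]_n => x ord0 i).
Proof.
move=> _ Y mY; rewrite setTI; apply: sub_sigma_algebra => /=.
rewrite -bigcup_seq/=; exists i => /=; first by rewrite mem_index_enum.
by exists Y => //; rewrite setTI.
Qed.

Definition consrV n (xv : R * 'rV[R]_n) : 'rV[R]_n.+1 :=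
  row_mx (xv.1%:M : 'rV_1) xv.2.

Lemma measurable_consrV n : measurable_fun [set: R * 'rV[R]_n] (@consrV n).
Proof.
have mc (i : 'I_n.+1) :
    measurable_fun [set: R * 'rV[R]_n] (fun xv => consrV xv ord0 i).
  have [j ->|j ->] := split_ordP (i : 'I_(1 + n)).
    rewrite (_ : (fun _ => _) = fst); first exact: measurable_fst.
    by apply/funext => xv; rewrite /consrV (@row_mxEl _ 1 1 n) !mxE [j]ord1.
  rewrite (_ : (fun _ => _) = (fun v : 'rV[R]_n => v ord0 j) \o snd).
    by apply: measurableT_comp; [exact: measurable_coord|exact: measurable_snd].
  by apply/funext => xv; rewrite /consrV (@row_mxEr _ 1 1 n).
move=> _ A mA; rewrite setTI.
suff: g_sigma_preimage (fun (i : 'I_n.+1) (x : 'rV[R]_n.+1) => x ord0 i)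
    `<=` [set B | measurable (@consrV n @^-1` B)] by exact.
apply: smallest_sub.
  split => /=.
  - by rewrite preimage_set0.
  - by move=> B mB; rewrite setTD preimage_setC; exact: measurableC.
  - by move=> F mF; rewrite preimage_bigcup; exact: bigcup_measurable.
rewrite -bigcup_seq /=; apply: bigcup_sub => i _ _ [B mB <-] /=.
by rewrite setTI; have := mc i measurableT B mB; rewrite setTI.
Qed.

Definition lebesgue_consrV n (mu : {measure set 'rV[R]_n -> \bar R}) :
    {measure set 'rV[R]_n.+1 -> \bar R} :=
  measure_function_pushforward__canonical__measure_function_Measure
    (lebesgue_measure \x^ mu)%E (@measurable_consrV n).

(* Lebesgue measure on R^n: the product of n copies of Lebesgue measure on R. *)
Fixpoint lebesgue_rV n : {measure set 'rV[R]_n -> \bar R} :=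
  match n with
  | 0 => dirac (0 : 'rV[R]_0)
  | n'.+1 => lebesgue_consrV (lebesgue_rV n')
  end.

End lebesgue_rV.

Section muckenhoupt.
Context {R : realType} (n : nat).
Implicit Types (w : 'rV[R]_n -> R) (B : set 'rV[R]_n).

Local Notation leb := (@lebesgue_rV R n).

(* The norm of the normed module 'rV[R]_n is the sup norm; balls, like |m|
   below, are Euclidean. *)
Definition eball (c : 'rV[R]_n) (r : R) : set 'rV[R]_n :=
  [set x | \sum_j (x ord0 j - c ord0 j) ^+ 2 < r ^+ 2].

Definition is_weight w : Prop :=
  [/\ measurable_fun [set: 'rV[R]_n] w,
      forall K : set 'rV[R]_n, compact K ->
        (\int[leb]_(x in K) `|w x|%:E < +oo)%E &
      {ae leb, forall x, 0 < w x}].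

Definition average B w : \bar R :=
  (((fine (leb B))^-1)%:E * \int[leb]_(x in B) (w x)%:E)%E.

(* The value +oo outside B does not affect the essential infimum. *)
Definition ess_inf_on B w : \bar R :=
  ess_inf leb (fun x => if x \in B then (w x)%:E else +oo%E).

Definition A1_condition w : Prop :=
  exists C : R, forall c r, 0 < r ->
    (average (eball c r) w <= C%:E * ess_inf_on (eball c r) w)%E.

Definition Ap_product (p : R) w B : \bar R :=
  (average B w * average B (fun x => w x `^ (- (p - 1)^-1))%R `^ (p - 1))%E.

Definition Ap_condition (p : R) w : Prop :=
  (ereal_sup [set Ap_product p w (eball cr.1 cr.2)
    | cr in [set cr : 'rV[R]_n * R | (0 < cr.2)%R]] < +oo)%E.

(* Only meaningful for 1 <= p. In Ap_product, 0 `^ a = 0 for a <> 0, so the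
   integrand is 0 rather than +oo where w vanishes; weights are positive a.e. *)
Definition muckenhoupt (p : R) w : Prop :=
  is_weight w /\ if p == 1 then A1_condition w else Ap_condition p w.

End muckenhoupt.

Section smooth_functions.
Context {R : realType} {n : nat}.
Local Notation C := R[i].
Implicit Types (g : 'rV[R]_n -> R) (f : 'rV[R]_n -> C).

Definition partial (j : 'I_n) g : 'rV[R]_n -> R :=
  fun x => 'D_(delta_mx ord0 j) g x.

(* C^oo: the iterated partial derivatives along every word s of coordinates
   exist and are continuous. *)
Definition smooth g : Prop := forall s : seq 'I_n,
  continuous (foldr partial g s) /\
  forall j x, derivable (foldr partial g s) x (delta_mx ord0 j).

Definition csmooth f : Prop :=
  smooth (fun x => complex.Re (f x)) /\ smooth (fun x => complex.Im (f x)).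

(* D_j = (1/i) d/dx_j, the derivative being taken componentwise. *)
Definition Dj (j : 'I_n) f : 'rV[R]_n -> C := fun x =>
  (Complex 0 1)^-1 *
  Complex (partial j (fun y => complex.Re (f y)) x)
          (partial j (fun y => complex.Im (f y)) x).

(* Iterates commuting operators indexed by the coordinates: op^alpha. *)
Definition multi_iter (X : Type) (op : 'I_n -> X -> X)
    (alpha : mpoly.multinom n) (a : X) : X :=
  foldr (fun j => iter (alpha j) (op j)) a (enum 'I_n).

(* C^oo functions on T^n = (R/2piZ)^n, as periodic functions on R^n. *)
Definition test_function f : Prop :=
  csmooth f /\
  forall (x : 'rV[R]_n) (m : 'rV[int]_n),
    f (x + (2 * pi) *: map_mx intr m) = f x.

Definition dotr (x y : 'rV[R]_n) : R := \sum_j x ord0 j * y ord0 j.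

Definition expi_dot (xi : 'rV[R]_n) : 'rV[R]_n -> C :=
  fun x => Complex (cos (dotr x xi)) (sin (dotr x xi)).

End smooth_functions.

Section periodic_distributions.
Context {R : realType} {n : nat}.
Local Notation C := R[i].
Local Notation fct := ('rV[R]_n -> C).

(* Distributions on T^n: continuous linear functionals on C^oo(T^n), continuity
   being with respect to the seminorms sup |D^alpha phi|.
   The values of the functional outside test functions are irrelevant. *)
Record periodic_distribution := PeriodicDistribution {
  pairing :> fct -> C ;
  pairing_linear : forall (a : C) (phi psi : fct),
    test_function phi -> test_function psi ->
    pairing (fun x => a * phi x + psi x) = a * pairing phi + pairing psi ;
  pairing_continuous : exists (K : R) (N : nat),
    forall (phi : fct) (M : R), test_function phi ->
    (forall alpha : mpoly.multinom n, (mpoly.mdeg alpha <= N)%N ->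
       forall x, Normc.normc (multi_iter Dj alpha phi x) <= M) ->
    Normc.normc (pairing phi) <= K * M }.

Implicit Types T : fct -> C.

(* Operations on distributions are defined by transposition. *)
Definition dmul (g : fct) T : fct -> C := fun phi => T (fun x => g x * phi x).

Definition dDj (j : 'I_n) T : fct -> C := fun phi => - T (Dj j phi).

Definition dPD (P : mpoly.mpoly n C) T : fct -> C := fun phi =>
  \sum_(alpha <- mpoly.msupp P) mpoly.mcoeff alpha P * multi_iter dDj alpha T phi.

(* e^{-i(x,xi0)} P(D) (e^{i(x,xi0)} T). On a test function phi this only
   evaluates T at functions e^{i(x,xi0)} D^alpha (e^{-i(x,xi0)} phi), which are
   again test functions. *)
Definition conjugated (P : mpoly.mpoly n C) (xi0 : 'rV[R]_n) T : fct -> C :=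
  dmul (expi_dot (- xi0)) (dPD P (dmul (expi_dot xi0) T)).

Definition eq_distribution T1 T2 : Prop :=
  forall phi, test_function phi -> T1 phi = T2 phi.

(* Normalised so that a function f, acting by integration over one period, has
   coefficients (2pi)^-n int f e^{-i(m,x)} dx. *)
Definition fourier_coef T (m : 'rV[int]_n) : C :=
  ((2 * pi) ^- n)%:C%C * T (expi_dot (- map_mx intr m)).

Definition sobolev_norm (s : R) T : \bar R :=
  poweR (\esum_(m in [set: 'rV[int]_n])
    (Normc.normc (fourier_coef T m) ^+ 2 *
     (1 + \sum_j (m ord0 j)%:~R ^+ 2) `^ s)%:E)%E 2^-1.

Definition in_sobolev (s : R) (f : periodic_distribution) : Prop :=
  (sobolev_norm s f < +oo)%E.

End periodic_distributions.

Arguments periodic_distribution : clear implicits.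

Definition symbol (R : realType) (n : nat) (P : mpoly.mpoly n R[i])
    (xi : 'rV[R]_n) : R[i] :=
  mpoly.meval (fun j => (xi ord0 j)%:C%C) P.

Definition symbol_weight (R : realType) (n : nat) (P : mpoly.mpoly n R[i])
    (xi : 'rV[R]_n) : R :=
  Normc.normc (symbol P xi).

Definition unit_cube {R : realType} {n : nat} : set 'rV[R]_n :=
  [set x | forall j, - 2^-1 <= x ord0 j <= 2^-1].

(* Main.v *)
From HB Require Import structures.
Require Import Defs.
From mathcomp Require Import all_boot all_order all_algebra.
From mathcomp Require Import all_classical all_reals all_analysis.
From mathcomp Require Import measurable_realfun ess_sup_inf complex.
From mathcomp Require Import ring lra zify.
From mathcomp Require Import (canonicals, coercions) mpoly.
Set Implicit Arguments.
Unset Strict Implicit.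
Unset Printing Implicit Defensive.
Import Order.TTheory GRing.Theory Num.Theory.
Import numFieldNormedType.Exports.
Local Open Scope classical_set_scope.
Local Open Scope ring_scope.

(* In one variable, the mean over an interval I of |t - a|^(-1/2) is at most
   18 |z - a|^(-1/2) for every z in I, uniformly in the complex number a.
   Factoring a polynomial q of degree at most d into linear factors and using
   prod x_i^(1/d) <= 1 + sum x_i, the mean of |q|^(-1/(2d)) over I is
   at most a constant times |q(z)|^(-1/(2d)) for every z in I. By Fubini, one
   variable at a time, the same holds for |P| on cubes, and this implies A_p
   with p = 1 + 2d.

   The average of |P| over the ball of radius r centered at 0 stays bounded away
   from 0 as r grows, so A_p bounds the integral of |P|^(-1/(p-1)) over that ball
   by C r^n. By Chebyshev, the part of the ball of radius 2^k where
   |P| < l 2^(-knp) has measure at most C (l 2^(-kn))^(1/(p-1)), which is summable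
   in k with a sum that is small for small l. Translating by Z^n into the unit
   cube, |P(m + xi)| >= l (1 + |m|^2)^(-np/2) holds for all m, unless xi belongs
   to a set of small measure. For p = 1 the weight is bounded below.

   For such a xi, let u have the Fourier coefficients f^(m) / P(m + xi), which
   grow at most polynomially. Fourier coefficients of test functions are obtained
   as limits of discrete Fourier transforms on grids with (2L+1)^n points, where
   inversion is an exact finite identity and decay follows from difference
   quotients. *)

(** On a cube, the mean of |P|^(-delta), delta = 1/(2d), is bounded up to a constant by its value at
    every point; this is used twice. Applied at all points it bounds |P| from above by the power
    -1/delta of that mean, which is A_p for the p with 1/(p - 1) = delta. Applied at one fixed point
    where P is nonzero while the cube grows, it shows that |P| cannot be small on most of a large
    ball, hence the lower bound on averages. The latter does not involve p and so combines with
    whatever p the hypothesis |P| in A_p provides. In the Chebyshev step each dyadic scale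
    contributes 2^n from the radius and 2^(-np/(p-1)) from the threshold, so the series has ratio
    2^(-n/(p-1)) < 1; the loss |m|^(-np) costs s = np derivatives. On the torus no integral is
    formed. The functional with coefficients b sends phi to the sum of (2 pi)^n b(-m) phi^(m), and
    of phi^ only linearity, decay, the action of D_j and convergence of the Fourier series are used;
    limits along an ultrafilter inherit these from the grids. *)

#[local] Arguments Normc.normc : simpl never.

(** * Negative powers of polynomials *)

Section one_dimension.
Context {R : realType}.
Local Notation leb := (@lebesgue_measure R).

(* Unlike powR, for which 0 `^ (- d) = 0, the value at 0 is +oo. *)
Definition invpow (d x : R) : \bar R := if x == 0 then +oo%E else (x `^ (- d))%:E.

Lemma invpow_ge0 d x : (0 <= invpow d x)%E.
Proof. by rewrite /invpow; case: ifP => // _; rewrite lee_fin powR_ge0. Qed.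

Lemma measurable_invpow d : measurable_fun [set: R] (invpow d).
Proof.
apply: measurable_fun_ifT; last 2 first.
- exact: measurable_cst.
- by apply/measurable_EFinP; exact: measurable_powR.
- apply: (measurable_fun_bool true).
  rewrite setTI (_ : _ @^-1` _ = [set 0 : R]); first exact: measurable_set1.
  by apply/seteqP; split => x /=; [move/eqP|move=> ->; rewrite eqxx].
Qed.

(** A dyadic layer decomposition, which turns the integral of x^(-1/2) into a series of interval
    lengths. For x in ]L/4^(k+1), L/4^k] the k-th layer alone suffices, since x^(-1/2) <= 2^(k+1) /
    sqrt L; for x >= L the summand 1 does. At x = 0 all layers are present and the series diverges,
    matching the value +oo. *)
Lemma invpow_half_le (L x : R) : 0 < L -> 0 <= x ->
  (invpow 2^-1 x <= ((Num.sqrt L)^-1)%:E *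
    (1 + \sum_(0 <= k <oo) (2 ^+ k.+1 * (x <= L / 4 ^+ k)%R%:R)%:E))%E.
Proof.
move=> L0 x0.
have t0 k : true -> (0 <= (2 ^+ k.+1 * (x <= L / 4 ^+ k)%R%:R : R)%:E)%E.
  by rewrite lee_fin mulr_ge0// exprn_ge0.
have sL0 : 0 < Num.sqrt L by rewrite sqrtr_gt0.
have tle k : ((2 ^+ k.+1 * (x <= L / 4 ^+ k)%R%:R : R)%:E <=
    \sum_(0 <= k <oo) (2 ^+ k.+1 * (x <= L / 4 ^+ k)%R%:R)%:E)%E.
  rewrite (le_trans _ (nneseries_lim_ge k.+1 (fun k _ => t0 k)))//.
  by rewrite big_nat_recr//= leeDr// sume_ge0// => i _; exact: t0.
have S0 := nneseries_ge0 (fun k (_ : (0 <= k)%N) => t0 k).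
rewrite /invpow; case: ifPn => [/eqP x00|xn0].
  suff -> : (\sum_(0 <= k <oo) (2 ^+ k.+1 * (x <= L / 4 ^+ k)%R%:R)%:E = +oo :> \bar R)%E.
    by rewrite addey// gt0_muley// lte_fin invr_gt0.
  apply/eqyP => A A0; apply: le_trans (tle (Num.truncn A)).
  rewrite lee_fin x00 divr_ge0 ?exprn_ge0 ?(ltW L0)// mulr1.
  have /ltW/le_trans := truncnS_gt A; apply.
  by rewrite -natrX ler_nat ltnW// ltn_expl.
rewrite powRN powR12_sqrt//.
have {}x0 : 0 < x by rewrite lt_neqAle eq_sym xn0.
have sx0 : 0 < Num.sqrt x by rewrite sqrtr_gt0.
have [Lx|xL] := leP L x.
  apply: (@le_trans _ _ (((Num.sqrt L)^-1)%:E * 1)%E).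
    by rewrite mule1 lee_fin lef_pV2 ?posrE// ler_wsqrtr.
  by rewrite lee_pmul2l ?lte_fin ?invr_gt0// leeDl.
have [k /andP[k1 k2]] : exists k, (L / 4 ^+ k.+1 < x <= L / 4 ^+ k).
  have ex : exists k, L / 4 ^+ k.+1 < x.
    exists (Num.truncn (L / x)).
    rewrite ltr_pdivrMr ?exprn_gt0// mulrC -ltr_pdivrMr//.
    have /lt_le_trans := truncnS_gt (L / x); apply.
    by rewrite -natrX ler_nat ltnW// ltn_expl.
  case: (ex_minnP ex) => k kx kmin; exists k; rewrite kx /=.
  case: k {kx} kmin => [_|k kmin]; first by rewrite expr0 divr1 ltW.
  by rewrite leNgt; apply/negP => /kmin; rewrite ltnn.
apply: (@le_trans _ _ (((Num.sqrt L)^-1)%:E * (2 ^+ k.+1)%:E)%E).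
  rewrite -EFinM lee_fin mulrC ler_pdivlMr// mulrC ler_pdivrMr//.
  rewrite -[leLHS]ger0_norm ?sqrtr_ge0// -[leRHS]ger0_norm ?mulr_ge0 ?sqrtr_ge0 ?exprn_ge0//.
  rewrite -ler_sqr ?nnegrE// ?normr_ge0// !real_normK ?num_real//.
  rewrite exprMn !sqr_sqrtr ?ltW// -exprM mulnC exprM (_ : 2 ^+ 2 = 4 :> R); last by rewrite expr2 -natrM.
  by rewrite -ltr_pdivrMl ?exprn_gt0// mulrC.
rewrite lee_pmul2l ?lte_fin ?invr_gt0//.
apply: (@le_trans _ _ (2 ^+ k.+1 * (x <= L / 4 ^+ k)%R%:R)%:E).
  by rewrite k2 mulr1.
by apply: le_trans (tle k) _; rewrite leeDr.
Qed.

(** With L = b - a, layer k is an interval of length 2L/4^k and weight 2^(k+1), so it contributes at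
    most 8L/2^(k+1), and all layers together 8L. The summand 1 adds L, whence 9L / sqrt L. *)
Lemma integral_invpow_half (mu a b : R) : a < b ->
  (\int[leb]_(t in `[a, b]) invpow 2^-1 `|t - mu|%R <= (9 * Num.sqrt (b - a))%:E)%E.
Proof.
move=> ab; pose L := b - a.
have L0 : 0 < L by rewrite subr_gt0.
have sL0 : 0 < Num.sqrt L by rewrite sqrtr_gt0.
pose F k := [set` `[mu - L / 4 ^+ k, mu + L / 4 ^+ k]] : set R.
pose f k t : \bar R := ((2 ^+ k.+1)%:E * (\1_(F k) t)%:E)%E.
have mF k : measurable (F k) by exact: measurable_itv.
have f0 k t : (0 <= f k t)%E by rewrite mule_ge0// lee_fin ?exprn_ge0.
have mI k : measurable_fun `[a, b] (fun t => (\1_(F k) t : R)%:E).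
  by apply/measurable_EFinP; exact: measurable_indic.
have mf k : measurable_fun `[a, b] (f k).
  by apply: emeasurable_funM; [exact: measurable_cst|exact: mI].
have E t : (\sum_(0 <= k <oo) (2 ^+ k.+1 * (`|t - mu| <= L / 4 ^+ k)%R%:R)%:E
            = \sum_(0 <= k <oo) f k t)%E.
  apply: eq_eseriesr => k _; rewrite /f -EFinM; congr (_ * _%:R)%:E.
  rewrite /F mem_setE in_itv /= ler_distl; congr andb.
have mS : measurable_fun `[a, b] (fun t => \sum_(0 <= k <oo) f k t)%E.
  exact: ge0_emeasurable_sum.
apply: (@le_trans _ _ (\int[leb]_(t in `[a, b]) (((Num.sqrt L)^-1)%:E *
     (1 + \sum_(0 <= k <oo) f k t)))%E).
  apply: ge0_le_integral => //.
  - by move=> t _; exact: invpow_ge0.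
  - apply: measurable_funTS; apply: (measurableT_comp (measurable_invpow _)).
    by apply: measurableT_comp => //; exact: measurable_funB.
  - apply: emeasurable_funM; first exact: measurable_cst.
    by apply: emeasurable_funD.
  - by move=> t _; rewrite -E; exact: invpow_half_le.
rewrite ge0_integralZl//; last 2 first.
- exact: emeasurable_funD.
- by move=> t _; rewrite adde_ge0// nneseries_ge0.
rewrite ge0_integralD//; last first.
  by move=> t _; rewrite nneseries_ge0.
rewrite integral_cst// mul1e [X in (X + _)%E](_ : _ = L%:E); last first.
  by rewrite /= lebesgue_measure_itv/= lte_fin ab EFinB.
rewrite integral_nneseries//.
apply: (@le_trans _ _ ((Num.sqrt L)^-1%:E * (L%:E + (8 * L)%:E))%E); last first.
  rewrite -EFinD -EFinM lee_fin -{3}(sqr_sqrtr (ltW L0)) -{2}(sqr_sqrtr (ltW L0)).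
  rewrite (_ : _ + _ = Num.sqrt L * (9 * Num.sqrt L)); last by ring.
  by rewrite mulKf// gt_eqF.
rewrite lee_pmul2l ?lte_fin ?invr_gt0//; apply: leeD => //.
have <- : (\sum_(0 <= k <oo) (8 * L / (2 ^ k.+1)%:R)%:E = (8 * L)%:E)%E.
  have := @cvg_geometric_eseries_half R (8 * L) 0.
  by rewrite expr0 divr1 => /(cvg_lim (@ereal_hausdorff R)) <-; apply: eq_eseriesr => k _; rewrite addn1.
apply: lee_nneseries => k _; first by rewrite integral_ge0.
rewrite /f ge0_integralZl ?lee_fin ?exprn_ge0//; last exact: mI.
rewrite integral_indic//; last exact: mF.
apply: (@le_trans _ _ ((2 ^+ k.+1)%:E * leb (F k))%E).
  rewrite lee_pmul2l ?lte_fin ?exprn_gt0//.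
  apply: le_measure; [rewrite inE; apply: measurableI => //; exact: mF|rewrite inE; exact: mF|exact: subIsetl].
rewrite /F lebesgue_measure_itv/= lte_fin ltrD2l.
rewrite gt0_cp ?divr_gt0 ?exprn_gt0// -EFinB -EFinM lee_fin.
rewrite natrX (_ : 4 ^+ k = 2 ^+ k * 2 ^+ k :> R); last by rewrite -exprMn -natrM.
by rewrite le_eqVlt !exprS; apply/orP; left; apply/eqP; field; rewrite gt_eqF ?exprn_gt0.
Qed.

Lemma invpow_antimono d (x y : R) : 0 <= d -> 0 <= x -> x <= y ->
  (invpow d y <= invpow d x)%E.
Proof.
move=> d0 x0 xy; rewrite /invpow; case: (eqVneq x 0) => [_|xn0]; first by rewrite leey.
have {}x0 : 0 < x by rewrite lt_neqAle eq_sym xn0.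
have y0 := lt_le_trans x0 xy; rewrite gt_eqF//= lee_fin !powRN.
by rewrite lef_pV2 ?posrE ?powR_gt0// ge0_ler_powR// nnegrE ltW.
Qed.

Lemma normc_ge_Re (x : R[i]) : `|complex.Re x| <= Normc.normc x.
Proof.
case: x => a b; rewrite /Normc.normc -sqrtr_sqr; apply: ler_wsqrtr.
by rewrite lerDl sqr_ge0.
Qed.

Lemma normc_real (x : R) : Normc.normc (x%:C)%C = `|x|.
Proof. by rewrite /Normc.normc/= expr0n/= addr0 sqrtr_sqr. Qed.

Lemma normc_ge0 (x : R[i]) : 0 <= Normc.normc x.
Proof. by case: x => a b; exact: sqrtr_ge0. Qed.

Lemma normc_eq0 (x : R[i]) : (Normc.normc x == 0) = (x == 0).
Proof.
by apply/eqP/eqP => [/Normc.eq0_normc//|->]; rewrite Normc.normc0.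
Qed.

Lemma measurable_normc d (T : measurableType d) (D : set T) (f : T -> R[i]) :
  measurable_fun D (fun x => complex.Re (f x)) ->
  measurable_fun D (fun x => complex.Im (f x)) ->
  measurable_fun D (fun x => Normc.normc (f x)).
Proof.
move=> mr mi.
rewrite (_ : (fun x => _) = Num.sqrt \o
  (fun x => complex.Re (f x) ^+ 2 + complex.Im (f x) ^+ 2)); last first.
  by apply/funext => x /=; case: (f x).
apply: (measurableT_comp (continuous_measurable_fun (@sqrt_continuous R))).
by apply: measurable_funD; exact: measurable_funX.
Qed.

Lemma measurable_normc_real (la : R[i]) :
  measurable_fun [set: R] (fun t : R => Normc.normc (t%:C%C - la)%R).
Proof.
by case: la => u v; apply: measurable_normc => /=; exact: measurable_funB.
Qed.

Lemma measurable_horner_re_im (q : {poly R[i]}) :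
  measurable_fun [set: R] (fun t : R => complex.Re q.[t%:C%C]) /\
  measurable_fun [set: R] (fun t : R => complex.Im q.[t%:C%C]).
Proof.
elim/poly_ind: q => [|q c [IHr IHi]].
  by split; under eq_fun do rewrite horner0; exact: measurable_cst.
have E (t : R) : q.[t%:C%C] * t%:C%C + c =
   Complex (complex.Re q.[t%:C%C] * t + complex.Re c)
           (complex.Im q.[t%:C%C] * t + complex.Im c).
  case: (q.[_]) => u v; case: c => e f; apply/eqP; rewrite eq_complex /=.
  by apply/andP; split; apply/eqP; ring.
split; under eq_fun do rewrite hornerMXaddC E/=;
  by apply: measurable_funD => //; exact: measurable_funM.
Qed.

Lemma measurable_normc_poly (q : {poly R[i]}) :
  measurable_fun [set: R] (fun t : R => Normc.normc q.[t%:C%C]).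
Proof.
by have [] := measurable_horner_re_im q; exact: measurable_normc.
Qed.

(** Let L = b - a. Far from the root, |z - la| >= 2L, the triangle inequality makes |t - la|
    comparable with |z - la|, and the integrand is at most 2. Close to it, sqrt |z - la| <= 2 sqrt
    L, and [la] may be replaced by its real part, which only decreases |t - la|; then 18 = 2 * 9. *)
Lemma integral_factor (la : R[i]) (a b z : R) : a < b -> a <= z <= b ->
  (\int[leb]_(t in `[a, b]) ((Num.sqrt (Normc.normc (z%:C%C - la)%R))%:E *
      invpow 2^-1 (Normc.normc (t%:C%C - la)%R)) <= (18 * (b - a))%:E)%E.
Proof.
move=> ab /andP[az zb]; pose L := b - a.
have L0 : 0 < L by rewrite subr_gt0.
set rho := Normc.normc (z%:C%C - la)%R.
have mi : measurable_fun `[a, b] (fun t => invpow 2^-1 (Normc.normc (t%:C%C - la)%R)).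
  apply: measurable_funTS; apply: (measurableT_comp (measurable_invpow _)).
  exact: measurable_normc_real.
have rho0 : 0 <= rho by exact: normc_ge0.
have [Lrho|rhoL] := leP (2 * L) rho.
  apply: (@le_trans _ _ (\int[leb]_(t in `[a, b]) 2%:E)%E); last first.
    rewrite integral_cst//= lebesgue_measure_itv/= lte_fin ab -EFinB -EFinM lee_fin.
    by rewrite ler_wpM2r// ?ler_nat// ltW.
  apply: ge0_le_integral => //.
  - by move=> t _; rewrite mule_ge0 ?invpow_ge0// lee_fin sqrtr_ge0.
  - by apply: emeasurable_funM => //; exact: measurable_cst.
  move=> t /=; rewrite in_itv/= => /andP[at' tb].
  have r0 : 0 < rho by apply: lt_le_trans Lrho; rewrite mulr_gt0.
  have h : rho / 4 <= Normc.normc (t%:C%C - la)%R.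
    have := le_normcD (t%:C%C - la)%R (z - t)%:C%C.
    rewrite normc_real (_ : t%:C%C - la + (z - t)%:C%C = z%:C%C - la); last first.
    by case: (la) => u v; apply/eqP; rewrite eq_complex /=; apply/andP; split; apply/eqP; ring.
    rewrite -/rho => h; have : `|z - t| <= L.
      by rewrite ler_norml /L; apply/andP; split; lra.
    by lra.
  apply: (@le_trans _ _ ((Num.sqrt rho)%:E * invpow 2^-1 (rho / 4))%E).
    by rewrite lee_wpmul2l ?lee_fin ?sqrtr_ge0// invpow_antimono// ?divr_ge0.
  rewrite /invpow mulf_eq0 invr_eq0 pnatr_eq0 orbF gt_eqF// -EFinM lee_fin.
  rewrite powRN powR12_sqrt ?divr_ge0// sqrtrM// sqrtrV//.
  rewrite (_ : 4 = 2 ^+ 2 :> R); last by rewrite expr2 -natrM.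
  rewrite sqrtr_sqr ger0_norm// invfM invrK mulrA mulfV ?mul1r//.
  by rewrite gt_eqF// sqrtr_gt0.
apply: (@le_trans _ _ (\int[leb]_(t in `[a, b])
    ((2 * Num.sqrt L)%:E * invpow 2^-1 `|t - complex.Re la|%R))%E).
  have c0 : 0 <= 2 * Num.sqrt L by rewrite mulr_ge0 ?sqrtr_ge0.
  have mi' : measurable_fun `[a, b] (fun t : R => invpow 2^-1 `|t - complex.Re la|%R).
    apply: measurable_funTS; apply: (measurableT_comp (measurable_invpow _)).
    by apply: measurableT_comp => //; exact: measurable_funB.
  apply: ge0_le_integral => //.
  - by move=> t _; rewrite mule_ge0 ?invpow_ge0// lee_fin sqrtr_ge0.
  - by apply: emeasurable_funM => //; exact: measurable_cst.
  - by apply: emeasurable_funM => //; exact: measurable_cst.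
  move=> t _; apply: lee_pmul; rewrite ?lee_fin ?sqrtr_ge0 ?invpow_ge0//.
    rewrite -[leRHS]ger0_norm// -sqrtr_sqr; apply: ler_wsqrtr.
    by rewrite exprMn sqr_sqrtr ?ltW// -natrX; nra.
  apply: invpow_antimono => //.
  by apply: le_trans (normc_ge_Re _); case: (la).
rewrite ge0_integralZl; [|by []| | |by rewrite lee_fin mulr_ge0 ?sqrtr_ge0]; last 2 first.
- apply: measurable_funTS; apply: (measurableT_comp (measurable_invpow _)).
  by apply: measurableT_comp => //; exact: measurable_funB.
- by move=> t _; exact: invpow_ge0.
apply: (@le_trans _ _ ((2 * Num.sqrt L)%:E * (9 * Num.sqrt L)%:E)%E).
  rewrite lee_wpmul2l ?lee_fin ?mulr_ge0 ?sqrtr_ge0//.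
  exact: integral_invpow_half.
rewrite -EFinM lee_fin (_ : 2 * Num.sqrt L * (9 * Num.sqrt L) = 18 * Num.sqrt L ^+ 2); last by ring.
by rewrite sqr_sqrtr// ltW.
Qed.

Lemma normc_prod (I : Type) (r : seq I) (F : I -> R[i]) :
  Normc.normc (\prod_(i <- r) F i) = \prod_(i <- r) Normc.normc (F i).
Proof.
by elim/big_rec2 : _ => [|i x y _ <-]; [rewrite Normc.normc1|rewrite Normc.normcM].
Qed.

Lemma powR_inv (x y : R) : 0 <= x -> (x^-1) `^ y = (x `^ y)^-1.
Proof. by move=> x0; rewrite -powR_inv1// -powRrM mulN1r powRN. Qed.

(** With A_la = sqrt (|z - la| / |t - la|), the quotient |q(z)| / |q(t)| is the square of the
    product of the A_la. Each A_la is at most M = 1 + sum of the A_la, and M >= 1 makes up for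
    missing roots, so the quotient is at most M^(2d); its power 1/(2d) is the claim. *)
Lemma invpow_poly_le (d : nat) (q : {poly R[i]}) (z : R) : (0 < d)%N ->
  (size q <= d.+1)%N -> q.[z%:C%C] != 0 ->
  exists r : seq R[i], (size r <= d)%N /\ forall t : R,
  (invpow (2 * d%:R)^-1 (Normc.normc q.[t%:C%C]) <=
    invpow (2 * d%:R)^-1 (Normc.normc q.[z%:C%C]) *
    (1 + \sum_(la <- r) ((Num.sqrt (Normc.normc (z%:C%C - la)%R))%:E *
      invpow 2^-1 (Normc.normc (t%:C%C - la)%R))))%E.
Proof.
move=> d0 sq qz0.
have [r qE] := closed_field_poly_normal q.
have lc0 : lead_coef q != 0.
  by rewrite lead_coef_eq0; apply: contra_neq qz0 => ->; rewrite horner0.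
have sr : (size r <= d)%N.
  by move: sq; rewrite qE size_scale// size_prod_XsubC.
have qv (s : R[i]) : q.[s] = lead_coef q * \prod_(la <- r) (s - la).
  rewrite {1}qE hornerZ horner_prod; congr (_ * _).
  by apply: eq_bigr => la _; rewrite hornerXsubC.
exists r; split=> // t.
have S0 : (0 <= \sum_(la <- r) ((Num.sqrt (Normc.normc (z%:C%C - la)%R))%:E *
      invpow 2^-1 (Normc.normc (t%:C%C - la)%R)))%E.
  by apply: sume_ge0 => la _; rewrite mule_ge0 ?invpow_ge0// lee_fin sqrtr_ge0.
have nz0 : 0 < Normc.normc q.[z%:C%C].
  by rewrite lt_neqAle normc_ge0 eq_sym normc_eq0 qz0.
have zr la : la \in r -> 0 < Normc.normc (z%:C%C - la).
  move=> lar; rewrite lt_neqAle normc_ge0 eq_sym normc_eq0 andbT.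
  apply: contra_neq qz0 => zla; rewrite qv (big_rem la)//= zla mul0r mulr0//.
have ipz : (0 < invpow (2 * d%:R)^-1 (Normc.normc q.[z%:C%C]))%E.
  by rewrite /invpow gt_eqF// lte_fin powR_gt0.
(* At a root t of q the sum contains the value +oo of [invpow] at 0, with a positive coefficient
   because z is not a root. *)
have [tr|tnr] := boolP (t%:C%C \in r).
  rewrite (_ : \sum_(la <- r) _ = +oo)%E ?addey// ?gt0_muley ?leey//.
  rewrite (big_rem _ tr)/=.
  have -> : invpow 2^-1 (Normc.normc (t%:C%C - t%:C%C)) = +oo%E.
    by rewrite subrr Normc.normc0 /invpow eqxx.
  rewrite gt0_muley; last first.
    by rewrite lte_fin sqrtr_gt0; apply: zr.
  rewrite addye// gt_eqF// (lt_le_trans (ltNy0))//.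
  by apply: sume_ge0 => la _; rewrite mule_ge0 ?invpow_ge0// lee_fin sqrtr_ge0.
have tr la : la \in r -> 0 < Normc.normc (t%:C%C - la).
  move=> lar; rewrite lt_neqAle normc_ge0 eq_sym normc_eq0 andbT.
  by rewrite subr_eq0; apply: contraNneq tnr => ->.
pose A la := Num.sqrt (Normc.normc (z%:C%C - la) / Normc.normc (t%:C%C - la)).
pose M := 1 + \sum_(la <- r) A la.
have A0 la : 0 <= A la by exact: sqrtr_ge0.
have -> : (1 + \sum_(la <- r) ((Num.sqrt (Normc.normc (z%:C%C - la)%R))%:E *
      invpow 2^-1 (Normc.normc (t%:C%C - la)%R)) = M%:E)%E.
  rewrite /M EFinD -sumEFin; congr (_ + _)%E; apply: eq_big_seq => la lar.
  rewrite /invpow gt_eqF ?tr// -EFinM; congr (_%:E).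
  by rewrite powRN powR12_sqrt ?normc_ge0// /A sqrtrM ?normc_ge0// sqrtrV ?normc_ge0.
have M1 : 1 <= M by rewrite lerDl sumr_ge0.
have AM la : la \in r -> A la <= M.
  move=> lar; rewrite /M (big_rem la)//= addrCA lerDl addr_ge0// sumr_ge0//.
have nt0 : 0 < Normc.normc q.[t%:C%C].
  rewrite qv Normc.normcM normc_prod mulr_gt0//.
    by rewrite lt_neqAle normc_ge0 eq_sym normc_eq0 lc0.
  by rewrite big_seq prodr_gt0.
have pA : \prod_(la <- r) A la <= M ^+ d.
  apply: (@le_trans _ _ (\prod_(la <- r) M)).
    by rewrite big_seq [leRHS]big_seq; apply: ler_prod => la lar; rewrite A0 AM.
  by rewrite big_const_seq count_predT iter_mulr_1 ler_weXn2l.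
have qtz : Normc.normc q.[z%:C%C] / Normc.normc q.[t%:C%C] <= M ^+ (2 * d).
  rewrite !qv !Normc.normcM !normc_prod invfM mulrACA mulfV ?mul1r; last first.
    by rewrite normc_eq0.
  rewrite -prodfV -big_split/= mulnC exprM.
  apply: le_trans (_ : (\prod_(la <- r) A la) ^+ 2 <= _); last first.
    by rewrite lerXn2r// nnegrE ?prodr_ge0// exprn_ge0// (le_trans _ M1).
  rewrite -prodrXl le_eqVlt; apply/orP; left; apply/eqP.
  by apply: eq_bigr => la _; rewrite sqr_sqrtr// divr_ge0// normc_ge0.
rewrite /invpow !gt_eqF// -EFinM lee_fin !powRN.
set dl := (2 * d%:R)^-1.
have dl0 : 0 <= dl by rewrite invr_ge0 mulr_ge0.
rewrite mulrC ler_pdivlMr ?powR_gt0// mulrC -powR_inv ?normc_ge0//.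
rewrite -powRM ?normc_ge0 ?invr_ge0 ?normc_ge0//.
apply: le_trans (_ : (M ^+ (2 * d)) `^ dl <= _).
  apply: ge0_ler_powR; rewrite ?nnegrE//.
    by rewrite divr_ge0// normc_ge0.
  by rewrite exprn_ge0// (le_trans _ M1).
have M0 : 0 <= M := le_trans ler01 M1.
have d2 : 2 * d%:R != 0 :> R by rewrite mulf_neq0 ?pnatr_eq0 -?lt0n.
by rewrite -powR_mulrn// -powRrM natrM mulfV// powRr1.
Qed.

Lemma integral_invpow_poly (d : nat) (q : {poly R[i]}) (a b z : R) : (0 < d)%N ->
  (size q <= d.+1)%N -> a < b -> a <= z <= b ->
  (\int[leb]_(t in `[a, b]) invpow (2 * d%:R)^-1 (Normc.normc q.[t%:C%C]) <=
   ((1 + 18 * d%:R) * (b - a))%:E * invpow (2 * d%:R)^-1 (Normc.normc q.[z%:C%C]))%E.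
Proof.
move=> d0 sq ab azb; have L0 : 0 < b - a by rewrite subr_gt0.
have K0 : 0 < (1 + 18 * d%:R) * (b - a).
  by rewrite mulr_gt0// ltr_pwDl// mulr_ge0.
have [qz0|qz0] := eqVneq q.[z%:C%C] 0.
  by rewrite {2}/invpow qz0 Normc.normc0 eqxx gt0_muley ?leey// lte_fin.
have [r [sr rP]] := invpow_poly_le d0 sq qz0.
have mi (la : R[i]) : measurable_fun `[a, b]
    (fun t : R => invpow 2^-1 (Normc.normc (t%:C%C - la))).
  apply: measurable_funTS; apply: (measurableT_comp (measurable_invpow _)).
  exact: measurable_normc_real.
set s := fun la => (Num.sqrt (Normc.normc (z%:C%C - la)%R)).
have s0 la : (0 <= (s la)%:E)%E by rewrite lee_fin sqrtr_ge0.
have mi2 la : measurable_fun `[a, b]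
    (fun t : R => (s la)%:E * invpow 2^-1 (Normc.normc (t%:C%C - la)%R))%E.
  by apply: emeasurable_funM => //; exact: measurable_cst.
have i0 la (t : R) : (0 <= (s la)%:E * invpow 2^-1 (Normc.normc (t%:C%C - la)%R))%E.
  by rewrite mule_ge0// invpow_ge0.
have mS : measurable_fun `[a, b]
    (fun t : R => \sum_(la <- r) ((s la)%:E * invpow 2^-1 (Normc.normc (t%:C%C - la)%R)))%E.
  exact: emeasurable_sum.
apply: (@le_trans _ _ (\int[leb]_(t in `[a, b])
  (invpow (2 * d%:R)^-1 (Normc.normc q.[z%:C%C]) *
    (1 + \sum_(la <- r) ((s la)%:E * invpow 2^-1 (Normc.normc (t%:C%C - la)%R)))))%E).
  apply: ge0_le_integral => //.
  - by move=> t _; exact: invpow_ge0.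
  - apply: measurable_funTS; apply: (measurableT_comp (measurable_invpow _)).
    exact: measurable_normc_poly.
  - apply: emeasurable_funM; first exact: measurable_cst.
    by apply: emeasurable_funD; first exact: measurable_cst.
rewrite ge0_integralZl; [|by []| | |exact: invpow_ge0]; last 2 first.
- by apply: emeasurable_funD; first exact: measurable_cst.
- by move=> t _; rewrite adde_ge0// sume_ge0.
rewrite muleC lee_wpmul2r ?invpow_ge0//.
rewrite ge0_integralD//; last by move=> t _; rewrite sume_ge0.
rewrite integral_cst// mul1e [X in (X + _)%E](_ : _ = (b - a)%:E); last first.
  by rewrite /= lebesgue_measure_itv/= lte_fin ab EFinB.
rewrite ge0_integral_sum//.
apply: (@le_trans _ _ ((b - a)%:E + \sum_(la <- r) (18 * (b - a))%:E)%E).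
  by rewrite leeD2l//; apply: lee_sum => la _; exact: integral_factor.
rewrite sumEFin -EFinD lee_fin big_const_seq count_predT iter_addr_0.
have : (size r)%:R <= d%:R :> R by rewrite ler_nat.
by rewrite -mulr_natr; nra.
Qed.

End one_dimension.

(** The integral of a nonnegative function is a supremum over the simple functions below it, so
    domination carries over directly. This serves for inner integrals, whose measurability in the
    outer variable would otherwise have to be shown. *)
Lemma le_ge0_integral d (T : measurableType d) (R : realType)
    (mu : {measure set T -> \bar R}) (D : set T) (f g : T -> \bar R) :
  (forall x, D x -> 0 <= f x)%E -> (forall x, D x -> f x <= g x)%E ->
  (\int[mu]_(x in D) f x <= \int[mu]_(x in D) g x)%E.
Proof.
move=> f0 fg.
have g0 x : D x -> (0 <= g x)%E by move=> Dx; rewrite (le_trans (f0 _ Dx))// fg.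
rewrite !ge0_integralE//; apply: le_ereal_sup => _ [h hf <-].
exists h => // x; apply: le_trans (hf x) _; rewrite !patchE.
by case: ifPn => // /set_mem; exact: fg.
Qed.

(** * Lebesgue measure on R^n: boxes, Tonelli one variable at a time, cubes *)

Section lebesgue_measure_rV.
Context {R : realType}.
Local Notation leb := (@lebesgue_measure R).
Local Notation lebn := (@lebesgue_rV R).

Lemma prodEFin (I : Type) (r : seq I) (P : pred I) (F : I -> R) :
  (\prod_(i <- r | P i) (F i)%:E)%E = (\prod_(i <- r | P i) F i)%:E.
Proof. by rewrite (big_morph EFin (@EFinM _) erefl). Qed.

Definition box n (I : 'I_n -> set R) : set 'rV[R]_n :=
  [set x | forall j, I j (x ord0 j)].

Lemma measurable_box n (I : 'I_n -> set R) : (forall j, measurable (I j)) ->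
  measurable (box I).
Proof.
move=> mI; rewrite (_ : box I = \bigcap_(j in [set: 'I_n]) ((fun x : 'rV[R]_n => x ord0 j) @^-1` I j)).
  apply: fin_bigcap_measurable => [|j _]; first exact: finite_finset.
  by rewrite -[X in measurable X]setTI; exact: (measurable_coord j).
by apply/seteqP; split => x h j; [move=> _; exact: (h j)|exact: (h j Logic.I)].
Qed.

Lemma consrV0 n (t : R) (y : 'rV[R]_n) : consrV (t, y) ord0 ord0 = t.
Proof.
rewrite /consrV (_ : ord0 = lshift n (ord0 : 'I_1)); last exact: val_inj.
by rewrite (@row_mxEl _ 1 1 n) !mxE eqxx mulr1n.
Qed.

Lemma consrV_lift n (t : R) (y : 'rV[R]_n) j :
  consrV (t, y) ord0 (lift ord0 j) = y ord0 j.
Proof.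
rewrite /consrV (_ : lift ord0 j = rshift 1 j); last exact: val_inj.
by rewrite (@row_mxEr _ 1 1 n).
Qed.

Lemma consrV_eta n (x : 'rV[R]_n.+1) :
  x = consrV (x ord0 ord0, \row_j x ord0 (lift ord0 j)).
Proof.
apply/rowP => i; have [j ->|->] := unliftP ord0 i.
  by rewrite consrV_lift mxE.
by rewrite consrV0.
Qed.

Lemma preimage_consrV_box n (I : 'I_n.+1 -> set R) :
  @consrV R n @^-1` box I = I ord0 `*` box (fun j => I (lift ord0 j)).
Proof.
apply/seteqP; split => [[t y] h|[t y] [h0 h] j] /=.
  split => [|j] /=; first by have := h ord0; rewrite consrV0.
  by have := h (lift ord0 j); rewrite consrV_lift.
by have [i ->|->] := unliftP ord0 j; rewrite ?consrV0 ?consrV_lift//; exact: h.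
Qed.

Lemma lebesgue_rVSE n (A : set 'rV[R]_n.+1) :
  lebn n.+1 A = (leb \x^ lebn n)%E (@consrV R n @^-1` A).
Proof. by []. Qed.

Lemma lebesgue_box n (I : 'I_n -> set R) : (forall j, measurable (I j)) ->
  lebn n (box I) = (\prod_j leb (I j))%E.
Proof.
elim: n I => [|n IHn] I mI.
  rewrite big_ord0 /= diracE mem_set//.
  by case.
rewrite lebesgue_rVSE preimage_consrV_box product_measure2E; [|exact: mI|exact: (measurable_box (fun j => mI _))].
by rewrite big_ord_recl IHn.
Qed.

Lemma sigma_finite_lebesgue_rV n : sigma_finite [set: 'rV[R]_n] (lebn n).
Proof.
exists (fun k => box (fun _ : 'I_n => [set` `[- k%:R, k%:R]] : set R)).
  rewrite predeqE => x; split => // _.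
  exists (Num.truncn (\sum_j `|x ord0 j|)).+1 => // j /=.
  rewrite in_itv/= -ler_norml; apply: le_trans (ltW (truncnS_gt _)).
  by rewrite (bigD1 j)//= lerDl sumr_ge0.
move=> k; split; first by apply: measurable_box.
rewrite lebesgue_box//.
have [r r0 ->] : exists2 r : R, 0 <= r & leb [set` `[- k%:R, k%:R]] = r%:E.
  rewrite lebesgue_measure_itv/= lte_fin; case: ifP => h; last by exists 0.
  by exists (k%:R - - k%:R); [rewrite subr_ge0 ltW|rewrite EFinB].
by rewrite prodEFin ltry.
Qed.

(* A name for the underlying set function, to hang the sigma-finite structure on. *)
Definition lebn_fun n : set 'rV[R]_n -> \bar R := lebn n.

HB.instance Definition _ n := Measure.copy (@lebn_fun n) (lebn n).
HB.instance Definition _ n := Measure_isSigmaFinite.Build _ _ _ (@lebn_fun n)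
  (sigma_finite_lebesgue_rV n).

(** Tonelli is applied to the product [\x], whereas [lebesgue_rV] is built on [\x^]. The two agree
    on rectangles, hence on all measurable sets by sigma-finiteness. *)
Lemma integral_lebesgue_rVS n (f : 'rV[R]_n.+1 -> \bar R) :
  measurable_fun [set: 'rV[R]_n.+1] f -> (forall x, 0 <= f x)%E ->
  (\int[lebn n.+1]_x f x =
   \int[lebn n]_y \int[leb]_t f (consrV (t, y)))%E.
Proof.
move=> mf f0.
have mF : measurable_fun [set: R * 'rV[R]_n] (f \o @consrV R n).
  exact: measurableT_comp (@measurable_consrV R n).
pose mu' := measure_function_pushforward__canonical__measure_function_Measure
  (leb \x @lebn_fun n)%E (@measurable_consrV R n).
transitivity (\int[mu']_x f x)%E.
  apply: eq_measure_integral => A mA _; apply/esym.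
  apply: (@product_measure_unique _ _ _ _ R leb (@lebn_fun n) (leb \x^ lebn n)%E) => //.
    by move=> ? ? ? ?; exact: product_measure2E.
  by rewrite -[X in measurable X]setTI; exact: measurable_consrV.
rewrite ge0_integral_pushforward//.
have := @fubini_tonelli2 _ _ _ _ R leb (@lebn_fun n) _ mF (fun x => f0 (consrV x)).
by rewrite preimage_setT => H; exact: H.
exact: measurable_consrV.
Qed.

Lemma integral_box_S n (I : 'I_n.+1 -> set R) (f : 'rV[R]_n.+1 -> \bar R) :
  (forall j, measurable (I j)) ->
  measurable_fun [set: 'rV[R]_n.+1] f -> (forall x, 0 <= f x)%E ->
  (\int[lebn n.+1]_(x in box I) f x =
   \int[lebn n]_(y in box (fun j => I (lift ord0 j)))
     \int[leb]_(t in I ord0) f (consrV (t, y)))%E.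
Proof.
move=> mI mf f0.
rewrite integral_mkcond integral_lebesgue_rVS; last 2 first.
- apply/(measurable_restrictT _ _).1; first exact: measurable_box.
  exact: measurable_funTS.
- by move=> x; rewrite patchE; case: ifP.
rewrite [RHS]integral_mkcond; apply: eq_integral => y _.
have E t : (consrV (t, y) \in box I) =
    (t \in I ord0) && (y \in box (fun j => I (lift ord0 j))).
  apply/idP/andP; rewrite !inE => h.
    by have : (@consrV R n @^-1` box I) (t, y) by []; rewrite preimage_consrV_box.
  by suff: (@consrV R n @^-1` box I) (t, y) by []; rewrite preimage_consrV_box.
rewrite patchE; case: ifPn => yI.
  rewrite [RHS]integral_mkcond; apply: eq_integral => t _.
  by rewrite !patchE E yI andbT.
by apply: integral0_eq => t _; rewrite patchE E (negbTE yI) andbF.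
Qed.

Definition upd n (x : 'rV[R]_n) (j : 'I_n) (t : R) : 'rV[R]_n :=
  \row_i (if i == j then t else x ord0 i).

(** Only the degree in each single variable is recorded: this survives fixing a coordinate, so
    induction on the dimension goes through without iterated polynomial rings. *)
Definition sep_poly (d : nat) n (f : 'rV[R]_n -> R[i]) : Prop :=
  forall x j, exists q : {poly R[i]},
    (size q <= d.+1)%N /\ forall t, f (upd x j t) = q.[t%:C%C].

Lemma consrV_upd0 n t (y : 'rV[R]_n) : consrV (t, y) = upd (consrV (0, y)) ord0 t.
Proof.
apply/rowP => i; rewrite [RHS]mxE; have [j ->|->] := unliftP ord0 i.
  by rewrite !consrV_lift eq_sym (negbTE (neq_lift _ _)).
by rewrite consrV0 eqxx.
Qed.

Lemma consrV_updS n t s (y : 'rV[R]_n) j :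
  consrV (t, upd y j s) = upd (consrV (t, y)) (lift ord0 j) s.
Proof.
apply/rowP => i; rewrite [RHS]mxE; have [k ->|->] := unliftP ord0 i.
  by rewrite !consrV_lift mxE (inj_eq lift_inj).
by rewrite !consrV0 (negbTE (neq_lift _ _)).
Qed.

Lemma sep_poly_consrV d n (f : 'rV[R]_n.+1 -> R[i]) t :
  sep_poly d f -> sep_poly d (fun y => f (consrV (t, y))).
Proof.
move=> sf y j; have [q [sq qE]] := sf (consrV (t, y)) (lift ord0 j).
by exists q; split => // s; rewrite consrV_updS.
Qed.

Definition cube n (c : 'rV[R]_n) (r : R) : set 'rV[R]_n :=
  box (fun j => [set` `[c ord0 j - r, c ord0 j + r]]).

Lemma measurable_cube n (c : 'rV[R]_n) r : measurable (cube c r).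
Proof. exact: measurable_box. Qed.

Lemma lebesgue_cube n (c : 'rV[R]_n) r : 0 <= r ->
  lebn n (cube c r) = ((2 * r) ^+ n)%:E.
Proof.
move=> r0; rewrite lebesgue_box//.
under eq_bigr => j _.
  rewrite lebesgue_measure_itv/= lte_fin.
  rewrite (_ : (if _ then _ else _) = (2 * r)%:E); last first.
    have [->|rn0] := eqVneq r 0; first by rewrite subr0 addr0 ltxx mulr0.
    have {}r0 : 0 < r by rewrite lt_neqAle eq_sym rn0.
    by rewrite (_ : _ < _)%R -?EFinB; [congr EFin; ring|lra].
  over.
by rewrite prodEFin prodr_const card_ord.
Qed.

Lemma measurable_fun_consrV d (T : measurableType d) n t (f : 'rV[R]_n.+1 -> T) :
  measurable_fun [set: 'rV[R]_n.+1] f ->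
  measurable_fun [set: 'rV[R]_n] (fun y => f (consrV (t, y))).
Proof.
move=> mf; apply: (measurableT_comp mf).
apply: (measurableT_comp (@measurable_consrV R n)).
exact: measurable_pair1.
Qed.

(** For fixed y the one-variable estimate replaces t by the first coordinate of z, at the cost of
    one factor; what remains is the slice of f through that coordinate, to which the induction
    hypothesis applies. *)
Lemma integral_invpow_cube (d n : nat) (f : 'rV[R]_n -> R[i]) c r z : (0 < d)%N ->
  0 < r -> measurable_fun [set: 'rV[R]_n] (fun x => Normc.normc (f x)) ->
  sep_poly d f -> cube c r z ->
  (\int[lebn n]_(x in cube c r) invpow (2 * d%:R)^-1 (Normc.normc (f x)) <=
   (((1 + 18 * d%:R) * (2 * r)) ^+ n)%:E *
     invpow (2 * d%:R)^-1 (Normc.normc (f z)))%E.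
Proof.
move=> d0 r0; set K := (1 + 18 * d%:R) * (2 * r).
have K0 : 0 <= K by rewrite !mulr_ge0 ?addr_ge0 ?mulr_ge0// ltW.
elim: n f c z => [|n IHn] f c z mf sf cz.
  rewrite expr0 mul1e integral_dirac//=.
  - rewrite diracE mem_set ?mul1e; last by case.
    by rewrite (_ : z = 0)//; apply/rowP; case.
  - exact: measurable_cube.
  - apply: measurable_funTS; exact: (measurableT_comp (measurable_invpow _)).
rewrite /cube integral_box_S//; last 2 first.
- exact: (measurableT_comp (measurable_invpow _)).
- by move=> x; exact: invpow_ge0.
pose z0 := z ord0 ord0; pose z' : 'rV[R]_n := \row_j z ord0 (lift ord0 j).
pose c' : 'rV[R]_n := \row_j c ord0 (lift ord0 j).
have bE : box (fun j => [set` `[c ord0 (lift ord0 j) - r, c ord0 (lift ord0 j) + r]]) = cube c' r.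
  by congr box; apply/funext => j; rewrite mxE.
rewrite bE.
apply: (@le_trans _ _ (\int[lebn n]_(y in cube c' r) (K%:E *
    invpow (2 * d%:R)^-1 (Normc.normc (f (consrV (z0, y))))))%E).
  apply: le_ge0_integral => y _.
    by apply: integral_ge0 => t _; exact: invpow_ge0.
  have [q [sq qE]] := sf (consrV (0, y)) ord0.
  have {}qE t : f (consrV (t, y)) = q.[t%:C%C] by rewrite consrV_upd0 qE.
  under eq_integral do rewrite qE.
  rewrite qE (_ : K = (1 + 18 * d%:R) * (c ord0 ord0 + r - (c ord0 ord0 - r))).
    apply: integral_invpow_poly => //; first by lra.
    by have := cz ord0; rewrite /= in_itv.
  by rewrite /K; congr (_ * _); ring.
have mg : measurable_fun [set: 'rV[R]_n] (fun y => Normc.normc (f (consrV (z0, y)))).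
  exact: (measurable_fun_consrV z0 mf).
rewrite ge0_integralZl; [|exact: measurable_cube| | |by rewrite lee_fin]; last 2 first.
- by apply: measurable_funTS; exact: (measurableT_comp (measurable_invpow _)).
- by move=> y _; exact: invpow_ge0.
rewrite exprS [(K * _)%:E]EFinM -[leRHS]muleA lee_wpmul2l ?lee_fin//.
rewrite (consrV_eta z); apply: (IHn (fun y => f (consrV (z0, y)))) => //.
  exact: sep_poly_consrV.
by move=> j; have := cz (lift ord0 j); rewrite /= !mxE.
Qed.

End lebesgue_measure_rV.

(** * Symbols: measurability, degree in each variable, a point of non-vanishing *)

Section symbols.
Context {R : realType}.
Local Notation lebn := (@lebesgue_rV R).

Lemma symbolE n (P : mpoly.mpoly n R[i]) (x : 'rV[R]_n) :
  symbol P x = \sum_(m <- mpoly.msupp P) mpoly.mcoeff m P * \prod_i (x ord0 i)%:C%C ^+ m i.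
Proof. exact: mpoly.mevalE. Qed.

Definition measurable_complex d (T : measurableType d) (f : T -> R[i]) :=
  measurable_fun [set: T] (fun x => complex.Re (f x)) /\
  measurable_fun [set: T] (fun x => complex.Im (f x)).

Lemma measurable_complex_cst d (T : measurableType d) c :
  measurable_complex (fun _ : T => c).
Proof. by split; exact: measurable_cst. Qed.

Lemma measurable_complexD d (T : measurableType d) (f g : T -> R[i]) :
  measurable_complex f -> measurable_complex g ->
  measurable_complex (fun x => f x + g x).
Proof.
by move=> [fr fi] [gr gi]; split; under eq_fun do rewrite raddfD;
  exact: measurable_funD.
Qed.

Lemma measurable_complexM d (T : measurableType d) (f g : T -> R[i]) :
  measurable_complex f -> measurable_complex g ->
  measurable_complex (fun x => f x * g x).
Proof.
move=> [fr fi] [gr gi]; split.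
  rewrite (_ : (fun x => _) = fun x => complex.Re (f x) * complex.Re (g x) -
      complex.Im (f x) * complex.Im (g x)).
    by apply: measurable_funB; exact: measurable_funM.
  by apply/funext => x; case: (f x); case: (g x).
rewrite (_ : (fun x => _) = fun x => complex.Re (f x) * complex.Im (g x) +
    complex.Im (f x) * complex.Re (g x)).
  by apply: measurable_funD; exact: measurable_funM.
by apply/funext => x; case: (f x); case: (g x).
Qed.

Lemma measurable_complex_sum d (T : measurableType d) (I : Type) (r : seq I)
    (F : I -> T -> R[i]) :
  (forall i, measurable_complex (F i)) ->
  measurable_complex (fun x => \sum_(i <- r) F i x).
Proof.
move=> mF; elim: r => [|i r IHr].
  by under eq_fun do rewrite big_nil; exact: measurable_complex_cst.
by under eq_fun do rewrite big_cons; exact: measurable_complexD.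
Qed.

Lemma measurable_complex_prod d (T : measurableType d) (I : Type) (r : seq I)
    (F : I -> T -> R[i]) :
  (forall i, measurable_complex (F i)) ->
  measurable_complex (fun x => \prod_(i <- r) F i x).
Proof.
move=> mF; elim: r => [|i r IHr].
  by under eq_fun do rewrite big_nil; exact: measurable_complex_cst.
by under eq_fun do rewrite big_cons; exact: measurable_complexM.
Qed.

Lemma measurable_complexX d (T : measurableType d) (f : T -> R[i]) k :
  measurable_complex f -> measurable_complex (fun x => f x ^+ k).
Proof.
move=> mf; elim: k => [|k IHk]; first exact: measurable_complex_cst.
by under eq_fun do rewrite exprS; exact: measurable_complexM.
Qed.

Lemma measurable_symbol n (P : mpoly.mpoly n R[i]) :
  measurable_complex (symbol P).
Proof.
pose F m (x : 'rV[R]_n) := mpoly.mcoeff m P * \prod_i (x ord0 i)%:C%C ^+ m i.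
rewrite (_ : symbol P = fun x => \sum_(m <- mpoly.msupp P) F m x); last first.
  by apply/funext => x; rewrite symbolE.
apply: measurable_complex_sum => m; apply: measurable_complexM.
  exact: measurable_complex_cst.
pose G i (x : 'rV[R]_n) := (x ord0 i)%:C%C ^+ m i.
apply: (@measurable_complex_prod _ _ _ _ G) => i.
apply: (@measurable_complexX _ _ (fun x : 'rV[R]_n => (x ord0 i)%:C%C)).
by split => /=; [exact: measurable_coord|exact: measurable_cst].
Qed.

Lemma measurable_symbol_weight n (P : mpoly.mpoly n R[i]) :
  measurable_fun [set: 'rV[R]_n] (symbol_weight P).
Proof. by have [mr mi] := measurable_symbol P; exact: measurable_normc. Qed.

Lemma sep_poly_symbol n (P : mpoly.mpoly n R[i]) :
  sep_poly (mpoly.mmeasure mpoly.mdeg P) (symbol P).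
Proof.
move=> x j.
exists (\sum_(m <- mpoly.msupp P)
  (mpoly.mcoeff m P * \prod_(i | i != j) (x ord0 i)%:C%C ^+ m i) *: 'X^(m j)).
split.
  rewrite big_seq; apply: (big_ind (fun q : {poly R[i]} => (size q <= _)%N)).
  - by rewrite size_poly0.
  - by move=> p q sp sq; rewrite (leq_trans (size_polyD _ _))// geq_max sp.
  move=> m mP; rewrite (leq_trans (size_scale_leq _ _))// size_polyXn ltnS.
  (* [mmeasure mdeg P] strictly exceeds the degree of every monomial, so it bounds each partial
     degree with one unit to spare. *)
  apply: leq_trans (ltnW (mpoly.msize_mdeg_lt mP)).
  by rewrite mpoly.mdegE (bigD1 j)//= leq_addr.
move=> t; rewrite symbolE horner_sum; apply: eq_bigr => m _.
rewrite hornerZ hornerXn (bigD1 j)//= mxE eqxx mulrCA mulrC; congr (_ * _ * _).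
by apply: eq_bigr => i ij; rewrite mxE (negbTE ij).
Qed.

(** Uniqueness of digits in base D: reduction modulo D isolates the lowest digit, and division by D
    leaves the case of n digits. *)
Lemma expansion_inj (D n : nat) (a b : 'I_n -> nat) :
  (forall i, a i < D)%N -> (forall i, b i < D)%N ->
  (\sum_i a i * D ^ i = \sum_i b i * D ^ i)%N -> a =1 b.
Proof.
elim: n a b => [|n IHn] a b aD bD; first by move=> _ [].
rewrite !big_ord_recl !expn0 !muln1.
have E (c : 'I_n.+1 -> nat) : (\sum_(i < n) c (lift ord0 i) * D ^ (lift ord0 i) =
    (\sum_(i < n) c (lift ord0 i) * D ^ i) * D)%N.
  by rewrite big_distrl; apply: eq_bigr => i _; rewrite /= /bump add1n expnSr mulnA.
rewrite !E => H.
have D0 : (0 < D)%N by apply: leq_ltn_trans (aD ord0).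
have a0 : a ord0 = b ord0.
  by have /(congr1 (modn^~ D)) := H; rewrite -!(addnC (_ * D)%N) !modnMDl !modn_small//.
move: H; rewrite a0 => /addnI /eqP; rewrite eqn_pmul2r// => /eqP /IHn H.
move=> i; have [j ->|->//] := unliftP ord0 i.
by apply: (H (fun i => aD _) (fun i => bD _)).
Qed.

(* Kronecker substitution: setting the j-th variable to t^(D^j), with D above all
   exponents, sends distinct monomials to distinct powers of t. *)
Lemma symbol_neq0 n (P : mpoly.mpoly n R[i]) : P != 0 ->
  exists z, symbol P z != 0.
Proof.
move=> P0; pose D := mpoly.mmeasure (@mpoly.mdeg n) P.
pose e (m : mpoly.multinom n) := (\sum_i m i * D ^ i)%N.
pose q : {poly R[i]} := \sum_(m <- mpoly.msupp P) mpoly.mcoeff m P *: 'X^(e m).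
have degD m : m \in mpoly.msupp P -> forall i, (m i < D)%N.
  move=> mP i; apply: leq_ltn_trans (mpoly.msize_mdeg_lt mP).
  by rewrite mpoly.mdegE (bigD1 i)//= leq_addr.
have [m mP] : exists m, m \in mpoly.msupp P.
  have : mpoly.msupp P != [::] by rewrite mpoly.msupp_eq0.
  by case: mpoly.msupp => // m s _; exists m; rewrite mem_head.
have q0 : q != 0.
  apply: contraTneq mP => q0; rewrite mpoly.mcoeff_msupp negbK.
  have /(congr1 (fun p : {poly R[i]} => p`_(e m))) := q0.
  rewrite coef0 coef_sum big_seq.
  have [mP|/mpoly.memN_msupp_eq0-> //] := boolP (m \in mpoly.msupp P).
  rewrite -big_seq (bigD1_seq m)//= ?mpoly.msupp_uniq// coefZ coefXn eqxx mulr1.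
  rewrite big_seq_cond big1 ?addr0 => [->//|m' /andP[m'P m'm]].
  rewrite coefZ coefXn; case: eqP => [/expansion_inj H|_]; last by rewrite mulr0.
  case/eqP: m'm; apply/mpoly.mnmP => i; apply/esym.
  by apply: H; exact: degD.
apply: contrapT => nz.
have rq (t : R) : root q t%:C%C.
  rewrite /root horner_sum; apply/eqP.
  transitivity (symbol P (\row_i t ^+ (D ^ i))).
    rewrite symbolE; apply: eq_bigr => k _; rewrite hornerZ hornerXn; congr (_ * _).
    rewrite /e -prodrXr; apply: eq_bigr => i _.
    by rewrite mxE rmorphXn/= -exprM mulnC.
  by apply: contrapT => /eqP h; apply: nz; eexists; exact: h.
(* These are [size q] distinct roots, one more than the degree of the nonzero polynomial q
   allows. *)
pose rs := [seq (k%:R : R)%:C%C | k <- iota 0 (size q)].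
have : (size rs < size q)%N.
  apply: max_poly_roots => //; first by apply/allP => _ /mapP[k _ ->].
  rewrite map_inj_uniq ?iota_uniq// => k l /complexI /eqP.
  by rewrite eqr_nat => /eqP.
by rewrite size_map size_iota ltnn.
Qed.

End symbols.

(** * The Muckenhoupt condition *)

Section balls.
Context {R : realType} (n : nat).
Local Notation lebn := (@lebesgue_rV R n).
Implicit Types (c x : 'rV[R]_n) (r : R).

Lemma measurable_eball c r : measurable (eball c r).
Proof.
pose g (x : 'rV[R]_n) := \sum_j (x ord0 j - c ord0 j) ^+ 2.
have mg : measurable_fun [set: 'rV[R]_n] g.
  apply: measurable_sum => j; apply: measurable_funX; apply: measurable_funB.
    exact: measurable_coord.
  exact: measurable_cst.
rewrite (_ : eball c r = [set: 'rV[R]_n] `&` g @^-1` [set` `]-oo, (r ^+ 2)[]).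
  by apply: mg => //; exact: measurable_itv.
by rewrite setTI; apply/seteqP; split => x; rewrite /eball/= in_itv.
Qed.

Lemma eball_sub_cube c r : 0 < r -> eball c r `<=` cube c r.
Proof.
move=> r0 x xr j /=; rewrite in_itv/= -ler_distl.
have : (x ord0 j - c ord0 j) ^+ 2 < r ^+ 2.
  by apply: le_lt_trans xr; rewrite (bigD1 j)//= lerDl sumr_ge0// => i _; exact: sqr_ge0.
by rewrite -ltr_sqrt ?exprn_gt0// !sqrtr_sqr (gtr0_norm r0) => /ltW.
Qed.

Lemma cube_sub_eball c r : (0 < n)%N -> 0 < r ->
  cube c (r / (2 * n%:R)) `<=` eball c r.
Proof.
move=> n0 r0 x xr; have n1 : 1 <= n%:R :> R by rewrite ler1n.
have n0' : 0 < n%:R :> R by rewrite ltr0n.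
apply: (@le_lt_trans _ _ (\sum_(j < n) (r / (2 * n%:R)) ^+ 2)).
  apply: ler_sum => j _; have := xr j; rewrite /= in_itv/= -ler_distl => h.
  rewrite -real_normK ?num_real// lerXn2r ?nnegrE//.
  by rewrite divr_ge0 ?mulr_ge0// ltW.
have [a a0 ->] : exists2 a, 0 < a & r = 2 * n%:R * a.
  exists (r / (2 * n%:R)); first by rewrite divr_gt0 ?mulr_gt0.
  by field; rewrite gt_eqF.
rewrite [X in X ^+ 2](_ : _ = a); last by field; rewrite gt_eqF.
rewrite sumr_const card_ord -[_ *+ n]mulr_natr [ltRHS]exprMn [ltLHS]mulrC.
by rewrite ltr_pM2r ?exprn_gt0//; nra.
Qed.

(** Only the order r^n of the volume is ever used, so an inner and an outer cube replace an exact
    formula. *)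
Lemma lebesgue_eball c r : (0 < n)%N -> 0 < r -> exists V : R,
  [/\ lebn (eball c r) = V%:E, (r / n%:R) ^+ n <= V & V <= (2 * r) ^+ n].
Proof.
move=> n0 r0; have n0' : 0 < n%:R :> R by rewrite ltr0n.
have lo : (((r / n%:R) ^+ n)%:E <= lebn (eball c r))%E.
  rewrite (_ : r / n%:R = 2 * (r / (2 * n%:R))); last by field; rewrite gt_eqF.
  rewrite -(lebesgue_cube c) ?divr_ge0 ?mulr_ge0 ?(ltW r0)//.
  apply: le_measure; rewrite ?inE; [exact: measurable_cube|exact: measurable_eball|].
  exact: cube_sub_eball.
have hi : (lebn (eball c r) <= ((2 * r) ^+ n)%:E)%E.
  rewrite -(lebesgue_cube c) ?(ltW r0)//.
  apply: le_measure; rewrite ?inE; [exact: measurable_eball|exact: measurable_cube|].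
  exact: eball_sub_cube.
exists (fine (lebn (eball c r))).
have f : lebn (eball c r) \is a fin_num.
  by rewrite ge0_fin_numE//; apply: le_lt_trans hi _; rewrite ltry.
by split; rewrite ?fineK// -lee_fin fineK.
Qed.

End balls.

(** * Muckenhoupt bounds and averages for functions polynomial in each variable *)

Section polynomial_weights.
Context {R : realType} (n d : nat) (f : 'rV[R]_n -> R[i]).
Hypotheses (n0 : (0 < n)%N) (d0 : (0 < d)%N).
Let w x := Normc.normc (f x).
Hypotheses (mw : measurable_fun [set: 'rV[R]_n] w) (sf : sep_poly d f).
Local Notation lebn := (@lebesgue_rV R n).
Let delta : R := (2 * d%:R)^-1.
Let K : R := 1 + 18 * d%:R.

Let delta0 : 0 < delta.
Proof. by rewrite invr_gt0 mulr_gt0// ltr0n. Qed.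

Let K0 : 0 < K.
Proof. by rewrite ltr_pwDl// mulr_ge0. Qed.

Let w0 x : 0 <= w x.
Proof. exact: normc_ge0. Qed.

Let mi D a : measurable_fun D (fun x => invpow a (w x)).
Proof. by apply: measurable_funTS; exact: (measurableT_comp (measurable_invpow _)). Qed.

Let cubeP c r z : 0 < r -> cube c r z ->
  (\int[lebn]_(x in cube c r) invpow delta (w x) <=
    ((K * (2 * r)) ^+ n)%:E * invpow delta (w z))%E.
Proof. by move=> r0; exact: integral_invpow_cube. Qed.

Lemma powR_le_invpow (a x : R) : ((x `^ (- a))%:E <= invpow a x)%E.
Proof. by rewrite /invpow; case: ifP; rewrite ?leey. Qed.

Let p : R := 1 + 2 * d%:R.

(** Let I be the integral of w^(-delta) over the circumscribed cube, of side 2r. The cube estimate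
    at x reads w(x)^delta <= A/I, so w is at most (A/I)^(2d) pointwise and in the mean. The other
    average is at most I/V, and I cancels in the product of the two factors. *)
Lemma Ap_product_le c r : 0 < r ->
  (Ap_product p w (eball c r) <= (((2 * n%:R * K) ^+ n) `^ (2 * d%:R))%:E)%E.
Proof.
move=> r0; have [V [VE Vlo Vhi]] := lebesgue_eball c n0 r0.
have n0' : 0 < n%:R :> R by rewrite ltr0n.
have V0 : 0 < V by apply: lt_le_trans Vlo; rewrite exprn_gt0// divr_gt0.
have pE : p - 1 = 2 * d%:R by rewrite /p addrAC subrr add0r.
have d20 : 0 < 2 * d%:R :> R by rewrite mulr_gt0// ltr0n.
have sub := eball_sub_cube (c := c) r0.
pose I := (\int[lebn]_(x in cube c r) invpow delta (w x))%E.
have I0 : (0 <= I)%E by apply: integral_ge0 => x _; exact: invpow_ge0.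
have avg2 : (\int[lebn]_(x in eball c r) (w x `^ (- delta))%:E <= I)%E.
  apply: (@le_trans _ _ (\int[lebn]_(x in eball c r) invpow delta (w x))%E).
    by apply: le_ge0_integral => x _; [rewrite lee_fin powR_ge0|exact: powR_le_invpow].
  apply: ge0_subset_integral => //; [exact: measurable_eball|exact: measurable_cube|].
  by move=> x _; exact: invpow_ge0.
have avg20 : (0 <= \int[lebn]_(x in eball c r) (w x `^ (- delta))%:E)%E.
  by apply: integral_ge0 => x _; rewrite lee_fin powR_ge0.
rewrite /Ap_product /average VE /= pE -/delta.
(* Degenerate case: the second average vanishes, and so does its positive power. *)
have [Iz|In0] := eqVneq I 0.
  have -> : (\int[lebn]_(x in eball c r) (w x `^ (- delta))%:E = 0)%E.
    by apply/le_anti; rewrite avg20 -Iz avg2.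
  by rewrite mule0 poweR0r ?gt_eqF// mule0 lee_fin powR_ge0.
have Igt0 : (0 < I)%E by rewrite lt_def In0.
(* If w vanishes on the whole cube, the first average is 0; otherwise a point with w(z) != 0 shows
   that I is finite. *)
have [[z [cz wz]]|zz] := pselect (exists z, cube c r z /\ w z != 0); last first.
  rewrite (_ : \int[lebn]_(x in eball c r) (w x)%:E = 0)%E; last first.
    apply: integral0_eq => x bx; congr (_%:E); apply: contrapT => /eqP wx.
    by apply: zz; exists x; split => //; exact: sub.
  by rewrite mule0 mul0e lee_fin powR_ge0.
pose A : R := (K * (2 * r)) ^+ n.
have A0 : 0 < A by rewrite exprn_gt0// !mulr_gt0.
have wle x : cube c r x -> w x != 0 -> (I <= (A * w x `^ (- delta))%:E)%E.
  by move=> cx wx; apply: le_trans (cubeP r0 cx) _; rewrite /invpow (negbTE wx) -EFinM.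
have [i IE] : exists i, I = i%:E.
  exists (fine I); rewrite fineK// ge0_fin_numE//.
  by apply: le_lt_trans (wle z cz wz) _; rewrite ltry.
have i0 : 0 < i by rewrite -lte_fin -IE.
have avg1 : (\int[lebn]_(x in eball c r) (w x)%:E <= ((A / i) `^ (2 * d%:R) * V)%:E)%E.
  apply: (@le_trans _ _ (\int[lebn]_(x in eball c r) ((A / i) `^ (2 * d%:R))%:E)%E).
    apply: le_ge0_integral => x bx; first by rewrite lee_fin.
    rewrite lee_fin; have [->|wx] := eqVneq (w x) 0; first exact: powR_ge0.
    have wx0 : 0 < w x by rewrite lt_def wx w0.
    have := wle x (sub _ bx) wx; rewrite IE lee_fin powRN ler_pdivlMr ?powR_gt0// => h.
    have : w x `^ delta <= A / i by rewrite ler_pdivlMr// mulrC.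
    move=> /(ge0_ler_powR (ltW d20)); rewrite !nnegrE powR_ge0 divr_ge0 ?(ltW A0) ?(ltW i0)//.
    move=> /(_ isT isT); rewrite -powRrM mulVf ?gt_eqF// powRr1//.
  by rewrite integral_cst ?VE -?EFinM//; exact: measurable_eball.
apply: (@le_trans _ _ (((A / i) `^ (2 * d%:R))%:E * ((V^-1 * i) `^ (2 * d%:R))%:E)%E).
  apply: lee_pmul.
  - rewrite mule_ge0 ?lee_fin ?invr_ge0 ?(ltW V0)//.
    by apply: integral_ge0 => x _; rewrite lee_fin.
  - exact: poweR_ge0.
  - apply: (@le_trans _ _ (V^-1%:E * ((A / i) `^ (2 * d%:R) * V)%:E)%E).
      by rewrite lee_wpmul2l// lee_fin invr_ge0 ltW.
    by rewrite -EFinM lee_fin mulrCA mulVf ?mulr1// gt_eqF.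
  - rewrite -poweR_EFin; apply: gt0_ler_poweR; rewrite ?(ltW d20) ?in_itv/= ?leey ?andbT//.
    + by rewrite mule_ge0// lee_fin invr_ge0 ltW.
    + by rewrite lee_fin mulr_ge0 ?invr_ge0 ?(ltW V0) ?(ltW i0).
    by rewrite EFinM lee_wpmul2l ?lee_fin ?invr_ge0 ?(ltW V0)// -IE.
rewrite -EFinM lee_fin -powRM ?divr_ge0 ?mulr_ge0 ?invr_ge0 ?(ltW A0) ?(ltW V0) ?(ltW i0)//.
apply: ge0_ler_powR; rewrite ?nnegrE ?(ltW d20)//.
- by rewrite !mulr_ge0 ?invr_ge0 ?(ltW A0) ?(ltW V0) ?(ltW i0).
- by rewrite exprn_ge0// !mulr_ge0// ltW.
(* What is left is a ratio of volumes, up to K^n, bounded independently of r because V >=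
   (r/n)^n. *)
rewrite (_ : A / i * (V^-1 * i) = A / V); last by field; rewrite !gt_eqF.
rewrite ler_pdivrMr//.
apply: (@le_trans _ _ ((2 * n%:R * K) ^+ n * (r / n%:R) ^+ n)); last first.
  by rewrite ler_wpM2l// exprn_ge0// !mulr_ge0// ltW.
rewrite -exprMn /A le_eqVlt; apply/orP; left; apply/eqP; congr (_ ^+ _).
by field; rewrite gt_eqF.
Qed.

Lemma invpow_fin_num a x : invpow a (w x) \is a fin_num -> 0 < w x.
Proof. by rewrite /invpow lt_def w0 andbT; case: ifP. Qed.

(** On every cube containing z the integral of [invpow delta (w x)] is finite, so the integrand is
    finite almost everywhere; since it is +oo at the zeros of w, these form a null set. The radii r
    k are offset by the size of z so that all cubes contain it, and they exhaust R^n. *)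
Lemma ae_weight_gt0 : (exists z, f z != 0) -> {ae lebn, forall x, 0 < w x}.
Proof.
move=> [z fz]; have wz : w z != 0 by rewrite /w normc_eq0.
pose r (k : nat) : R := k.+1%:R + \sum_j `|z ord0 j|.
have S0 : 0 <= \sum_j `|z ord0 j| by exact: sumr_ge0.
have r0 k : 0 < r k by rewrite ltr_pwDl.
suff H k : {ae lebn, forall x, cube 0 (r k) x -> 0 < w x}.
  have := ae_foralln H; apply: filterS => x h.
  pose k := Num.truncn (\sum_j `|x ord0 j|).
  apply: (h k) => j; rewrite /= in_itv/= mxE sub0r add0r -ler_norml.
  apply: (@le_trans _ _ k.+1%:R); last by rewrite lerDl.
  apply: le_trans (ltW (truncnS_gt _)).
  by rewrite (bigD1 j)//= lerDl sumr_ge0.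
have zc : cube 0 (r k) z.
  move=> j; rewrite /= in_itv/= mxE sub0r add0r -ler_norml.
  apply: (@le_trans _ _ (\sum_j `|z ord0 j|)); last by rewrite lerDr.
  by rewrite (bigD1 j)//= lerDl sumr_ge0.
have : lebn.-integrable (cube 0 (r k)) (fun x => invpow delta (w x)).
  apply/integrableP; split; first exact: mi.
  under eq_integral do rewrite gee0_abs ?invpow_ge0//.
  apply: le_lt_trans (cubeP (r0 k) zc) _.
  by rewrite /invpow (negbTE wz) -EFinM ltry.
move=> /(integrable_ae (measurable_cube _ _)); apply: filterS => x h /h.
exact: invpow_fin_num.
Qed.

(** The cube estimate at the fixed point z bounds the mean of w^(-delta) over large balls by B,
    uniformly in the radius. Hence w >= la on a fixed proportion of each ball, which is expressed by
    integrating one pointwise inequality. *)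
Lemma average_weight_ge : (exists z, f z != 0) -> exists r0 c0 : R,
  [/\ 0 < r0, 0 < c0 & forall r, r0 <= r ->
    (c0%:E * lebn (eball 0 r) <= \int[lebn]_(x in eball 0 r) (w x)%:E)%E].
Proof.
move=> [z fz]; have wz : w z != 0 by rewrite /w normc_eq0.
have n0' : 0 < n%:R :> R by rewrite ltr0n.
pose r0 : R := 1 + \sum_j `|z ord0 j|.
have r00 : 0 < r0 by rewrite ltr_pwDl// sumr_ge0.
pose B : R := (2 * n%:R * K) ^+ n * w z `^ (- delta).
have B0 : 0 < B.
  apply: mulr_gt0; first by rewrite exprn_gt0// !mulr_gt0.
  by rewrite powR_gt0// lt_def wz w0.
(* Chosen so that la^delta B = 1/2: the negative power then accounts for at most half of the volume
   V. *)
pose la := (2 * B) `^ (- (2 * d%:R)).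
have la0 : 0 < la by rewrite powR_gt0// mulr_gt0.
have lan0 : la != 0 by rewrite gt_eqF.
have lad : la `^ delta * B = 2^-1.
  have B20 : 0 <= 2 * B by rewrite (mulr_ge0 _ (ltW B0)).
  rewrite /la -powRrM mulNr mulfV ?gt_eqF ?mulr_gt0 ?ltr0n// (powR_inv1 B20).
  by field; rewrite gt_eqF.
exists r0; exists (la / 2); split; [by []| |]; first by rewrite divr_gt0.
move=> r r0r; have rp : 0 < r := lt_le_trans r00 r0r.
have [V [VE Vlo Vhi]] := lebesgue_eball 0 n0 rp.
have zc : cube 0 r z.
  move=> j; rewrite /= in_itv/= mxE sub0r add0r -ler_norml.
  apply: le_trans r0r; apply: (@le_trans _ _ (\sum_j `|z ord0 j|)); last by rewrite lerDr.
  by rewrite (bigD1 j)//= lerDl sumr_ge0.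
have sub := eball_sub_cube (c := 0 : 'rV[R]_n) rp.
have V0 : 0 < V by apply: lt_le_trans Vlo; rewrite exprn_gt0// divr_gt0.
have mwB : measurable_fun (eball 0 r) (fun x => (w x)%:E).
  by apply/measurable_EFinP; exact: measurable_funTS.
have ball : (\int[lebn]_(x in eball 0 r) invpow delta (w x) <= (B * V)%:E)%E.
  apply: (@le_trans _ _ (\int[lebn]_(x in cube 0 r) invpow delta (w x))%E).
    apply: ge0_subset_integral; [exact: measurable_eball|exact: measurable_cube|exact: mi| |exact: sub].
    by move=> x _; exact: invpow_ge0.
  apply: le_trans (cubeP rp zc) _; rewrite /invpow (negbTE wz) -EFinM lee_fin /B mulrAC.
  rewrite ler_wpM2r ?powR_ge0//.
  apply: (@le_trans _ _ ((2 * n%:R * K) ^+ n * (r / n%:R) ^+ n)); last first.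
    by rewrite ler_wpM2l// exprn_ge0// !mulr_ge0// ltW.
  rewrite -exprMn le_eqVlt; apply/orP; left; apply/eqP; congr (_ ^+ _).
  by field; rewrite gt_eqF.
(* The first term is at least 1 where w >= la, the second where w < la. *)
have pw x : (1 <= la^-1%:E * (w x)%:E + (la `^ delta)%:E * invpow delta (w x))%E.
  have p1 : (0 <= la^-1%:E * (w x)%:E)%E by rewrite lee_fin mulr_ge0 ?invr_ge0 ?(ltW la0).
  have p2 : (0 <= (la `^ delta)%:E * invpow delta (w x))%E.
    by rewrite mule_ge0 ?invpow_ge0// lee_fin powR_ge0.
  have [wla|law] := ltP (w x) la; last first.
    rewrite (@le_trans _ _ (la^-1%:E * (w x)%:E)%E) ?leeDl//.
    by rewrite lee_fin -(mulVf lan0) ler_wpM2l// invr_ge0 ltW.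
  rewrite (@le_trans _ _ ((la `^ delta)%:E * invpow delta (w x))%E) ?leeDr//.
  rewrite /invpow; case: ifPn => [_|wx]; first by rewrite gt0_muley ?leey// lte_fin powR_gt0.
  have wx0 : 0 < w x by rewrite lt_def wx w0.
  rewrite -EFinM lee_fin powRN ler_pdivlMr ?powR_gt0// mul1r.
  by apply: ge0_ler_powR; rewrite ?nnegrE ?(ltW wla) ?(ltW delta0) ?(ltW la0) ?w0.
have : (V%:E <= la^-1%:E * \int[lebn]_(x in eball 0 r) (w x)%:E + (V / 2)%:E)%E.
  rewrite -VE -[X in (X <= _)%E]mul1e -integral_cst; last exact: measurable_eball.
  apply: (@le_trans _ _ (\int[lebn]_(x in eball 0 r)
     (la^-1%:E * (w x)%:E + (la `^ delta)%:E * invpow delta (w x)))%E).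
    by apply: le_ge0_integral => x _; [rewrite lee_fin|exact: pw].
  rewrite ge0_integralD; last 5 first.
  - exact: measurable_eball.
  - by move=> x _; rewrite lee_fin mulr_ge0 ?invr_ge0 ?(ltW la0).
  - by apply: emeasurable_funM; [exact: measurable_cst|exact: mwB].
  - by move=> x _; rewrite mule_ge0 ?invpow_ge0// lee_fin powR_ge0.
  - by apply: emeasurable_funM; [exact: measurable_cst|exact: mi].
  rewrite ge0_integralZl; [|exact: measurable_eball|exact: mwB| |]; last 2 first.
  - by move=> x _; rewrite lee_fin.
  - by rewrite lee_fin invr_ge0 ltW.
  rewrite leeD2l// ge0_integralZl; [|exact: measurable_eball|exact: mi| |]; last 2 first.
  - by move=> x _; exact: invpow_ge0.
  - by rewrite lee_fin powR_ge0.
  apply: (@le_trans _ _ ((la `^ delta)%:E * (B * V)%:E)%E).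
    by rewrite lee_wpmul2l// lee_fin powR_ge0.
  by rewrite -EFinM lee_fin mulrA lad mulrC.
rewrite VE; case: (\int[lebn]_(x in eball 0 r) (w x)%:E)%E
    (integral_ge0 lebn (fun x (_ : eball 0 r x) => (w0 x : (0 <= (w x)%:E)%E)))
    => [i|_ _|]//; last by rewrite leey.
rewrite -!EFinM -EFinD !lee_fin => i0 h.
have : V / 2 <= la^-1 * i by lra.
by rewrite ler_pdivlMl//; nra.
Qed.

End polynomial_weights.

Section symbol_muckenhoupt.
Context {R : realType} (n : nat).
Local Notation lebn := (@lebesgue_rV R n).

Lemma symbol_weight_bound (P : mpoly.mpoly n R[i]) (r : R) : exists M : R,
  forall x : 'rV[R]_n, (forall j, `|x ord0 j| <= r) -> symbol_weight P x <= M.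
Proof.
exists (\sum_(m <- mpoly.msupp P) Normc.normc (mpoly.mcoeff m P) * \prod_i r ^+ m i).
move=> x xr; rewrite /symbol_weight symbolE.
elim: (mpoly.msupp P) => [|m s IHs]; first by rewrite !big_nil Normc.normc0.
rewrite !big_cons; apply: le_trans (le_normcD _ _) _; apply: lerD => //.
rewrite Normc.normcM ler_wpM2l ?normc_ge0// normc_prod.
apply: ler_prod => i _; rewrite normc_ge0/=.
rewrite -rmorphXn/= normc_real normrX lerXn2r ?nnegrE//.
exact: le_trans (xr i).
Qed.

Lemma compact_sub_cube (A : set 'rV[R]_n) : compact A ->
  exists2 r : R, 0 < r & A `<=` cube 0 r.
Proof.
move=> /compact_bounded [M [_ /(_ (`|M| + 1))]] h.
exists (`|M| + 1); first by rewrite ltr_wpDl.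
move=> x Ax j; rewrite /= in_itv/= mxE sub0r add0r -ler_norml.
have := h _ x Ax; rewrite (le_lt_trans (ler_norm M)) ?ltrDl// => /(_ isT).
apply: le_trans; rewrite [leRHS]/Num.norm/= mx_normrE.
exact: (le_bigmax _ (fun ij => `|x ij.1 ij.2|) (ord0, j)).
Qed.

Lemma is_weight_symbol (P : mpoly.mpoly n R[i]) : (0 < n)%N -> P != 0 ->
  is_weight (symbol_weight P).
Proof.
move=> n0 P0; split; first exact: measurable_symbol_weight.
- move=> A /compact_sub_cube[r r0 Ar]; have [M hM] := symbol_weight_bound P r.
  have wM x : cube 0 r x -> symbol_weight P x <= `|M|.
    move=> cx; apply: le_trans (ler_norm M); apply: hM => j.
    by have := cx j; rewrite /= in_itv/= mxE sub0r add0r -ler_norml.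
  apply: (@le_lt_trans _ _ (\int[lebn]_(x in cube 0 r) `|M|%:E)%E).
    rewrite integral_mkcond [leRHS]integral_mkcond; apply: le_ge0_integral => x _.
      by rewrite patchE; case: ifP; rewrite ?lee_fin.
    rewrite !patchE; case: ifPn => [/set_mem xA|_]; last by case: ifP; rewrite ?lee_fin.
    rewrite mem_set; last exact: Ar.
    rewrite lee_fin ger0_norm; [exact: (wM _ (Ar _ xA))|exact: normc_ge0].
  rewrite integral_cst; last exact: measurable_cube.
  by rewrite lebesgue_cube ?ltW// -EFinM ltry.
- apply: (@ae_weight_gt0 _ _ (mpoly.mmeasure (@mpoly.mdeg n) P).+1) => //.
  + exact: measurable_symbol_weight.
  + by move=> x j; have [q [sq qE]] := sep_poly_symbol P x j; exists q; split => //; exact: leqW.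
  + exact: symbol_neq0.
Qed.

Lemma muckenhoupt_symbol (P : mpoly.mpoly n R[i]) : (0 < n)%N -> P != 0 ->
  exists p : R, 1 <= p /\ muckenhoupt p (symbol_weight P).
Proof.
(* A degree bound may be enlarged freely; the successor makes d positive, as the exponent 1/(2d)
   requires. *)
move=> n0 P0; pose d := (mpoly.mmeasure (@mpoly.mdeg n) P).+1.
have d0 : 0 < 2 * d%:R :> R by rewrite mulr_gt0// ltr0n.
exists (1 + 2 * d%:R); split; first by rewrite lerDl ltW.
split; first exact: is_weight_symbol.
rewrite gt_eqF ?ltrDl//; apply: (@le_lt_trans _ _
  (((2 * n%:R * (1 + 18 * d%:R)) ^+ n) `^ (2 * d%:R))%:E); last by rewrite ltry.
apply: ge_ereal_sup => _ [[c r] /= r0 <-].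
apply: (@Ap_product_le _ _ d (symbol P)) => //; first exact: measurable_symbol_weight.
by move=> x j; have [q [sq qE]] := sep_poly_symbol P x j; exists q; split => //; exact: leqW.
Qed.

End symbol_muckenhoupt.

(** * Small divisors *)

Section translation.
Context {R : realType}.
Local Notation leb := (@lebesgue_measure R).
Local Notation lebn := (@lebesgue_rV R).

Lemma lebesgue_measure_shift (c : R) (A : set R) : measurable A ->
  leb ((fun x => x + c) @^-1` A) = leb A.
Proof.
move=> mA.
have mc : measurable_fun [set: measurableTypeR R]
    ((fun x : R => x + c) : measurableTypeR R -> measurableTypeR R).
  exact: measurable_funD.
pose mu' := measure_function_pushforward__canonical__measure_function_Measure leb mc.
suff H X : ocitv X -> leb X = mu' X by have -> := @lebesgue_measure_unique R mu' H A mA.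
move=> [[a b] _ <-]; rewrite /mu' /= /pushforward; apply/esym.
rewrite (_ : _ @^-1` _ = [set` `]a - c, b - c]]); last first.
  by apply/seteqP; split => x /=; rewrite !in_itv/= ltrBlDr lerBrDr.
rewrite !lebesgue_measure_itv/= !lte_fin ltrD2r; case: ifP => // _.
by rewrite -!EFinB; congr EFin; ring.
Qed.

Lemma measurable_fun_rV d (T : measurableType d) n (g : T -> 'rV[R]_n) :
  (forall i, measurable_fun [set: T] (fun x => g x ord0 i)) ->
  measurable_fun [set: T] g.
Proof.
move=> mg _ A mA; rewrite setTI.
suff: g_sigma_preimage (fun (i : 'I_n) (x : 'rV[R]_n) => x ord0 i)
    `<=` [set B | measurable (g @^-1` B)] by exact.
apply: smallest_sub.
  split => /=.
  - by rewrite preimage_set0.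
  - by move=> B mB; rewrite setTD preimage_setC; exact: measurableC.
  - by move=> F mF; rewrite preimage_bigcup; exact: bigcup_measurable.
rewrite -bigcup_seq /=; apply: bigcup_sub => i _ _ [B mB <-] /=.
by rewrite setTI; have := mg i measurableT B mB; rewrite setTI.
Qed.

Lemma measurable_fun_shift n (c : 'rV[R]_n) :
  measurable_fun [set: 'rV[R]_n] (fun x => x + c).
Proof.
apply: measurable_fun_rV => i; under eq_fun do rewrite mxE.
by apply: measurable_funD; [exact: measurable_coord|exact: measurable_cst].
Qed.

Lemma measurable_shift n (c : 'rV[R]_n) (A : set 'rV[R]_n) : measurable A ->
  measurable ((fun x => x + c) @^-1` A).
Proof.
by move=> mA; rewrite -[X in measurable X]setTI; exact: measurable_fun_shift.
Qed.

Lemma lebesgue_rV_shift n (c : 'rV[R]_n) (A : set 'rV[R]_n) : measurable A ->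
  lebn n ((fun x => x + c) @^-1` A) = lebn n A.
Proof.
elim: n c A => [|n IHn] c A mA.
  rewrite (_ : _ @^-1` _ = A)//; apply/seteqP; split => x /=;
  by rewrite (_ : x + c = x)//; apply/rowP; case.
pose c' : 'rV[R]_n := \row_j c ord0 (lift ord0 j).
have mB : measurable (@consrV R n @^-1` A).
  by rewrite -[X in measurable X]setTI; exact: measurable_consrV.
rewrite lebesgue_rVSE [RHS]lebesgue_rVSE /product_measure2.
pose G y := leb (ysection (@consrV R n @^-1` A) y).
transitivity (\int[lebn n]_y G (y + c')%R)%E.
  apply: eq_integral => y _; rewrite /= /G -[RHS](lebesgue_measure_shift (c ord0 ord0)).
    congr (leb _); apply/seteqP; split => t /=; rewrite !ysectionE/=;
    (rewrite (_ : consrV (t, y) + c = consrV (t + c ord0 ord0, y + c'))//;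
     apply/rowP => i; rewrite mxE; have [j ->|->] := unliftP ord0 i;
     by rewrite ?consrV_lift ?consrV0 ?mxE).
  exact: measurable_ysection.
have mG : measurable_fun [set: 'rV[R]_n] G by exact: measurable_fun_ysection.
pose mu' := measure_function_pushforward__canonical__measure_function_Measure
  (lebn n) (measurable_fun_shift c').
transitivity (\int[mu']_y G y)%E.
  rewrite [RHS]ge0_integral_pushforward//.
  exact: measurable_fun_shift.
apply: eq_measure_integral => B mB' _.
exact: IHn.
Qed.

(** Half-open, so that its integer translates are pairwise disjoint; it differs from [unit_cube] by
    a null set. *)
Definition half_open_cube {n} : set 'rV[R]_n := box (fun _ => [set` `[- 2^-1, 2^-1[]).

Lemma measurable_half_open_cube n : measurable (@half_open_cube n).
Proof. by apply: measurable_box => j; exact: measurable_itv. Qed.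

Definition of_lattice n (m : 'rV[int]_n) : 'rV[R]_n := map_mx intr m.

Lemma half_open_cube_lattice_inj n (x : 'rV[R]_n) (m m' : 'rV[int]_n) :
  half_open_cube (x - of_lattice m) -> half_open_cube (x - of_lattice m') -> m = m'.
Proof.
move=> h h'; apply/rowP => j.
have := h j; have := h' j; rewrite /= !in_itv/= !mxE => /andP[a1 a2] /andP[b1 b2].
have lt1 : (m ord0 j)%:~R - (m' ord0 j)%:~R < 1 :> R by lra.
have lt2 : (m' ord0 j)%:~R - (m ord0 j)%:~R < 1 :> R by lra.
suff : m ord0 j = m' ord0 j by [].
move: lt1 lt2; rewrite -!rmorphB/= -[1 in X in X -> _]/(1%:~R) -[1]/(1%:~R) !ltr_int; lia.
Qed.

Lemma measurable_lattice_bigcup n (E : set 'rV[R]_n) : measurable E ->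
  measurable (\bigcup_(m in [set: 'rV[int]_n]) ((fun x => x + of_lattice m) @^-1` E)).
Proof.
move=> mE; pose G i := if pickle_inv i is Some m
  then (fun x => x + @of_lattice n m) @^-1` E else set0.
rewrite (_ : \bigcup_(m in _) _ = \bigcup_i G i).
  apply: bigcup_measurable => i _; rewrite /G; case: pickle_inv => // m.
  exact: measurable_shift.
apply/seteqP; split => x [i _]; first by exists (pickle i) => //; rewrite /G pickleK_inv.
by rewrite /G; case: pickle_inv => // m Em; exists m.
Qed.

(** Reduction modulo Z^n does not increase measure: the parts of E in the various translates of the
    cube are disjoint, each keeps its measure when moved into the cube, and there they may only
    overlap. *)
Lemma lebesgue_fold_cube_le n (E : set 'rV[R]_n) : measurable E ->
  (lebn n (half_open_cube `&` \bigcup_(m in [set: 'rV[int]_n])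
     ((fun x => x + of_lattice m)%R @^-1` E)) <= lebn n E)%E.
Proof.
move=> mE.
pose H m := E `&` ((fun x => x + - of_lattice m) @^-1` @half_open_cube n).
(* Z^n is enumerated through [pickle_inv]; numbers that code no lattice point give the empty set. *)
pose F i := if pickle_inv i is Some m then H m else set0.
pose G i := if pickle_inv i is Some m then (fun x => x + of_lattice m) @^-1` H m else set0.
have mH m : measurable (H m).
  by apply: measurableI => //; apply: measurable_shift; exact: measurable_half_open_cube.
have mF i : measurable (F i) by rewrite /F; case: pickle_inv.
have mG i : measurable (G i).
  by rewrite /G; case: pickle_inv => // m; exact: measurable_shift.
have FG i : lebn n (G i) = lebn n (F i).
  by rewrite /G /F; case: pickle_inv => // m; exact: lebesgue_rV_shift.
have E1 : half_open_cube `&` \bigcup_(m in [set: 'rV[int]_n])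
     ((fun x => x + of_lattice m) @^-1` E) = \bigcup_i G i.
  apply/seteqP; split => x.
    move=> [Qx [m _ Em]]; exists (pickle m) => //.
    by rewrite /G pickleK_inv /H /=; split => //; rewrite addrK.
  move=> [i _]; rewrite /G; case: pickle_inv => // m [/= Ex].
  by rewrite addrK => Qx; split => //; exists m.
rewrite E1; apply: (@le_trans _ _ (\sum_(i <oo) lebn n (G i))%E).
  by apply: measure_sigma_subadditive => //; exact: bigcup_measurable.
rewrite (eq_eseriesr (g := fun i => lebn n (F i))); last by move=> i _; exact: FG.
have tF : trivIset [set: nat] F.
  move=> i j _ _ [x]; rewrite /F.
  case ei : pickle_inv => [m|] [] //; case ej : pickle_inv => [m'|] // [_ h] [_ h'].
  have mm : m = m' by apply: (half_open_cube_lattice_inj h h').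
  have := pickle_invK (T := 'rV[int]_n) i; have := pickle_invK (T := 'rV[int]_n) j.
  by rewrite ei ej /= mm => -> //.
have -> : (\sum_(i <oo) lebn n (F i))%E = lebn n (\bigcup_i F i).
  rewrite (measure_bigcup (lebn n) _ _ _ tF)//.
  by apply: eq_eseriesl => i; rewrite in_setT.
apply: le_measure; rewrite ?inE//; first exact: bigcup_measurable.
by move=> x [i _]; rewrite /F; case: pickle_inv => // m [].
Qed.

Lemma lebesgue_half_open_cube n : lebn n half_open_cube = lebn n unit_cube.
Proof.
rewrite (_ : unit_cube = box (fun _ => [set` `[- 2^-1, 2^-1]])); last first.
  by apply/seteqP; split => x h j; have := h j; rewrite /= in_itv.
rewrite !lebesgue_box//; apply: eq_bigr => j _.
by rewrite !lebesgue_measure_itv.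
Qed.

Lemma half_open_cube_sub n : half_open_cube `<=` @unit_cube R n.
Proof.
by move=> x h j; have := h j; rewrite /= in_itv/= => /andP[-> /ltW ->].
Qed.

(** The square of the Japanese bracket of m, hence the halved exponents further on. *)
Definition bracket n (m : 'rV[int]_n) : R := 1 + \sum_j (m ord0 j)%:~R ^+ 2.

Lemma bracket_ge1 n (m : 'rV[int]_n) : 1 <= bracket m.
Proof. by rewrite lerDl sumr_ge0// => j _; exact: sqr_ge0. Qed.

(** [S] is the set of points of the half-open cube for which some constant 1/(k+1) serves all m at
    once; restricting to these countably many constants makes it measurable. Its complement in the
    cube lies in the folded exceptional set for every e, so it is null. *)
Lemma full_measure_of_small n (w : 'rV[R]_n -> R) (a : R) :
  measurable_fun [set: 'rV[R]_n] w ->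
  (forall e, 0 < e -> exists la E, [/\ 0 < la, measurable E, (lebn n E <= e%:E)%E &
    forall m xi, half_open_cube xi -> ~ E (xi + of_lattice m) ->
    la * bracket m `^ (- a) <= w (xi + of_lattice m)]) ->
  exists S, [/\ measurable S, S `<=` unit_cube, lebn n S = lebn n unit_cube &
    forall xi, S xi -> exists c, 0 < c /\
      forall m, c * bracket m `^ (- a) <= w (xi + of_lattice m)].
Proof.
move=> mw small.
pose g (k : nat) m := [set xi | (k.+1%:R)^-1 * bracket m `^ (- a) <= w (xi + of_lattice m)].
have mg k m : measurable (g k m).
  have mwm : measurable_fun [set: 'rV[R]_n] (fun xi => w (xi + of_lattice m)).
    exact: measurableT_comp mw (measurable_fun_shift _).
  rewrite (_ : g k m = [set: 'rV[R]_n] `&` (fun xi => w (xi + of_lattice m)) @^-1`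
      [set` `[(k.+1%:R)^-1 * bracket m `^ (- a), +oo[]).
    by apply: mwm => //; exact: measurable_itv.
  by rewrite setTI; apply/seteqP; split => x; rewrite /g/= in_itv/= andbT.
pose g' k i := if pickle_inv i is Some m then g k m else setT.
pose G := \bigcup_k \bigcap_i g' k i.
have mG : measurable G.
  apply: bigcup_measurable => k _; apply: bigcap_measurable => // i _.
  by rewrite /g'; case: pickle_inv.
have Gk k xi : (\bigcap_i g' k i) xi <-> forall m, g k m xi.
  split => [h m|h i _]; first by have := h (pickle m) Logic.I; rewrite /g' pickleK_inv.
  by rewrite /g'; case: pickle_inv.
have mS : measurable (half_open_cube `&` G).
  by apply: measurableI => //; exact: measurable_half_open_cube.
exists (half_open_cube `&` G); split => //.
- by move=> x [/half_open_cube_sub].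
- rewrite -lebesgue_half_open_cube.
  rewrite [RHS](measureDI _ _ mG) ?[X in (X + _)%E](_ : _ = 0%E) ?add0e//; last exact: measurable_half_open_cube.
  apply/le_anti; rewrite measure_ge0 andbT; apply/lee_addgt0Pr => e e0; rewrite add0e.
  have [la [E [la0 mE Ee EP]]] := small e e0.
  apply: le_trans Ee; apply: le_trans (lebesgue_fold_cube_le mE).
  apply: le_measure; rewrite ?inE.
  + by apply: measurableD => //; exact: measurable_half_open_cube.
  + apply: measurableI; first exact: measurable_half_open_cube.
    exact: measurable_lattice_bigcup.
  move=> xi [Qxi nG]; split => //; apply: contrapT => nE; apply: nG.
  (* This k satisfies k + 1 > 1/la, that is 1/(k+1) < la. *)
  exists (Num.truncn la^-1) => //; apply/Gk => m; rewrite /g/=.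
  apply: le_trans (EP m xi Qxi _); last by move=> Em; apply: nE; exists m.
  rewrite ler_wpM2r ?powR_ge0// -[leRHS]invrK lef_pV2 ?posrE ?invr_gt0//.
  exact/ltW/truncnS_gt.
move=> xi [_ [k _ /Gk h]]; exists (k.+1%:R)^-1; split; first by rewrite invr_gt0.
exact: h.
Qed.

End translation.

(** * Lower bounds for P(m + xi), for almost every xi *)

Section small_divisors.
Context {R : realType} (n : nat) (P : mpoly.mpoly n R[i]).
Hypotheses (n0 : (0 < n)%N) (P0 : P != 0).
Local Notation lebn := (@lebesgue_rV R n).
Let w : 'rV[R]_n -> R := symbol_weight P.
Let d := (mpoly.mmeasure (@mpoly.mdeg n) P).+1.

Let mw : measurable_fun [set: 'rV[R]_n] w.
Proof. exact: measurable_symbol_weight. Qed.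

Let w0 x : 0 <= w x.
Proof. exact: normc_ge0. Qed.

Let n0' : 0 < n%:R :> R.
Proof. by rewrite ltr0n. Qed.

Let avg : exists r0 c0 : R, [/\ 0 < r0, 0 < c0 & forall r, r0 <= r ->
    (c0%:E * lebn (eball 0 r) <= \int[lebn]_(x in eball 0 r) (w x)%:E)%E].
Proof.
apply: (@average_weight_ge _ _ d (symbol P)) => //.
  by move=> x j; have [q [sq qE]] := sep_poly_symbol P x j; exists q; split => //; exact: leqW.
exact: symbol_neq0.
Qed.

(** On balls exhausting R^n the averages are at least c0, and A_1 passes this to the essential
    infimum. The constant C may be nonpositive a priori, hence |C| + 1. *)
Lemma A1_lower_bound : A1_condition w ->
  exists2 c : R, 0 < c & {ae lebn, forall x, c <= w x}.
Proof.
move=> [C HC]; have [r0 [c0 [r00 c00 Havg]]] := avg.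
exists (c0 / (`|C| + 1)); first by rewrite divr_gt0// ltr_wpDl.
have C10 : 0 < `|C| + 1 by rewrite ltr_wpDl.
pose r (k : nat) := r0 + k%:R.
have r0k k : 0 < r k by rewrite ltr_pwDl.
suff H k : {ae lebn, forall x, eball 0 (r k) x -> c0 / (`|C| + 1) <= w x}.
  have := ae_foralln H; apply: filterS => x h.
  apply: (h (Num.truncn (\sum_j (x ord0 j) ^+ 2)).+1); rewrite /eball/=.
  under eq_bigr do rewrite mxE subr0.
  set s := \sum_j _; have s0 : 0 <= s by apply: sumr_ge0 => j _; exact: sqr_ge0.
  have t1 : 1 <= (Num.truncn s).+1%:R :> R by rewrite ler1n.
  have := truncnS_gt s; rewrite /r => t; nra.
have [V [VE Vlo Vhi]] := lebesgue_eball 0 n0 (r0k k).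
have V0 : 0 < V by apply: lt_le_trans Vlo; rewrite exprn_gt0// divr_gt0.
have h1 : (c0%:E <= average (eball 0 (r k)) w)%E.
  have := Havg (r k); rewrite lerDl ler0n => /(_ isT).
  rewrite /average VE /= => h.
  apply: (@le_trans _ _ (V^-1%:E * (c0%:E * V%:E))%E).
    by rewrite -!EFinM lee_fin mulrCA mulVf ?mulr1// gt_eqF.
  by rewrite lee_wpmul2l// lee_fin invr_ge0 ltW.
have := ess_inf_le lebn (fun x => if x \in eball 0 (r k) then (w x)%:E else +oo%E).
apply: filterS => x; rewrite -/(ess_inf_on _ _) => h bx.
move: h; rewrite mem_set// => h.
have i0 : (0 <= ess_inf_on (eball 0 (r k)) w)%E.
  apply/ess_infP; apply: (aeW lebn) => y; case: ifP => _; rewrite ?leey// lee_fin; exact: w0.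
have h2 := le_trans h1 (HC 0 (r k) (r0k k)).
have : (c0%:E <= (`|C| + 1)%:E * (w x)%:E)%E.
  apply: le_trans h2 _; apply: (@le_trans _ _ ((`|C| + 1)%:E * ess_inf_on (eball 0 (r k)) w)%E).
    rewrite lee_wpmul2r// lee_fin; apply: le_trans (ler_norm C) _; by rewrite lerDl.
  by rewrite lee_wpmul2l// lee_fin ltW.
by rewrite -EFinM lee_fin ler_pdivrMr// mulrC.
Qed.

(** On large balls the first factor of [Ap_product] is at least c0, so the A_p constant bounds the
    second one alone; a power 1/(p - 1) and V <= (2r)^n give the integral. *)
Lemma Ap_integral_bound p : 1 < p -> muckenhoupt p w -> exists r0 C : R,
  [/\ 0 < r0, 0 <= C & forall r, r0 <= r ->
    (\int[lebn]_(x in eball 0 r) invpow (p - 1)^-1 (w x) <= (C * r ^+ n)%:E)%E].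
Proof.
move=> p1 [[_ _ aew]]; rewrite gt_eqF// /Ap_condition.
set S := ereal_sup _ => Ap; have [r0 [c0 [r00 c00 Havg]]] := avg.
have p10 : 0 < p - 1 by rewrite subr_gt0.
have S0 : (0 <= S)%E.
  apply: le_trans (ereal_sup_ubound _); last by exists (0, 1) => //=.
  apply: mule_ge0; last exact: poweR_ge0.
  rewrite /average mule_ge0 ?lee_fin ?invr_ge0 ?fine_ge0 ?measure_ge0//.
  by apply: integral_ge0 => x _; rewrite lee_fin.
pose A := fine S.
have SE : S = A%:E by rewrite fineK// ge0_fin_numE.
have A0 : 0 <= A by rewrite -lee_fin -SE.
exists r0; exists ((A / c0) `^ (p - 1)^-1 * 2 ^+ n); split => //.
  by rewrite mulr_ge0 ?powR_ge0 ?exprn_ge0.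
move=> r r0r; have rp : 0 < r := lt_le_trans r00 r0r.
have [V [VE Vlo Vhi]] := lebesgue_eball 0 n0 rp.
have V0 : 0 < V by apply: lt_le_trans Vlo; rewrite exprn_gt0// divr_gt0.
set dl := (p - 1)^-1.
have dl0 : 0 < dl by rewrite invr_gt0.
set J := (\int[lebn]_(x in eball 0 r) (w x `^ (- dl))%:E)%E.
(* The two integrands differ only at the zeros of w, where one is +oo and the other 0; a weight has
   almost no zeros. *)
have -> : (\int[lebn]_(x in eball 0 r) invpow dl (w x) = J)%E.
  apply: ge0_ae_eq_integral.
  - exact: measurable_eball.
  - by apply: measurable_funTS; exact: (measurableT_comp (measurable_invpow _)).
  - apply: measurable_funTS; apply/measurable_EFinP.
    exact: (measurableT_comp (measurable_powR _)).
  - by move=> x _; exact: invpow_ge0.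
  - by move=> x _; rewrite lee_fin powR_ge0.
  - by apply: filterS aew => x wx _; rewrite /invpow gt_eqF.
have J0 : (0 <= J)%E by apply: integral_ge0 => x _; rewrite lee_fin powR_ge0.
have h1 : (c0%:E <= average (eball 0 r) w)%E.
  have := Havg r r0r; rewrite /average VE /= => h.
  apply: (@le_trans _ _ (V^-1%:E * (c0%:E * V%:E))%E).
    by rewrite -!EFinM lee_fin mulrCA mulVf ?mulr1// gt_eqF.
  by rewrite lee_wpmul2l// lee_fin invr_ge0 ltW.
have h2 : (c0%:E * (V^-1%:E * J) `^ (p - 1) <= A%:E)%E.
  rewrite -SE; apply: (@le_trans _ _ (Ap_product p w (eball 0 r))).
    rewrite /Ap_product [X in (_ <= _ * X `^ _)%E]/average VE /= -/dl -/J.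
    by rewrite lee_wpmul2r// poweR_ge0.
  by apply: ereal_sup_ubound; exists (0, r).
(* If J were infinite, so would be the product bounded by A, because c0 > 0 and p - 1 > 0. *)
have [j JE] : exists j, J = j%:E.
  exists (fine J); rewrite fineK// ge0_fin_numE//.
  rewrite ltNge leye_eq; apply/negP => /eqP Joo.
  move: h2; rewrite Joo gt0_muley ?lte_fin ?invr_gt0// poweRyr ?gt_eqF//.
  by rewrite gt0_muley ?lte_fin.
rewrite JE lee_fin; have j0 : 0 <= j by rewrite -lee_fin -JE.
move: h2; rewrite JE -EFinM lee_fin => h2.
have h3 : (V^-1 * j) `^ (p - 1) <= A / c0 by rewrite ler_pdivlMr// mulrC.
have Vj0 : 0 <= V^-1 * j by rewrite mulr_ge0// invr_ge0 ltW.
have h4 : V^-1 * j <= (A / c0) `^ dl.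
  rewrite -[leLHS]powRr1// -(mulfV (_ : p - 1 != 0)) ?gt_eqF// powRrM.
  apply: ge0_ler_powR; rewrite ?nnegrE ?powR_ge0 ?divr_ge0 ?(ltW c00) ?(ltW dl0)//.
have -> : j = (V^-1 * j) * V by field; rewrite gt_eqF.
by rewrite -[leRHS]mulrA -exprMn; apply: ler_pM => //; exact: ltW.
Qed.

Lemma nneseries_geometric (a t : R) : 0 <= t -> t < 1 ->
  (\sum_(k <oo) (a * t ^+ k)%:E = (a / (1 - t))%:E)%E.
Proof.
move=> t0 t1; apply/cvg_lim => //.
rewrite (_ : (fun _ => _) = EFin \o series (geometric a t)); last first.
  by apply/funext => k; rewrite /series/= sumEFin.
apply: cvg_EFin; first by apply: nearW => k.
by apply: cvg_geometric_series; rewrite ger0_norm.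
Qed.

(** Powers of 4 because the bracket is quadratic: m lives at scale 2^k. *)
Lemma bracket_dyadic (m : 'rV[int]_n) : exists k : nat,
  (bracket m : R) <= 4 ^+ k /\ (4 : R) ^+ k <= 4 * bracket m.
Proof.
have ex : exists k : nat, bracket m <= 4 ^+ k :> R.
  exists (Num.truncn (bracket m : R)).+1; apply: le_trans (ltW (truncnS_gt _)) _.
  by rewrite -natrX ler_nat ltnW// ltn_expl.
case: (ex_minnP ex) => k kP kmin; exists k; split => //.
case: k kP kmin => [|k] _ kmin.
  by rewrite expr0 (le_trans (bracket_ge1 m))// ler_peMl// ?ler1n// (le_trans ler01)// bracket_ge1.
rewrite exprS ler_pM2l// leNgt; apply/negP => /ltW /kmin; by rewrite ltnn.
Qed.

Lemma shifted_point_in_eball (m : 'rV[int]_n) (xi : 'rV[R]_n) (rho : R) k :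
  n%:R + 2 <= rho -> half_open_cube xi -> bracket m <= 4 ^+ k :> R ->
  eball 0 (rho * 2 ^+ k) (xi + of_lattice m).
Proof.
move=> rho2 xic mk; rewrite /eball/=.
apply: (@le_lt_trans _ _ (\sum_j (2^-1 + 2 * (m ord0 j)%:~R ^+ 2))).
  apply: ler_sum => j _; have := xic j; rewrite /= in_itv/= !mxE subr0 => /andP[h1 h2].
  set u := xi _ _ in h1 h2 *; set v := (_)%:~R.
  (* That is u^2 <= 1/4; with (u - v)^2 >= 0 it gives (u + v)^2 <= 2 u^2 + 2 v^2 <= 1/2 + 2 v^2. *)
  have h3 : 0 <= (2^-1 - u) * (2^-1 + u) by apply: mulr_ge0; lra.
  have h4 := sqr_ge0 (u - v); nra.
rewrite big_split/= sumr_const card_ord -mulr_sumr.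
rewrite exprMn -exprM mulnC exprM (_ : 2 ^+ 2 = 4 :> R); last by rewrite expr2 -natrM.
have b1 : 1 <= bracket m :> R := bracket_ge1 m.
move: mk b1; rewrite /bracket; set S := \sum_j _; set F := 4 ^+ k => h1 h2.
rewrite -mulr_natr; have := n0'; set N := n%:R in rho2 *; move=> N0.
have F1 : 1 <= F by lra.
have : (N + 2) ^+ 2 <= rho ^+ 2 by rewrite lerXn2r// nnegrE; lra.
move=> hr; have : (N + 2) ^+ 2 * F <= rho ^+ 2 * F by rewrite ler_wpM2r//; lra.
nra.
Qed.

Lemma Ap_small_sets p : 1 < p -> muckenhoupt p w -> forall e : R, 0 < e ->
  exists (la : R) E, [/\ 0 < la, measurable E, (lebn E <= e%:E)%E &
    forall m xi, half_open_cube xi -> ~ E (xi + of_lattice m) ->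
    la * bracket m `^ (- (n%:R * p / 2)) <= w (xi + of_lattice m)].
Proof.
move=> p1 mp e e0; have [r0 [C [r00 C0 HC]]] := Ap_integral_bound p1 mp.
have p10 : 0 < p - 1 by rewrite subr_gt0.
have p0 : 0 < p by rewrite (lt_trans _ p1).
set dl := (p - 1)^-1 in HC; have dl0 : 0 < dl by rewrite invr_gt0.
pose rho : R := r0 + (n%:R + 2).
have rho0 : 0 < rho by rewrite !addr_gt0.
pose s : R := n%:R * p; pose q : R := 2 `^ (- s).
have q0 : 0 < q by rewrite powR_gt0.
(* The exponent of 2 is n - np/(p - 1) = -n/(p - 1): the decay of the threshold beats the growth of
   the ball. *)
pose t : R := q `^ dl * 2 ^+ n.
have tE : t = 2 `^ (- (n%:R * dl)).
  rewrite /t /q -powRrM -(powR_mulrn n (ler0n R 2)) -powRD ?pnatr_eq0 ?implybT//.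
  congr (_ `^ _); rewrite /s /dl; field; rewrite gt_eqF//.
have t0 : 0 < t by rewrite mulr_gt0 ?powR_gt0// exprn_gt0.
have t1 : t < 1.
  rewrite tE powRN invf_lt1 ?powR_gt0// /powR pnatr_eq0/= expR_gt1.
  by rewrite !mulr_gt0 ?ln_gt0 ?ltr1n.
(* The measures sum to at most la^(1/(p-1)) (C' - 1), and [la] is chosen so that la^(1/(p-1)) C' =
   e. The summand 1 keeps C' positive. *)
pose C' : R := C * rho ^+ n / (1 - t) + 1.
have C'0 : 0 < C'.
  by rewrite ltr_wpDl// divr_ge0 ?mulr_ge0 ?exprn_ge0 ?(ltW rho0)// subr_ge0 ltW.
pose la : R := (e / C') `^ (p - 1).
have la0 : 0 < la by rewrite powR_gt0// divr_gt0.
have lad : la `^ dl = e / C'.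
  by rewrite /la -powRrM mulfV ?gt_eqF// powRr1// divr_ge0 ?ltW.
pose Ek k := eball 0 (rho * 2 ^+ k) `&` [set x | w x < la * q ^+ k].
have mEk k : measurable (Ek k).
  apply: measurableI; first exact: measurable_eball.
  rewrite (_ : [set x | _] = [set: 'rV[R]_n] `&` w @^-1` [set` `]-oo, la * q ^+ k[]).
    by apply: mw => //; exact: measurable_itv.
  by rewrite setTI; apply/seteqP; split => x /=; rewrite in_itv.
have lEk k : (lebn (Ek k) <= (la `^ dl * C * rho ^+ n * t ^+ k)%:E)%E.
  have lq0 : 0 < la * q ^+ k by rewrite mulr_gt0// exprn_gt0.
  have rk : r0 <= rho * 2 ^+ k.
    rewrite (@le_trans _ _ rho) ?lerDl ?addr_ge0//.
    by rewrite ler_peMr ?(ltW rho0)// exprn_ege1// ler1n.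
  (* Chebyshev: on [Ek k] the negative power is at least its value at the threshold la q^k. *)
  have h1 : (((la * q ^+ k) `^ (- dl))%:E * lebn (Ek k) <=
      \int[lebn]_(x in eball 0 (rho * 2 ^+ k)) invpow dl (w x))%E.
    rewrite -integral_cst//.
    apply: (@le_trans _ _ (\int[lebn]_(x in Ek k) invpow dl (w x))%E).
      apply: le_ge0_integral => x; first by rewrite lee_fin powR_ge0.
      move=> [_ /ltW wx]; apply: le_trans (invpow_antimono (ltW dl0) (w0 x) wx).
      by rewrite /invpow gt_eqF.
    apply: ge0_subset_integral; [exact: mEk|exact: measurable_eball| | |exact: subIsetl].
      by apply: measurable_funTS; exact: (measurableT_comp (measurable_invpow _)).
    by move=> x _; exact: invpow_ge0.
  have := le_trans h1 (HC _ rk).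
  have [v ->] : exists v, lebn (Ek k) = v%:E.
    exists (fine (lebn (Ek k))); rewrite fineK// ge0_fin_numE//.
    have [V [VE _ _]] := lebesgue_eball 0 n0 (lt_le_trans r00 rk).
    apply: (@le_lt_trans _ _ V%:E); last by rewrite ltry.
    rewrite -VE; apply: le_measure; rewrite ?inE//; first exact: measurable_eball.
    exact: subIsetl.
  rewrite -EFinM !lee_fin powRN ler_pdivrMl ?powR_gt0// => h.
  apply: le_trans h _; rewrite powRM ?(ltW la0) ?exprn_ge0 ?(ltW q0)//.
  rewrite le_eqVlt; apply/orP; left; apply/eqP.
  rewrite (_ : (q ^+ k) `^ dl = (q `^ dl) ^+ k); last first.
    by rewrite -!powR_mulrn ?(ltW q0) ?powR_ge0// powRAC.
  rewrite /t !exprMn -!exprM [(n * k)%N]mulnC; ring.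
(* From 4^k <= 4 (1 + |m|^2) follows q^k = 4^(-ks/2) >= 2^(-s) (1 + |m|^2)^(-s/2); hence the
   division by 2^s. *)
exists (la / 2 `^ s); exists (\bigcup_k Ek k); split.
- by rewrite divr_gt0// powR_gt0.
- exact: bigcup_measurable.
- apply: (@le_trans _ _ (\sum_(k <oo) lebn (Ek k))%E).
    by apply: measure_sigma_subadditive => //; exact: bigcup_measurable.
  apply: (@le_trans _ _ (\sum_(k <oo) (la `^ dl * C * rho ^+ n * t ^+ k)%:E)%E).
    by apply: lee_nneseries => k _ //; exact: lEk.
  rewrite nneseries_geometric ?(ltW t0)// lee_fin lad.
  rewrite (_ : _ / (1 - t) = e / C' * (C * rho ^+ n / (1 - t))); last by rewrite !mulrA.
  rewrite (_ : C * rho ^+ n / (1 - t) = C' - 1); last by rewrite /C' addrK.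
  by rewrite -mulrA ler_piMr ?(ltW e0)// mulrC ler_pdivrMr// mul1r gerBl.
move=> m xi xic nE; have [k [k1 k2]] := bracket_dyadic m.
have xB : eball 0 (rho * 2 ^+ k) (xi + of_lattice m).
  by apply: shifted_point_in_eball => //; rewrite lerDr ltW.
have : la * q ^+ k <= w (xi + of_lattice m).
  by rewrite leNgt; apply/negP => lt; apply: nE; exists k.
apply: le_trans; rewrite -mulrA ler_pM2l//.
have b0 : 0 < bracket m :> R by rewrite (lt_le_trans ltr01)// bracket_ge1.
have s0 : 0 < s by rewrite mulr_gt0.
rewrite powRN -invfM (_ : q ^+ k = ((2 `^ s) ^+ k)^-1); last by rewrite /q powRN exprVn.
rewrite lef_pV2 ?posrE ?exprn_gt0 ?mulr_gt0 ?powR_gt0//.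
have e4 : 2 `^ s = 4 `^ (s / 2).
  rewrite (_ : 4 = 2 `^ 2); last by rewrite powR_mulrn// expr2 -natrM.
  by rewrite -powRrM; congr (_ `^ _); field.
rewrite e4 -powR_mulrn ?powR_ge0// powRAC powR_mulrn// -powRM ?(ltW b0)//.
by apply: ge0_ler_powR; rewrite ?nnegrE ?mulr_ge0 ?exprn_ge0 ?divr_ge0 ?(ltW b0) ?(ltW s0) ?(ltW p0).
Qed.

(** The exceptional set is null, and a constant lower bound is stronger than one that decays in
    m. *)
Lemma A1_small_sets : A1_condition w -> forall e : R, 0 < e ->
  exists (la : R) E, [/\ 0 < la, measurable E, (lebn E <= e%:E)%E &
    forall m xi, half_open_cube xi -> ~ E (xi + of_lattice m) ->
    la * bracket m `^ (- (n%:R * 1 / 2)) <= w (xi + of_lattice m)].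
Proof.
move=> /A1_lower_bound[c c0 aec] e e0; exists c; exists [set x | w x < c].
have mE : measurable [set x | w x < c].
  rewrite (_ : [set x | _] = [set: 'rV[R]_n] `&` w @^-1` [set` `]-oo, c[]).
    by apply: mw => //; exact: measurable_itv.
  by rewrite setTI; apply/seteqP; split => x /=; rewrite in_itv.
split => //.
  have /(measure_negligible mE) -> : lebn.-negligible [set x | w x < c].
    apply: negligibleS aec => x /= wc h; have := lt_le_trans wc (h); by rewrite ltxx.
  by rewrite lee_fin ltW.
move=> m xi _ /negP; rewrite -leNgt; apply: le_trans.
rewrite ler_piMr ?(ltW c0)// powRN.
have h : 1 <= bracket m `^ (n%:R * 1 / 2) :> R.
  rewrite -[leLHS](powRr0 (bracket m : R)); apply: ler_powR; first exact: bracket_ge1.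
  by rewrite mulr1 divr_ge0.
by rewrite invf_le1 ?(lt_le_trans ltr01 h).
Qed.

Lemma small_divisors p : 1 <= p -> muckenhoupt p w ->
  exists S, [/\ measurable S, S `<=` unit_cube, lebn S = lebn unit_cube &
    forall xi, S xi -> exists c, 0 < c /\
      forall m, c * bracket m `^ (- (n%:R * p / 2)) <= w (xi + of_lattice m)].
Proof.
move=> p1 mp; apply: (full_measure_of_small mw).
have [p1e|pn1] := eqVneq p 1.
  by move: mp => [_]; rewrite p1e eqxx; exact: A1_small_sets.
by apply: Ap_small_sets => //; rewrite lt_neqAle eq_sym pn1.
Qed.

End small_divisors.

(** * Fourier coefficients of test functions *)

Section generalized_limit.
Context {R : realType}.
Local Notation C := R[i].

Lemma exists_ultrafilter_oo : exists U : set_system nat, UltraFilter U /\ \oo `<=` U.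
Proof. exact: (@ultraFilterLemma nat \oo). Qed.

(* Along an ultrafilter every bounded sequence converges, and limits are linear. *)
Definition ultra_oo : set_system nat := projT1 (cid exists_ultrafilter_oo).

Lemma ultra_oo_ultra : UltraFilter ultra_oo.
Proof. by rewrite /ultra_oo; case: cid => U []. Qed.

Lemma ultra_oo_sub : \oo `<=` ultra_oo.
Proof. by rewrite /ultra_oo; case: cid => U []. Qed.

#[local] Instance ultra_oo_proper : ProperFilter ultra_oo.
Proof. exact: (@ultra_proper _ _ ultra_oo_ultra). Qed.

Lemma ultra_fmap (T S : Type) (f : T -> S) (F : set_system T) :
  UltraFilter F -> UltraFilter (f @ F).
Proof.
move=> FU; split; first exact: fmap_proper_filter.
move=> G GF sFG; apply/seteqP; split => // A GA.
have [//|FnA] := in_ultra_setVsetC (f @^-1` A) FU.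
have GnA : G (~` A) by exact: sFG.
have G0 : G set0 by rewrite -(setICr A); exact: filterI.
by case: (@filter_not_empty _ G _ G0).
Qed.

Definition ulim (x : nat -> R) : R := lim (x @ ultra_oo).

(** Compactness of [-M, M]: the image of an ultrafilter is again one, and therefore converges. *)
Lemma cvg_ulim (x : nat -> R) M : (forall k, `|x k| <= M) -> x @ ultra_oo --> ulim x.
Proof.
move=> xM.
suff [l xl] : exists l : R, x @ ultra_oo --> l by apply: (cvgP l).
have [/= l [_ xl]] : (`[- M, M]%classic `&` [set p : R | x @ ultra_oo --> p]) !=set0.
  have := @segment_compact R (- M) M; rewrite compact_ultra; apply.
    exact: (ultra_fmap x ultra_oo_ultra).
  by apply: nearW => k /=; rewrite in_itv/= -ler_norml.
by exists l.
Qed.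

Lemma ulim_lin (x y : nat -> R) a b M :
  (forall k, `|x k| <= M) -> (forall k, `|y k| <= M) ->
  ulim (fun k => a * x k + b * y k) = a * ulim x + b * ulim y.
Proof.
move=> xM yM; apply: cvg_lim => //.
by apply: cvgD; apply: cvgMr; apply: cvg_ulim; eassumption.
Qed.

Lemma ulim_bound (x : nat -> R) M B N : (forall k, `|x k| <= M) ->
  (forall k, (N <= k)%N -> `|x k| <= B) -> `|ulim x| <= B.
Proof.
move=> xM xB; apply: (cvgr_to_le (cvg_norm (cvg_ulim xM))).
by apply: ultra_oo_sub; exists N.
Qed.

Definition bddc (z : nat -> C) := exists M, forall k, Normc.normc (z k) <= M.

Definition limc (z : nat -> C) : C :=
  Complex (ulim (fun k => complex.Re (z k))) (ulim (fun k => complex.Im (z k))).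

Lemma normc_ge_Im (x : C) : `|complex.Im x| <= Normc.normc x.
Proof.
case: x => a b; rewrite /Normc.normc -sqrtr_sqr; apply: ler_wsqrtr.
by rewrite lerDr sqr_ge0.
Qed.

Lemma normc_le_ReIm (x : C) : Normc.normc x <= `|complex.Re x| + `|complex.Im x|.
Proof.
case: x => a b; rewrite /Normc.normc /= -[leRHS]ger0_norm ?addr_ge0// -sqrtr_sqr.
apply: ler_wsqrtr; rewrite -[a ^+ 2]real_normK ?num_real// -[b ^+ 2]real_normK ?num_real//.
by have := normr_ge0 a; have := normr_ge0 b; nra.
Qed.

Lemma normcD_le (x y : C) : Normc.normc (x + y) <= Normc.normc x + Normc.normc y.
Proof. exact: le_normcD. Qed.

Lemma normcN (x : C) : Normc.normc (- x) = Normc.normc x.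
Proof. by case: x => a b; rewrite /Normc.normc /= !sqrrN. Qed.

Lemma normc_sum (I : Type) (r : seq I) (P : pred I) (F : I -> C) :
  Normc.normc (\sum_(i <- r | P i) F i) <= \sum_(i <- r | P i) Normc.normc (F i).
Proof.
elim/big_rec2: _ => [|i x y _ h]; first by rewrite Normc.normc0.
by apply: le_trans (normcD_le _ _) _; rewrite lerD2l.
Qed.

Lemma limc_lin (a : C) (z w : nat -> C) : bddc z -> bddc w ->
  limc (fun k => a * z k + w k) = a * limc z + limc w.
Proof.
move=> [M zM] [M' wM]; pose B := `|M| + `|M'|.
have B1 k : `|complex.Re (z k)| <= B.
  by rewrite (le_trans (normc_ge_Re _))// (le_trans (zM k))// (le_trans (ler_norm M))// lerDl.
have B2 k : `|complex.Im (z k)| <= B.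
  by rewrite (le_trans (normc_ge_Im _))// (le_trans (zM k))// (le_trans (ler_norm M))// lerDl.
have B3 k : `|complex.Re (w k)| <= B.
  by rewrite (le_trans (normc_ge_Re _))// (le_trans (wM k))// (le_trans (ler_norm M'))// lerDr.
have B4 k : `|complex.Im (w k)| <= B.
  by rewrite (le_trans (normc_ge_Im _))// (le_trans (wM k))// (le_trans (ler_norm M'))// lerDr.
pose a1 := complex.Re a; pose a2 := complex.Im a.
pose S := (`|a1| + `|a2|) * B + B.
have lin2 (x y : nat -> R) (c e : R) : (forall k, `|x k| <= B) -> (forall k, `|y k| <= B) ->
    forall k, `|c * x k + e * y k| <= (`|c| + `|e|) * B.
  move=> xB yB k; apply: le_trans (ler_normD _ _) _; rewrite !normrM mulrDl.
  by apply: lerD; apply: ler_wpM2l.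
have lin3 (x y t : nat -> R) (c e : R) : (forall k, `|x k| <= B) -> (forall k, `|y k| <= B) ->
    (forall k, `|t k| <= B) ->
    ulim (fun k => c * x k + e * y k + t k) = c * ulim x + e * ulim y + ulim t.
  move=> xB yB tB; pose D := (`|c| + `|e|) * B + B.
  have B0 : 0 <= B by rewrite addr_ge0.
  have -> : (fun k => c * x k + e * y k + t k) =
      fun k => 1 * (c * x k + e * y k) + 1 * t k.
    by apply/funext => k; rewrite !mul1r.
  rewrite (@ulim_lin _ _ 1 1 D) ?mul1r ?(ulim_lin c e xB yB)//.
  - by move=> k; apply: le_trans (lin2 _ _ _ _ xB yB k) _; rewrite lerDl.
  - by move=> k; apply: le_trans (tB k) _; rewrite lerDr mulr_ge0// addr_ge0.
apply/eqP; rewrite eq_complex; apply/andP; split; apply/eqP.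
  transitivity (ulim (fun k => a1 * complex.Re (z k) + (- a2) * complex.Im (z k) + complex.Re (w k))).
    congr ulim; apply/funext => k; rewrite /a1 /a2; case: (a) (z k) (w k) => [? ?] [? ?] [? ?] /=.
    by rewrite mulNr.
  by rewrite lin3// /limc /a1 /a2; case: (a) => ? ? /=; rewrite mulNr.
transitivity (ulim (fun k => a1 * complex.Im (z k) + a2 * complex.Re (z k) + complex.Im (w k))).
  by congr ulim; apply/funext => k; rewrite /a1 /a2; case: (a) (z k) (w k) => [? ?] [? ?] [? ?] /=.
by rewrite lin3// /limc /a1 /a2; case: (a) => ? ? /=.
Qed.

(** Real and imaginary parts are bounded separately, which loses a factor 2; later estimates only
    need the order of magnitude. *)
Lemma limc_bound (z : nat -> C) B N : bddc z ->
  (forall k, (N <= k)%N -> Normc.normc (z k) <= B) -> Normc.normc (limc z) <= 2 * B.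
Proof.
move=> [M zM] zB; apply: le_trans (normc_le_ReIm _) _; rewrite mulr2n mulrDl !mul1r.
apply: lerD; apply: (@ulim_bound _ M _ N).
- by move=> k; exact: le_trans (normc_ge_Re _) (zM k).
- by move=> k Nk; exact: le_trans (normc_ge_Re _) (zB k Nk).
- by move=> k; exact: le_trans (normc_ge_Im _) (zM k).
- by move=> k Nk; exact: le_trans (normc_ge_Im _) (zB k Nk).
Qed.

Lemma bddc_cst c : bddc (fun _ => c).
Proof. by exists (Normc.normc c). Qed.

Lemma bddcD z w : bddc z -> bddc w -> bddc (fun k => z k + w k).
Proof.
move=> [M zM] [M' wM]; exists (M + M') => k.
by apply: le_trans (normcD_le _ _) _; exact: lerD.
Qed.

Lemma bddcM c z : bddc z -> bddc (fun k => c * z k).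
Proof.
move=> [M zM]; exists (Normc.normc c * M) => k.
by rewrite Normc.normcM ler_wpM2l// normc_ge0.
Qed.

Lemma limc_cst c : limc (fun _ => c) = c.
Proof.
by case: c => a b; rewrite /limc/=; congr Complex; apply: cvg_lim => //; exact: cvg_cst.
Qed.

Lemma limcM c z : bddc z -> limc (fun k => c * z k) = c * limc z.
Proof.
move=> bz; rewrite -[RHS]addr0 -[X in _ + X](limc_cst 0) -limc_lin//; last exact: bddc_cst.
by congr limc; apply/funext => k; rewrite addr0.
Qed.

Lemma limcD z w : bddc z -> bddc w -> limc (fun k => z k + w k) = limc z + limc w.
Proof.
move=> bz bw; rewrite -[X in X + _]mul1r -limc_lin//.
by congr limc; apply/funext => k; rewrite mul1r.
Qed.

Lemma bddc_sum (I : Type) (r : seq I) (F : I -> nat -> C) :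
  (forall i, bddc (F i)) -> bddc (fun k => \sum_(i <- r) F i k).
Proof.
move=> bF; elim: r => [|i r IHr].
  by under eq_fun do rewrite big_nil; exact: bddc_cst.
by under eq_fun do rewrite big_cons; exact: bddcD.
Qed.

Lemma limc_sum (I : Type) (r : seq I) (F : I -> nat -> C) :
  (forall i, bddc (F i)) ->
  limc (fun k => \sum_(i <- r) F i k) = \sum_(i <- r) limc (F i).
Proof.
move=> bF; elim: r => [|i r IHr].
  by under eq_fun do rewrite big_nil; rewrite big_nil limc_cst.
under eq_fun do rewrite big_cons; rewrite big_cons -IHr limcD//.
exact: bddc_sum.
Qed.

Lemma limc_eq z w : bddc z -> bddc w ->
  (forall e, 0 < e -> exists N, forall k, (N <= k)%N -> Normc.normc (z k - w k) <= e) ->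
  limc z = limc w.
Proof.
move=> bz bw h; apply/eqP; rewrite -subr_eq0 -normc_eq0 eq_le normc_ge0 andbT.
apply/ler_addgt0Pr => e e0; rewrite add0r.
have e2 : 0 < e / 2 by rewrite divr_gt0.
have [N hN] := h _ e2.
have bNw : bddc (fun k => -1 * w k) by exact: bddcM.
rewrite -mulN1r -limcM// -limcD// (_ : e = 2 * (e / 2)); last by field.
apply: (limc_bound (N := N)); first exact: bddcD.
by move=> k Nk; rewrite mulN1r; exact: hN.
Qed.

Lemma limc_cvg z c : bddc z ->
  (forall e, 0 < e -> exists N, forall k, (N <= k)%N -> Normc.normc (z k - c) <= e) ->
  limc z = c.
Proof. by move=> bz h; rewrite -[RHS](limc_cst c); apply: limc_eq => //; exact: bddc_cst. Qed.

End generalized_limit.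

(** * Elementary estimates for e^(ix) *)

Section cis.
Context {R : realType}.
Implicit Types x y : R.

Definition cis x : R[i] := Complex (cos x) (sin x).

Lemma cis0 : cis 0 = 1.
Proof. by rewrite /cis cos0 sin0. Qed.

Lemma cisD x y : cis (x + y) = cis x * cis y.
Proof. by rewrite /cis cosD sinD; apply/eqP; rewrite eq_complex /= eqxx/=; apply/eqP; ring. Qed.

Lemma normc_cis x : Normc.normc (cis x) = 1.
Proof. by rewrite /cis /Normc.normc cos2Dsin2 sqrtr1. Qed.

Lemma cis2pi : cis (2 * pi) = 1.
Proof.
rewrite mulr2n mulrDl mul1r cisD /cis cospi sinpi.
by apply/eqP; rewrite eq_complex /=; apply/andP; split; apply/eqP; ring.
Qed.

Lemma cisMn x (k : nat) : cis (k%:R * x) = cis x ^+ k.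
Proof.
elim: k => [|k IHk]; first by rewrite mul0r cis0.
by rewrite -addn1 natrD mulrDl mul1r cisD IHk addn1 exprSr.
Qed.

Lemma cisN x : cis (- x) = (cis x)^-1.
Proof.
have h : cis (- x) * cis x = 1 by rewrite -cisD addNr cis0.
have c0 : cis x != 0 by rewrite -normc_eq0 normc_cis oner_eq0.
by rewrite -[LHS]mulr1 -(mulfV c0) mulrA h mul1r.
Qed.

Lemma cis_int (k : int) : cis (2 * pi * k%:~R) = 1.
Proof.
have h (j : nat) : cis (2 * pi * j%:R) = 1 by rewrite mulrC cisMn cis2pi expr1n.
case: k => j; first exact: h.
by rewrite NegzE mulrNz mulrN cisN h invr1.
Qed.

Lemma abs_sin_le x : `|sin x| <= `|x|.
Proof.
suff h y : 0 <= y -> `|sin y| <= y.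
  have [x0|x0] := leP 0 x; first by rewrite (ger0_norm x0) h.
  by rewrite -normrN -sinN (ltr0_norm x0) h// oppr_ge0 ltW.
move=> y0; have [c _] := @MVT_segment R sin cos 0 y y0 (fun x _ => is_derive_sin x)
  (continuous_subspaceT (@continuous_sin R)).
rewrite sin0 !subr0 => ->; rewrite normrM (ger0_norm y0) ler_piMl//.
by rewrite ler_norml cos_geN1 cos_le1.
Qed.

Lemma cos_half x : cos x = 1 - 2 * sin (x / 2) ^+ 2.
Proof.
rewrite {1}(_ : x = x / 2 + x / 2) ?cosD; last by field.
by have := cos2Dsin2 (x / 2); rewrite -!expr2 => h; lra.
Qed.

Lemma cos_ge_half x : `|x| <= 1 -> 2^-1 <= cos x.
Proof.
move=> x1; rewrite cos_half; have := abs_sin_le (x / 2).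
rewrite normrM (ger0_norm (_ : 0 <= 2^-1 :> R)) ?invr_ge0// => h.
rewrite -real_normK ?num_real//; have := normr_ge0 (sin (x / 2)); nra.
Qed.

(** On [0, 1] the derivative cos is at least 1/2; beyond 1, sin y = cos (pi/2 - y) is at least 1/2
    while y/4 <= 1/2. *)
Lemma sin_ge_quarter y : 0 <= y -> y <= pi / 2 -> y / 4 <= sin y.
Proof.
move=> y0 yp; have /andP[_ p2] := @pihalf_02 R.
have [y1|y1] := leP y 1.
  have [c] := @MVT_segment R sin cos 0 y y0 (fun x _ => is_derive_sin x)
    (continuous_subspaceT (@continuous_sin R)).
  rewrite sin0 !subr0 in_itv/= => /andP[c0 cy] ->.
  have : 2^-1 <= cos c by apply: cos_ge_half; rewrite ger0_norm//; lra.
  by move=> h; nra.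
have -> : sin y = cos (pi / 2 - y) by rewrite cosB cos_pihalf sin_pihalf mul0r mul1r add0r.
have : 2^-1 <= cos (pi / 2 - y) by apply: cos_ge_half; rewrite ger0_norm; lra.
by lra.
Qed.

(** Since |e^(ix) - 1| = 2 |sin (x/2)|, the constant is that of [sin_ge_quarter]. This lower bound
    lets a difference quotient at grid scale detect the frequency. *)
Lemma cis_sub1_ge x : `|x| <= pi -> `|x| <= 4 * Normc.normc (cis x - 1).
Proof.
move=> xp; have e : Normc.normc (cis x - 1) = 2 * `|sin (x / 2)|.
  rewrite /cis /Normc.normc /= -[RHS]ger0_norm ?mulr_ge0// -sqrtr_sqr; congr Num.sqrt.
  have sx : sin x = 2 * sin (x / 2) * cos (x / 2).
    by rewrite {1}(_ : x = x / 2 + x / 2) ?sinD; [ring|field].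
  rewrite exprMn real_normK ?num_real// subr0 cos_half sx.
  transitivity (2 ^+ 2 * sin (x / 2) ^+ 2 * (cos (x / 2) ^+ 2 + sin (x / 2) ^+ 2)); first ring.
  by rewrite cos2Dsin2 mulr1.
rewrite e; suff : `|x| / 2 / 4 <= `|sin (x / 2)| by lra.
have h : `|x| / 2 / 4 <= sin (`|x| / 2) by apply: sin_ge_quarter; rewrite ?divr_ge0//; lra.
apply: le_trans h _; apply: le_trans (ler_norm _) _.
have [x0|x0] := leP 0 x; first by rewrite (ger0_norm x0).
by rewrite (ltr0_norm x0) mulNr sinN normrN.
Qed.

Lemma cis_lip x y : Normc.normc (cis x - cis y) <= 2 * `|x - y|.
Proof.
have -> : cis x - cis y = cis y * (cis (x - y) - 1).
  by rewrite mulrBr mulr1 -cisD; congr (cis _ - _); ring.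
rewrite Normc.normcM normc_cis mul1r; set t := x - y.
have ct : `|cos t - 1| <= `|t|.
  rewrite cos_half addrAC subrr sub0r normrN normrM ger0_norm// normrX.
  have := abs_sin_le (t / 2); rewrite normrM (ger0_norm (_ : 0 <= 2^-1 :> R)) ?invr_ge0//.
  have : `|sin (t / 2)| <= 1 by rewrite ler_norml sin_le1 sin_geN1.
  have := normr_ge0 (sin (t / 2)); nra.
apply: le_trans (normc_le_ReIm _) _ => /=; rewrite subr0.
by have := abs_sin_le t; lra.
Qed.

(** A quadratic remainder is needed because [coef_Dj] divides it by the grid step. *)
Lemma cis_taylor x : `|x| <= 1 -> Normc.normc (cis x - 1 - Complex 0 x) <= 2 * `|x| ^+ 2.
Proof.
move=> x1; apply: le_trans (normc_le_ReIm _) _ => /=; rewrite !subr0.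
have x0 := normr_ge0 x.
have cle (t : R) : `|cos t - 1| <= `|t| ^+ 2.
  rewrite cos_half addrAC subrr sub0r normrN normrM ger0_norm// normrX.
  have := abs_sin_le (t / 2); rewrite normrM (ger0_norm (_ : 0 <= 2^-1 :> R)) ?invr_ge0//.
  have := normr_ge0 (sin (t / 2)); have := normr_ge0 t; nra.
suff h (y : R) : 0 <= y -> y <= 1 -> `|sin y - y| <= y ^+ 2.
  have hs : `|sin x - x| <= `|x| ^+ 2.
    have [xp|xn] := leP 0 x; first by move: x1; rewrite (ger0_norm xp); exact: h.
    move: x1; rewrite (ltr0_norm xn) => x1.
    by have := h (- x) _ x1; rewrite sinN -opprD normrN; apply; rewrite oppr_ge0 ltW.
  by have := cle x; lra.
move=> y0 y1.
have [c] := @MVT_segment R sin cos 0 y y0 (fun x _ => is_derive_sin x)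
  (continuous_subspaceT (@continuous_sin R)).
rewrite sin0 !subr0 in_itv/= => /andP[c0 cy] ->.
rewrite -{2}(mul1r y) -mulrBl normrM (ger0_norm y0).
have := cle c; rewrite (ger0_norm c0) => h.
have : `|cos c - 1| * y <= c ^+ 2 * y by rewrite ler_wpM2r.
by nra.
Qed.

End cis.

(** * Discrete Fourier transform on grids of the torus *)

Section grid.
Context {R : realType} {n : nat}.
Local Notation C := R[i].
Implicit Types (phi psi : 'rV[R]_n -> C) (m k : 'rV[int]_n).

Definition character m : 'rV[R]_n -> C := expi_dot (of_lattice m).

Lemma characterE m x : character m x = cis (dotr x (of_lattice m)).
Proof. by []. Qed.

Lemma dotrDl (x y z : 'rV[R]_n) : dotr (x + y) z = dotr x z + dotr y z.
Proof. by rewrite /dotr -big_split; apply: eq_bigr => j _; rewrite mxE mulrDl. Qed.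

Lemma dotrC (x y : 'rV[R]_n) : dotr x y = dotr y x.
Proof. by apply: eq_bigr => j _; rewrite mulrC. Qed.

Lemma dotrDr (x y z : 'rV[R]_n) : dotr x (y + z) = dotr x y + dotr x z.
Proof. by rewrite dotrC dotrDl !(dotrC x). Qed.

Lemma dotrZl a (x y : 'rV[R]_n) : dotr (a *: x) y = a * dotr x y.
Proof. by rewrite /dotr mulr_sumr; apply: eq_bigr => j _; rewrite mxE mulrA. Qed.

Lemma dotrNr (x y : 'rV[R]_n) : dotr x (- y) = - dotr x y.
Proof. by rewrite /dotr -sumrN; apply: eq_bigr => j _; rewrite mxE mulrN. Qed.

Lemma dotr_lattice k m : dotr (of_lattice k) (of_lattice m) =
  (\sum_j k ord0 j * m ord0 j)%:~R :> R.
Proof. by rewrite rmorph_sum; apply: eq_bigr => j _; rewrite !mxE rmorphM. Qed.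

Lemma of_latticeD k m : of_lattice (k + m) = of_lattice k + of_lattice m :> 'rV[R]_n.
Proof. by apply/rowP => j; rewrite !mxE rmorphD. Qed.

Lemma of_latticeN k : of_lattice (- k) = - of_lattice k :> 'rV[R]_n.
Proof. by apply/rowP => j; rewrite !mxE rmorphN. Qed.

Lemma of_latticeMz k (a : int) : of_lattice (a *: k) = a%:~R *: of_lattice k :> 'rV[R]_n.
Proof. by apply/rowP => j; rewrite !mxE rmorphM. Qed.

Lemma characterDx m x y : character m (x + y) = character m x * character m y.
Proof. by rewrite !characterE dotrDl cisD. Qed.

Lemma characterD m m' x : character (m + m') x = character m x * character m' x.
Proof. by rewrite !characterE of_latticeD dotrDr cisD. Qed.

Lemma characterN m x : character (- m) x = (character m x)^-1.
Proof. by rewrite !characterE of_latticeN dotrNr cisN. Qed.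

Lemma character_neq0 m x : character m x != 0.
Proof. by rewrite -normc_eq0 normc_cis oner_eq0. Qed.

Lemma normc_character m x : Normc.normc (character m x) = 1.
Proof. exact: normc_cis. Qed.

Lemma character0 x : character 0 x = 1.
Proof.
rewrite characterE (_ : dotr _ _ = 0) ?cis0//.
by rewrite /dotr big1// => j _; rewrite !mxE mulr0.
Qed.

Definition periodic phi := forall x k, phi (x + (2 * pi) *: of_lattice k) = phi x.

Lemma periodic_character m : periodic (character m).
Proof.
move=> x k; rewrite characterDx [X in _ * X]characterE dotrZl dotr_lattice cis_int.
by rewrite mulr1.
Qed.

Lemma periodicM phi psi : periodic phi -> periodic psi -> periodic (fun x => phi x * psi x).
Proof. by move=> p1 p2 x k; rewrite p1 p2. Qed.

(** An odd number of points per direction, so that the frequencies -L, ..., L form a complete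
    residue system symmetric about 0. *)
Definition grid L := {ffun 'I_n -> 'I_(2 * L).+1}.
Definition gstep L : R := 2 * pi / (2 * L).+1%:R.
Definition gpoint L k : 'rV[R]_n := gstep L *: of_lattice k.
Definition gidx L (g : grid L) : 'rV[int]_n := \row_j (g j : nat)%:Z.
(* The frequencies are numbered so as to be centered at 0. *)
Definition cidx L (g : grid L) : 'rV[int]_n := \row_j ((g j : nat)%:Z - L%:Z).

Lemma card_grid L : #|{: grid L}| = ((2 * L).+1 ^ n)%N.
Proof. by rewrite card_ffun !card_ord. Qed.

Lemma gstep_gt0 L : 0 < gstep L.
Proof. by rewrite divr_gt0// ?mulr_gt0// ?pi_gt0// ltr0n. Qed.

Lemma gpointD L k k' : gpoint L (k + k') = gpoint L k + gpoint L k'.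
Proof. by rewrite /gpoint of_latticeD scalerDr. Qed.

Lemma gpoint_period L k : gpoint L ((2 * L).+1%:Z *: k) = (2 * pi) *: of_lattice k.
Proof.
rewrite /gpoint of_latticeMz scalerA /gstep; congr (_ *: _).
by rewrite -[_.+1%:Z%:~R]/(_.+1%:R) mulfVK// pnatr_eq0.
Qed.

Definition mean L phi : C :=
  ((2 * L).+1 ^ n)%:R^-1 * \sum_(g : grid L) phi (gpoint L (gidx g)).

Definition dft L phi m : C := mean L (fun x => phi x * character (- m) x).

Lemma mean_shift L phi k : periodic phi ->
  mean L (fun x => phi (x + gpoint L k)) = mean L phi.
Proof.
move=> pphi; congr (_ * _).
pose N := (2 * L).+1.
(* [kk] is k reduced modulo 2L + 1; adding it permutes the grid, whose indices form a cyclic group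
   in each direction. The quotient [l] is a translation by periods. *)
pose kk : grid L := [ffun j => inZp `|(k ord0 j %% N%:Z)%Z|%N].
rewrite [RHS](reindex_inj (addIr kk)); apply: eq_bigr => g _.
rewrite -gpointD.
pose l : 'rV[int]_n := \row_j ((gidx g + k) ord0 j %/ N%:Z)%Z.
have -> : gidx g + k = gidx (g + kk) + N%:Z *: l.
  apply/rowP => j; rewrite !mxE !ffunE /=.
  have e : ((g j + `|(k ord0 j %% N%:Z)%Z|%N %% N) %% N)%N%:Z =
      (((g j : nat)%:Z + k ord0 j) %% N%:Z)%Z.
    by rewrite modnDmr -modz_nat PoszD gez0_abs ?modz_ge0// modzDmr.
  by rewrite e [RHS]addrC [in RHS]mulrC -divz_eq.
by rewrite gpointD gpoint_period pphi.
Qed.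

Lemma mean_linear L a phi psi :
  mean L (fun x => a * phi x + psi x) = a * mean L phi + mean L psi.
Proof.
rewrite /mean big_split mulrDr -mulr_sumr; congr (_ + _).
by rewrite mulrCA.
Qed.

Lemma normc_natr (k : nat) : Normc.normc (k%:R : C) = k%:R.
Proof. by rewrite -(rmorph_nat (real_complex R)) normc_real ger0_norm. Qed.

Lemma normc_mean_le L phi B : (forall x, Normc.normc (phi x) <= B) ->
  Normc.normc (mean L phi) <= B.
Proof.
move=> pB; rewrite /mean Normc.normcM Normc.normcV normc_natr.
have N0 : 0 < ((2 * L).+1 ^ n)%:R :> R by rewrite ltr0n expn_gt0.
rewrite mulrC ler_pdivrMr//; apply: le_trans (normc_sum _ _ _) _.
apply: (@le_trans _ _ (\sum_(g : grid L) B)); first by apply: ler_sum => g _.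
by rewrite sumr_const card_grid mulr_natr.
Qed.

Lemma dft_shift L phi m k : periodic phi ->
  dft L (fun x => phi (x + gpoint L k)) m = character m (gpoint L k) * dft L phi m.
Proof.
move=> pphi; rewrite /dft.
rewrite -(@mean_shift L (fun x => phi x * character (- m) x) k); last first.
  by apply: periodicM => //; exact: periodic_character.
have E := @mean_linear L (character m (gpoint L k))
  (fun x => phi (x + gpoint L k) * character (- m) (x + gpoint L k)) (fun=> 0).
rewrite [X in _ = _ + X](_ : _ = 0) ?addr0 in E; last first.
  by rewrite /mean big1 ?mulr0.
rewrite -E; congr mean; apply/funext => x; rewrite addr0 characterDx.
rewrite [RHS]mulrCA; congr (_ * _).
by rewrite [RHS]mulrCA (characterN m (gpoint L k)) mulfV ?mulr1 ?character_neq0.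
Qed.

Lemma character_delta m L j :
  character m (gpoint L (delta_mx ord0 j)) = cis (gstep L * (m ord0 j)%:~R).
Proof.
rewrite characterE dotrZl dotr_lattice (bigD1 j)//= big1 ?addr0.
  by rewrite mxE !eqxx mul1r.
by move=> i ij; rewrite mxE (negbTE ij) andbF mul0r.
Qed.

Lemma gstep_mul_le L (a : int) : `|a| <= L%:Z -> `|gstep L * a%:~R| <= pi.
Proof.
move=> aL; rewrite normrM (gtr0_norm (gstep_gt0 L)) -intr_norm.
have N0 : 0 < (2 * L).+1%:R :> R by rewrite ltr0n.
rewrite /gstep mulrAC ler_pdivrMr//.
have : `|a|%:~R <= L%:R :> R by rewrite -[L%:R]/(L%:Z%:~R) ler_int.
rewrite -[(2 * L).+1%:R]natr1 natrM; have := pi_gt0 R; set b := _%:~R; set l := L%:R => p0 h.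
have : 0 <= pi * (l - b) by rewrite mulr_ge0 ?subr_ge0// ltW.
nra.
Qed.

(** For |a| <= L the angle is at most pi in absolute value and [cis_sub1_ge] applies; otherwise
    adding or subtracting 2L + 1 leaves [cis] unchanged and brings a into that range, still
    nonzero. *)
Lemma cis_gstep_neq1 L (a : int) : a != 0 -> `|a| <= (2 * L)%:Z ->
  cis (gstep L * a%:~R) != 1.
Proof.
move=> a0 aL; have N0 : (2 * L).+1%:R != 0 :> R by rewrite pnatr_eq0.
have small (b : int) : b != 0 -> `|b| <= L%:Z -> cis (gstep L * b%:~R) != 1.
  move=> b0 bL; apply/eqP => h.
  have := cis_sub1_ge (gstep_mul_le bL); rewrite h subrr Normc.normc0 mulr0.
  rewrite normr_le0 mulf_eq0 gt_eqF ?gstep_gt0//= intr_eq0; exact/negP.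
have per (b : int) (c : R) : (c = 1 \/ c = - 1) ->
    cis (gstep L * (b%:~R + c * (2 * L).+1%:R)) = cis (gstep L * b%:~R).
  move=> c1; rewrite mulrDr cisD.
  have -> : gstep L * (c * (2 * L).+1%:R) = c * (2 * pi).
    by rewrite mulrCA /gstep mulfVK.
  by case: c1 => ->; rewrite ?mul1r ?mulN1r ?cisN cis2pi ?invr1 mulr1.
have [aL'|aL'] := leP `|a| L%:Z; first exact: small.
have [a_ge0|a_lt0] := leP 0 a.
  rewrite -(per a (-1)); last by right.
  rewrite mulN1r -[(2 * L).+1%:R]/((2 * L).+1%:Z%:~R) -rmorphB/=.
  by apply: small; lia.
rewrite -(per a 1); last by left.
rewrite mul1r -[(2 * L).+1%:R]/((2 * L).+1%:Z%:~R) -rmorphD/=.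
by apply: small; lia.
Qed.

Lemma mean_character0 L : mean L (character 0) = 1.
Proof.
rewrite /mean; under eq_bigr do rewrite character0.
by rewrite sumr_const card_grid mulVf// pnatr_eq0 -lt0n expn_gt0.
Qed.

(** The mean is invariant under one grid step in direction j, yet that step multiplies it by a
    number different from 1. *)
Lemma mean_character L m j : m ord0 j != 0 -> `|m ord0 j| <= (2 * L)%:Z ->
  mean L (character m) = 0.
Proof.
move=> m0 mL; have := @mean_shift L (character m) (delta_mx ord0 j) (periodic_character m).
have -> : mean L (fun x => character m (x + gpoint L (delta_mx ord0 j))) =
    character m (gpoint L (delta_mx ord0 j)) * mean L (character m).
  rewrite /mean mulrCA; congr (_ * _); rewrite mulr_sumr; apply: eq_bigr => g _.
  by rewrite characterDx mulrC.
rewrite character_delta => /eqP; rewrite -subr_eq0 -{2}[mean _ _]mul1r -mulrBl mulf_eq0.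
by rewrite subr_eq0 (negbTE (cis_gstep_neq1 m0 mL))/= => /eqP.
Qed.

Lemma sum_character_cidx L (k : grid L) :
  \sum_(g : grid L) character (- cidx g) (gpoint L (gidx k)) =
  if k == 0 then ((2 * L).+1 ^ n)%:R else 0.
Proof.
pose c : 'rV[int]_n := const_mx L%:Z.
(* The phase is symmetric in frequency and point; once the centering by L is split off, the sum over
   frequencies becomes a sum over grid points, a [mean]. *)
have E (g : grid L) : character (- cidx g) (gpoint L (gidx k)) =
    character (gidx k) (gpoint L c) * character (- gidx k) (gpoint L (gidx g)).
  rewrite !characterE !dotrZl -cisD -mulrDr; congr (cis (_ * _)).
  rewrite !dotr_lattice -rmorphD/= -big_split/=; congr (_%:~R); apply: eq_bigr => j _.
  by rewrite !mxE; ring.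
under eq_bigr do rewrite E.
rewrite -mulr_sumr.
have mE : \sum_(g : grid L) character (- gidx k) (gpoint L (gidx g)) =
    ((2 * L).+1 ^ n)%:R * mean L (character (- gidx k)).
  by rewrite /mean mulrA mulfV ?mul1r// pnatr_eq0 -lt0n expn_gt0.
rewrite mE; case: eqP => [->|/eqP k0].
  have -> : gidx (0 : grid L) = 0 by apply/rowP => j; rewrite !mxE ffunE.
  by rewrite oppr0 character0 mean_character0 mul1r mulr1.
have [j kj] : exists j, k j != 0.
  apply: contrapT => nk; case/eqP: k0; apply/ffunP => j; rewrite ffunE.
  by apply: contrapT => /eqP kj; apply: nk; exists j.
have kj' : (k j : nat) != 0%N by apply: contraNneq kj => kj0; apply/eqP/val_inj.
rewrite (@mean_character L _ j) ?mulr0//; first by rewrite !mxE oppr_eq0; lia.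
by rewrite !mxE normrN; have := ltn_ord (k j); lia.
Qed.

(** Orthogonality with respect to the frequencies; [dft_shift] then carries inversion from the
    origin to the other grid points. *)
Lemma dft_inversion0 L phi : \sum_(g : grid L) dft L phi (cidx g) = phi 0.
Proof.
rewrite /dft /mean -mulr_sumr exchange_big/=.
under eq_bigr do rewrite -mulr_sumr sum_character_cidx.
rewrite (bigD1 (0 : grid L))//= big1 ?addr0 => [|k /negbTE ->]; last by rewrite mulr0.
rewrite eqxx mulrCA mulVf ?mulr1; last by rewrite pnatr_eq0 -lt0n expn_gt0.
congr phi; apply/rowP => j; rewrite !mxE ffunE mulr0//.
Qed.

Lemma dft_inversion L phi k : periodic phi ->
  phi (gpoint L k) = \sum_(g : grid L) dft L phi (cidx g) * character (cidx g) (gpoint L k).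
Proof.
move=> pphi; have := dft_inversion0 L (fun x => phi (x + gpoint L k)).
by rewrite add0r => <-; apply: eq_bigr => g _; rewrite dft_shift// mulrC.
Qed.

Lemma dft_linear L a phi psi m :
  dft L (fun x => a * phi x + psi x) m = a * dft L phi m + dft L psi m.
Proof.
rewrite /dft -mean_linear; congr mean; apply/funext => x.
by rewrite mulrDl mulrA.
Qed.

Lemma normc_dft_le L phi m B : (forall x, Normc.normc (phi x) <= B) ->
  Normc.normc (dft L phi m) <= B.
Proof.
move=> pB; apply: normc_mean_le => x.
by rewrite Normc.normcM normc_character mulr1.
Qed.

(** Aliases are spaced by 2L + 1, so none occurs within this range. *)
Lemma dft_character L m m' : (forall j, `|m ord0 j - m' ord0 j| <= (2 * L)%:Z) ->
  dft L (character m) m' = (m == m')%:R.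
Proof.
move=> mm'; have -> : dft L (character m) m' = mean L (character (m - m')).
  by congr mean; apply/funext => x; rewrite characterD.
have [->|nm] := eqVneq m m'; first by rewrite subrr mean_character0.
have [j mj] : exists j, m ord0 j != m' ord0 j.
  apply: contrapT => h; case/eqP: nm; apply/rowP => j.
  by apply: contrapT => /eqP mj; apply: h; exists j.
by rewrite (@mean_character L _ j) ?mxE ?subr_eq0//; exact: mm'.
Qed.

End grid.

(** * Real smooth functions: shifts, linear combinations, derivatives along lines *)

Section real_smooth.
Context {R : realType} {n : nat}.
Implicit Types (g : 'rV[R]_n -> R) (x v a : 'rV[R]_n) (j : 'I_n).

Local Notation dlt := (fun j : 'I_n => delta_mx ord0 j : 'rV[R]_n).

Lemma diffq_shift g a x v :
  (fun h : R => h^-1 *: (((fun y => g (y + a)) \o shift x) (h *: v) - g (x + a))) =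
  (fun h : R => h^-1 *: ((g \o shift (x + a)) (h *: v) - g (x + a))).
Proof. by apply/funext => h /=; rewrite addrA. Qed.

Lemma derivable_shift g a x v : derivable g (x + a) v ->
  derivable (fun y => g (y + a)) x v.
Proof. by rewrite /derivable diffq_shift. Qed.

Lemma derive_shift g a x v : 'D_v (fun y => g (y + a)) x = 'D_v g (x + a).
Proof. by rewrite /derive diffq_shift. Qed.

Lemma foldr_partial_shift g a s :
  foldr partial (fun y => g (y + a)) s = fun x => foldr partial g s (x + a).
Proof.
elim: s => //= j s ->; apply/funext => x.
by rewrite /partial derive_shift.
Qed.

Lemma continuous_shift_fun g a : continuous g -> continuous (fun x : 'rV[R]_n => g (x + a)).
Proof.
move=> cg x A nA; have := cg (x + a) A nA; rewrite /nbhs/= => h.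
have := near_shift x (x + a) (fun z => A (g z)).
rewrite [x + a]addrC addrK => E.
have : \forall z \near (a + x), A (g z) by rewrite addrC.
by rewrite E.
Qed.

Lemma continuous_lin2 g1 g2 (a b : R) : continuous g1 -> continuous g2 ->
  continuous (fun x : 'rV[R]_n => a * g1 x + b * g2 x).
Proof.
move=> c1 c2 x.
have h1 : (fun y : 'rV[R]_n => a * g1 y) @ x --> a * g1 x.
  exact: (cvgM (cvg_cst a) (c1 x)).
have h2 : (fun y : 'rV[R]_n => b * g2 y) @ x --> b * g2 x.
  exact: (cvgM (cvg_cst b) (c2 x)).
exact: (cvgD h1 h2).
Qed.

Lemma smooth_shift g a : smooth g -> smooth (fun y => g (y + a)).
Proof.
move=> sg s; have [cg dg] := sg s; rewrite foldr_partial_shift; split.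
  exact: continuous_shift_fun.
by move=> j x; apply: derivable_shift.
Qed.

Lemma smooth_partial g j : smooth g -> smooth (partial j g).
Proof. by move=> sg s; rewrite -foldr_rcons; exact: sg. Qed.

Lemma foldr_partial_lin g1 g2 (a b : R) s : smooth g1 -> smooth g2 ->
  foldr partial (fun x => a * g1 x + b * g2 x) s =
  fun x => a * foldr partial g1 s x + b * foldr partial g2 s x.
Proof.
move=> s1 s2; elim: s => //= j s ->; apply/funext => x; rewrite {1}/partial.
have d1 := (s1 s).2 j x; have d2 := (s2 s).2 j x.
rewrite (_ : (fun x => _) = (a \*: foldr partial g1 s) + (b \*: foldr partial g2 s))//.
by rewrite deriveD ?deriveZ//; exact: derivableZ.
Qed.

Lemma smooth_lin g1 g2 (a b : R) : smooth g1 -> smooth g2 ->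
  smooth (fun x => a * g1 x + b * g2 x).
Proof.
move=> s1 s2 s; rewrite foldr_partial_lin//.
have [c1 d1] := s1 s; have [c2 d2] := s2 s; split.
  exact: continuous_lin2.
move=> j x.
rewrite (_ : (fun x => _) = (a \*: foldr partial g1 s) + (b \*: foldr partial g2 s))//.
by apply: derivableD; apply: derivableZ.
Qed.

(** Identifies the difference quotient in direction v with that of a function of one real variable,
    so that the mean value theorem becomes available. *)
Lemma diffq_line g x v (t : R) :
  (fun h : R => h^-1 *: (((fun u => g (x + u *: v)) \o shift t) (h *: (1 : R)) - g (x + t *: v))) =
  (fun h : R => h^-1 *: ((g \o shift (x + t *: v)) (h *: v) - g (x + t *: v))).
Proof.
apply/funext => h /=; congr (_ *: (g _ - _)).
by rewrite -[h *: 1]/(h * 1) mulr1 scalerDl addrCA.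
Qed.

Lemma line_is_derive g x v (t : R) : derivable g (x + t *: v) v ->
  is_derive t 1 (fun u => g (x + u *: v)) ('D_v g (x + t *: v)).
Proof.
move=> dg; apply: DeriveDef; first by rewrite /derivable diffq_line.
by rewrite /derive diffq_line.
Qed.

Lemma derive_of_line g x v (l : R) : is_derive (0 : R) 1 (fun u => g (x + u *: v)) l ->
  derivable g x v /\ 'D_v g x = l.
Proof.
move=> [d1 d2]; have E := diffq_line g x v 0.
rewrite scale0r addr0 in E; split.
  by move: d1; rewrite /derivable /= scale0r addr0 E.
by rewrite -d2 /derive /= scale0r addr0 E.
Qed.

Lemma increment_bound g j B : (forall x, derivable g x (dlt j)) ->
  (forall x, `|partial j g x| <= B) ->
  forall x (t : R), `|g (x + t *: delta_mx ord0 j) - g x| <= B * `|t|.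
Proof.
move=> dg gB.
have pos x (t : R) : 0 <= t -> `|g (x + t *: delta_mx ord0 j) - g x| <= B * `|t|.
  move=> t0.
  have D (u : R) : is_derive u 1 (fun u => g (x + u *: dlt j)) (partial j g (x + u *: dlt j)).
    exact: line_is_derive.
  have [|c _] := @MVT_segment R (fun u => g (x + u *: dlt j))
    (fun u => partial j g (x + u *: dlt j)) 0 t t0 (fun u _ => D u).
    by apply: derivable_within_continuous => u _; have [] := D u.
  by rewrite scale0r addr0 subr0 => ->; rewrite normrM ler_wpM2r.
move=> x t; have [t0|t0] := leP 0 t; first exact: pos.
have := pos (x + t *: delta_mx ord0 j) (- t).
rewrite -addrA -scalerDl subrr scale0r addr0 normrN distrC; apply.
by rewrite oppr_ge0 ltW.
Qed.

Definition rperiodic g := forall x (k : 'rV[int]_n), g (x + (2 * pi) *: of_lattice k) = g x.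

Lemma foldr_partial_periodic g s : rperiodic g -> rperiodic (foldr partial g s).
Proof.
move=> pg x k; rewrite -[LHS](congr1 (fun f => f x) (foldr_partial_shift g _ s)).
by congr (foldr partial _ s x); apply/funext => y; rewrite pg.
Qed.

Lemma periodic_bounded g : continuous g -> rperiodic g -> exists M, forall x, `|g x| <= M.
Proof.
move=> cg pg.
have : compact [set v : 'rV[R]_n | forall i, `[0, 2 * pi]%classic (v ord0 i)].
  by apply: (@rV_compact R n (fun _ => `[0, 2 * pi]%classic)) => i; exact: segment_compact.
move=> /(continuous_compact (continuous_subspaceT cg)) /compact_bounded[M [_ /(_ (`|M| + 1))]] h.
exists (`|M| + 1) => x.
have p0 : 0 < 2 * pi :> R by rewrite mulr_gt0 ?pi_gt0.
(* Translates x into the compact period cell [0, 2 pi]^n. *)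
pose k : 'rV[int]_n := \row_j - Num.floor (x ord0 j / (2 * pi)).
rewrite -(pg x k); apply: h; first by rewrite (le_lt_trans (ler_norm M))// ltrDl.
exists (x + (2 * pi) *: of_lattice k) => //= i; rewrite in_itv/= !mxE rmorphN/= mulrN.
have h1 := floor_le_tmp (x ord0 i / (2 * pi)); have h2 := floorD1_gt (x ord0 i / (2 * pi)).
move: h1 h2; rewrite intrD -[1%:~R]/(1 : R) ler_pdivlMr// ltr_pdivrMr//.
set f := _%:~R => h1 h2; apply/andP; split; nra.
Qed.

Lemma continuous_dotr (xi : 'rV[R]_n) : continuous (fun x => dotr x xi).
Proof.
rewrite /dotr; elim: (index_enum _) => [|j r IHr] x.
  rewrite (_ : (fun _ => _) = cst 0); first exact: cst_continuous.
  by apply/funext => y; rewrite big_nil.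
rewrite (_ : (fun _ => _) = fun y : 'rV[R]_n => y ord0 j * xi ord0 j +
    \sum_(i <- r) y ord0 i * xi ord0 i); last first.
  by apply/funext => y; rewrite big_cons.
have h : (fun y : 'rV[R]_n => y ord0 j * xi ord0 j) @ x --> x ord0 j * xi ord0 j.
  exact: (cvgM (@coord_continuous R 1 n ord0 j x) (cvg_cst (xi ord0 j))).
exact: (cvgD h (IHr x)).
Qed.

(** This span is closed under partial derivatives, which makes smoothness of exponentials an
    induction on the word of derivatives. *)
Definition trig (xi : 'rV[R]_n) (a b : R) x := a * cos (dotr x xi) + b * sin (dotr x xi).

Lemma trig_is_derive xi (a b : R) x j : derivable (trig xi a b) x (dlt j) /\
  partial j (trig xi a b) x = trig xi (b * xi ord0 j) (- a * xi ord0 j) x.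
Proof.
apply: derive_of_line.
have E (u : R) : dotr (x + u *: dlt j) xi = xi ord0 j * u + dotr x xi.
  rewrite dotrDl dotrZl addrC [dotr (delta_mx _ _) _]/dotr (bigD1 j)//= big1 ?addr0.
    by rewrite mxE !eqxx mul1r mulrC.
  by move=> i ij; rewrite mxE (negbTE ij) andbF mul0r.
pose l (u : R) := xi ord0 j * u + dotr x xi.
have dl : is_derive (0 : R) 1 l (xi ord0 j).
  have h := is_deriveD (is_deriveZ (xi ord0 j) (is_derive_id (0 : R) (1 : R)))
    (is_derive_cst (dotr x xi) (0 : R) (1 : R)).
  apply: (is_derive_eq h).
  by rewrite addr0 -[LHS]/(xi ord0 j * 1) mulr1.
have l0 : l 0 = dotr x xi by rewrite /l mulr0 add0r.
rewrite (_ : (fun u => trig xi a b _) = (a \*: (cos \o l)) + (b \*: (sin \o l))); last first.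
  by apply/funext => u; rewrite /trig E.
have dc := is_derive1_comp (is_derive_cos (l 0)) dl.
have ds := is_derive1_comp (is_derive_sin (l 0)) dl.
apply: (is_derive_eq (is_deriveD (is_deriveZ a dc) (is_deriveZ b ds))).
rewrite l0 /trig -![_ *: _]/(_ * _); ring.
Qed.

Lemma smooth_trig xi (a b : R) : smooth (trig xi a b).
Proof.
move=> s; have [a' [b' ->]] : exists a' b' : R, foldr partial (trig xi a b) s = trig xi a' b'.
  elim: s => [|j s [a' [b' IHs]]]; first by exists a; exists b.
  exists (b' * xi ord0 j); exists (- a' * xi ord0 j); rewrite /= IHs.
  by apply/funext => x; rewrite (trig_is_derive xi a' b' x j).2.
split; last by move=> j x; have [] := trig_is_derive xi a' b' x j.
apply: (@continuous_lin2 (fun x => cos (dotr x xi)) (fun x => sin (dotr x xi))) => x.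
  exact: (cvg_comp _ _ (@continuous_dotr xi x) (@continuous_cos R _)).
exact: (cvg_comp _ _ (@continuous_dotr xi x) (@continuous_sin R _)).
Qed.

End real_smooth.

(** * Test functions and the operators D_j *)

Section test_functions.
Context {R : realType} {n : nat}.
Local Notation C := R[i].
Implicit Types (phi psi : 'rV[R]_n -> C) (m k : 'rV[int]_n) (j : 'I_n).
Local Notation re phi := (fun x => complex.Re (phi x)).
Local Notation im phi := (fun x => complex.Im (phi x)).

Lemma csmooth_lin (a b : C) phi psi : csmooth phi -> csmooth psi ->
  csmooth (fun x => a * phi x + b * psi x).
Proof.
move=> [r1 i1] [r2 i2].
have H (a1 a2 b1 b2 : R) : smooth (fun x => 1 * (a1 * re phi x + a2 * im phi x) +
    1 * (b1 * re psi x + b2 * im psi x)).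
  by apply: smooth_lin; exact: smooth_lin.
split.
  rewrite (_ : (fun x => _) = fun x => 1 * (complex.Re a * re phi x + - complex.Im a * im phi x) +
    1 * (complex.Re b * re psi x + - complex.Im b * im psi x)); first exact: H.
  apply/funext => x; case: (a) (b) (phi x) (psi x) => [? ?] [? ?] [? ?] [? ?] /=; ring.
rewrite (_ : (fun x => _) = fun x => 1 * (complex.Im a * re phi x + complex.Re a * im phi x) +
    1 * (complex.Im b * re psi x + complex.Re b * im psi x)); first exact: H.
apply/funext => x; case: (a) (b) (phi x) (psi x) => [? ?] [? ?] [? ?] [? ?] /=; ring.
Qed.

Lemma test_periodic phi : test_function phi -> periodic phi.
Proof. by case. Qed.

Lemma test_lin (a b : C) phi psi : test_function phi -> test_function psi ->
  test_function (fun x => a * phi x + b * psi x).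
Proof.
move=> [s1 p1] [s2 p2]; split; first exact: csmooth_lin.
by move=> x k; rewrite p1 p2.
Qed.

Lemma test_shift a phi : test_function phi -> test_function (fun x => phi (x + a)).
Proof.
move=> [[sr si] p]; split; last by move=> x k; rewrite addrAC p.
by split; [exact: (smooth_shift a sr)|exact: (smooth_shift a si)].
Qed.

Lemma DjE j phi x : Dj j phi x = Complex (partial j (im phi) x) (- partial j (re phi) x).
Proof.
rewrite /Dj (_ : (Complex 0 1)^-1 = Complex 0 (-1) :> C).
  by apply/eqP; rewrite eq_complex /=; apply/andP; split; apply/eqP; ring.
have i0 : (Complex 0 1 : C) != 0 by rewrite eq_complex /= oner_eq0 andbF.
apply: (mulfI i0); rewrite mulfV//; apply/eqP; rewrite eq_complex /=.
by apply/andP; split; apply/eqP; ring.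
Qed.

Lemma csmooth_Dj j phi : csmooth phi -> csmooth (Dj j phi).
Proof.
move=> [sr si]; split.
  rewrite (_ : re (Dj j phi) = partial j (im phi)); first exact: smooth_partial.
  by apply/funext => x; rewrite DjE.
rewrite (_ : im (Dj j phi) = fun x => -1 * partial j (re phi) x + 0 * partial j (re phi) x).
  by apply: smooth_lin; exact: smooth_partial.
by apply/funext => x; rewrite DjE /=; ring.
Qed.

Lemma test_Dj j phi : test_function phi -> test_function (Dj j phi).
Proof.
move=> [sp p]; split; first exact: csmooth_Dj.
move=> x k; rewrite !DjE; congr Complex.
  by apply: (@foldr_partial_periodic _ _ (im phi) [:: j]) => y l; rewrite p.
congr (- _).
by apply: (@foldr_partial_periodic _ _ (re phi) [:: j]) => y l; rewrite p.
Qed.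

Lemma csmooth_expi xi : csmooth (expi_dot xi : 'rV[R]_n -> C).
Proof.
split.
  rewrite (_ : re _ = trig xi 1 0); first exact: smooth_trig.
  by apply/funext => x; rewrite /trig mul1r mul0r addr0.
rewrite (_ : im _ = trig xi 0 1); first exact: smooth_trig.
by apply/funext => x; rewrite /trig mul1r mul0r add0r.
Qed.

Lemma test_character m : test_function (character m : 'rV[R]_n -> C).
Proof. by split; [exact: csmooth_expi|exact: periodic_character]. Qed.

(** The product rule, split into four real products; this is how the shift by xi enters the
    symbol. *)
Lemma Dj_expi_mul j xi phi : csmooth phi ->
  Dj j (fun x => expi_dot xi x * phi x) =
  fun x => expi_dot xi x * (Dj j phi x + (xi ord0 j)%:C%C * phi x).
Proof.
move=> [sr si]; apply/funext => x; rewrite DjE.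
have dr : derivable (re phi) x (delta_mx ord0 j) by exact: (sr [::]).2.
have di : derivable (im phi) x (delta_mx ord0 j) by exact: (si [::]).2.
have [dc cE] := trig_is_derive xi 1 0 x j.
have [ds sE] := trig_is_derive xi 0 1 x j.
have M (f g : 'rV[R]_n -> R) : derivable f x (delta_mx ord0 j) ->
    derivable g x (delta_mx ord0 j) ->
    partial j (f * g) x = f x * partial j g x + g x * partial j f x.
  by move=> df dg; rewrite /partial deriveM.
have -> : partial j (re (fun x => expi_dot xi x * phi x)) x =
    partial j (trig xi 1 0 * re phi) x - partial j (trig xi 0 1 * im phi) x.
  rewrite (_ : (fun x0 => complex.Re (expi_dot xi x0 * phi x0)) =
      trig xi 1 0 * re phi - trig xi 0 1 * im phi); last first.
    apply/funext => y; rewrite -[RHS]/(trig xi 1 0 y * re phi y - trig xi 0 1 y * im phi y).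
    by rewrite /trig /expi_dot; case: (phi y) => u v /=; ring.
  exact: (deriveB (derivableM dc dr) (derivableM ds di)).
have -> : partial j (im (fun x => expi_dot xi x * phi x)) x =
    partial j (trig xi 1 0 * im phi) x + partial j (trig xi 0 1 * re phi) x.
  rewrite (_ : (fun x0 => complex.Im (expi_dot xi x0 * phi x0)) =
      trig xi 1 0 * im phi + trig xi 0 1 * re phi); last first.
    apply/funext => y; rewrite -[RHS]/(trig xi 1 0 y * im phi y + trig xi 0 1 y * re phi y).
    by rewrite /trig /expi_dot; case: (phi y) => u v /=; ring.
  exact: (deriveD (derivableM dc di) (derivableM ds dr)).
rewrite (M _ _ dc di) (M _ _ ds dr) (M _ _ dc dr) (M _ _ ds di) cE sE DjE.
set pr := partial j (re phi) x; set pm := partial j (im phi) x.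
rewrite /trig /expi_dot; case: (phi x) => u v /=.
apply/eqP; rewrite eq_complex /=; apply/andP; split; apply/eqP; ring.
Qed.

Lemma Dj_character j m :
  Dj j (character m : 'rV[R]_n -> C) = fun x => (m ord0 j)%:~R * character m x.
Proof.
apply/funext => x; rewrite DjE.
have -> : re (character m : 'rV[R]_n -> C) = trig (of_lattice m) 1 0.
  by apply/funext => y; rewrite /trig mul1r mul0r addr0.
have -> : im (character m : 'rV[R]_n -> C) = trig (of_lattice m) 0 1.
  by apply/funext => y; rewrite /trig mul1r mul0r add0r.
rewrite (trig_is_derive _ 0 1 x j).2 (trig_is_derive _ 1 0 x j).2.
rewrite -(rmorph_int (real_complex R)) /trig /character /expi_dot !mxE.
by apply/eqP; rewrite eq_complex /=; apply/andP; split; apply/eqP; ring.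
Qed.

Lemma Dj_lin j (a b : C) phi psi : csmooth phi -> csmooth psi ->
  Dj j (fun x => a * phi x + b * psi x) = fun x => a * Dj j phi x + b * Dj j psi x.
Proof.
move=> [r1 i1] [r2 i2]; apply/funext => x; rewrite !DjE.
have H (a1 a2 b1 b2 : R) : partial j (fun x => 1 * (a1 * re phi x + a2 * im phi x) +
    1 * (b1 * re psi x + b2 * im psi x)) x =
    1 * (a1 * partial j (re phi) x + a2 * partial j (im phi) x) +
    1 * (b1 * partial j (re psi) x + b2 * partial j (im psi) x).
  have := foldr_partial_lin 1 1 [:: j] (smooth_lin a1 a2 r1 i1) (smooth_lin b1 b2 r2 i2).
  move=> /(congr1 (fun f => f x)) /= ->.
  have := foldr_partial_lin a1 a2 [:: j] r1 i1.
  move=> /(congr1 (fun f => f x)) /= ->.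
  have := foldr_partial_lin b1 b2 [:: j] r2 i2.
  by move=> /(congr1 (fun f => f x)) /= ->.
rewrite [X in partial j X x](_ : _ = fun x => 1 * (complex.Im a * re phi x + complex.Re a * im phi x) +
    1 * (complex.Im b * re psi x + complex.Re b * im psi x)); last first.
  apply/funext => y; case: (a) (b) (phi y) (psi y) => [? ?] [? ?] [? ?] [? ?] /=; ring.
rewrite [X in - partial j X x](_ : _ = fun x => 1 * (complex.Re a * re phi x + - complex.Im a * im phi x) +
    1 * (complex.Re b * re psi x + - complex.Im b * im psi x)); last first.
  apply/funext => y; case: (a) (b) (phi y) (psi y) => [? ?] [? ?] [? ?] [? ?] /=; ring.
rewrite !H; case: (a) (b) => [? ?] [? ?].
by apply/eqP; rewrite eq_complex /=; apply/andP; split; apply/eqP; ring.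
Qed.

End test_functions.

(** * Fourier coefficients of test functions: decay, derivatives, inversion *)

Section fourier_decay.
Context {R : realType} {n : nat}.
Local Notation C := R[i].
Implicit Types (phi psi : 'rV[R]_n -> C) (m k : 'rV[int]_n) (j : 'I_n).
Implicit Types (Phi : nat -> 'rV[R]_n -> C).
Local Notation re phi := (fun x => complex.Re (phi x)).
Local Notation im phi := (fun x => complex.Im (phi x)).

Lemma prod_ege1 (I : Type) (r : seq I) (P : pred I) (F : I -> R) :
  (forall i, P i -> 1 <= F i) -> 1 <= \prod_(i <- r | P i) F i.
Proof. by move=> h; apply: (big_ind (fun x => 1 <= x)) => // x y; exact: mulr_ege1. Qed.

(** A product rather than a power of the bracket: it is gained one difference quotient at a time,
    and sums of its powers factor over the coordinates. *)
Definition wt m : R := \prod_j (1 + `|(m ord0 j)%:~R|).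

Lemma wt_ge1 m : 1 <= wt m.
Proof. by apply: prod_ege1 => j _; rewrite lerDl. Qed.

Lemma wt_ge_coord m j : 1 + `|(m ord0 j)%:~R| <= wt m.
Proof.
rewrite /wt (bigD1 j)//= ler_peMr ?addr_ge0//.
by apply: prod_ege1 => i _; rewrite lerDl.
Qed.

Definition in_box (K : nat) m := [forall j, `|m ord0 j| <= K%:Z].

Lemma in_box_cidx L (g : grid L) : in_box L (cidx g).
Proof. by apply/forallP => j; rewrite mxE; have := ltn_ord (g j); lia. Qed.

(* Bounded in C^oo, uniformly in the index L: the grid spacing will vary with L. *)
Definition usmooth Phi := (forall L, test_function (Phi L)) /\
  forall s, exists M, forall L x, `|foldr partial (re (Phi L)) s x| <= M /\
    `|foldr partial (im (Phi L)) s x| <= M.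

Lemma usmooth_cst phi : test_function phi -> usmooth (fun _ => phi).
Proof.
move=> tp; split => // s; have [[sr si] p] := tp.
have [M1 h1] : exists M, forall x, `|foldr partial (re phi) s x| <= M.
  apply: periodic_bounded; first exact: (sr s).1.
  by apply: foldr_partial_periodic => x k; rewrite p.
have [M2 h2] : exists M, forall x, `|foldr partial (im phi) s x| <= M.
  apply: periodic_bounded; first exact: (si s).1.
  by apply: foldr_partial_periodic => x k; rewrite p.
exists (`|M1| + `|M2|) => _ x; split.
  by rewrite (le_trans (h1 x))// (le_trans (ler_norm M1))// lerDl.
by rewrite (le_trans (h2 x))// (le_trans (ler_norm M2))// lerDr.
Qed.

Lemma of_lattice_delta j : of_lattice (delta_mx ord0 j) = delta_mx ord0 j :> 'rV[R]_n.
Proof. by apply/rowP => i; rewrite !mxE; case: (_ && _). Qed.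

(* The factor 4 is the one of cis_sub1_ge: it makes the multiplier in dft_fdiff at
   least |m_j|. *)
Definition fdiff j L phi : 'rV[R]_n -> C := fun x =>
  (4 / gstep L)%:C%C * phi (x + gpoint L (delta_mx ord0 j)) + (- (4 / gstep L))%:C%C * phi x.

(** By the mean value theorem a difference quotient is bounded by the next derivative, whatever the
    step, so the bounds stay independent of L. *)
Lemma usmooth_fdiff j Phi : usmooth Phi -> usmooth (fun L => fdiff j L (Phi L)).
Proof.
move=> [tP bP]; split.
  by move=> L; apply: test_lin => //; exact: test_shift.
move=> s; have [M hM] := bP (j :: s); exists (4 * M) => L x.
pose a : 'rV[R]_n := gpoint L (delta_mx ord0 j).
have h0 := @gstep_gt0 R L; pose c : R := 4 / gstep L.
have c0 : 0 < c by rewrite divr_gt0.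
have aE : a = gstep L *: delta_mx ord0 j by rewrite /a /gpoint of_lattice_delta.
have K (g : 'rV[R]_n -> R) : smooth g -> (forall x, `|foldr partial g (j :: s) x| <= M) ->
    `|foldr partial (fun x => c * g (x + a) + - c * g x) s x| <= 4 * M.
  move=> sg gM; rewrite foldr_partial_lin//; last exact: smooth_shift.
  rewrite foldr_partial_shift mulNr -mulrBr normrM (gtr0_norm c0).
  have := increment_bound ((sg s).2 j) gM x (gstep L).
  rewrite -aE (gtr0_norm h0) => h; apply: le_trans (ler_wpM2l (ltW c0) h) _.
  by rewrite /c mulrCA -mulrA mulVf ?gt_eqF// mulr1 mulrC.
have [[sr si] _] := tP L.
split.
  rewrite (_ : re (fdiff j L (Phi L)) = fun x => c * re (Phi L) (x + a) + - c * re (Phi L) x).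
    by apply: K => // y; have [] := hM L y.
  by apply/funext => y; rewrite /fdiff -/a -/c; case: (Phi L _) (Phi L _) => [? ?] [? ?] /=; ring.
rewrite (_ : im (fdiff j L (Phi L)) = fun x => c * im (Phi L) (x + a) + - c * im (Phi L) x).
  by apply: K => // y; have [] := hM L y.
by apply/funext => y; rewrite /fdiff -/a -/c; case: (Phi L _) (Phi L _) => [? ?] [? ?] /=; ring.
Qed.

Lemma dft_lin2 L (a b : C) phi psi m :
  dft L (fun x => a * phi x + b * psi x) m = a * dft L phi m + b * dft L psi m.
Proof.
rewrite dft_linear; congr (_ + _).
have := dft_linear L b psi (fun=> 0) m.
under eq_fun do rewrite addr0; move=> ->.
by rewrite [X in _ + X](_ : _ = 0) ?addr0// /dft /mean big1 ?mulr0// => g _; rewrite mul0r.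
Qed.

Lemma dft_fdiff j L phi m : periodic phi -> dft L (fdiff j L phi) m =
  (4 / gstep L)%:C%C * (cis (gstep L * (m ord0 j)%:~R) - 1) * dft L phi m.
Proof.
move=> pp; rewrite /fdiff dft_lin2 dft_shift// character_delta rmorphN/=; ring.
Qed.

(** Each factor 1 + |m_j| is split: the 1 is the induction hypothesis for Phi, the |m_j| the one for
    its difference quotient, whose transform carries a multiplier of modulus at least |m_j|. The
    latter requires m in the box of size L, where the angle stays within [-pi, pi]. *)
Lemma uniform_decay js Phi : usmooth Phi -> exists M, forall L m, in_box L m ->
  Normc.normc (dft L (Phi L) m) * \prod_(j <- js) (1 + `|(m ord0 j)%:~R|) <= M.
Proof.
elim: js Phi => [|j js IH] Phi uP.
  have [M hM] := uP.2 [::]; exists (M + M) => L m _; rewrite big_nil mulr1.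
  apply: normc_dft_le => x; apply: le_trans (normc_le_ReIm _) _.
  by have [h1 h2] := hM L x; exact: lerD.
have [M1 h1] := IH _ uP; have [M2 h2] := IH _ (usmooth_fdiff j uP).
exists (M1 + M2) => L m mL; rewrite big_cons mulrA mulrDr mulr1 mulrDl.
apply: lerD; first exact: h1.
apply: le_trans (h2 L m mL); rewrite dft_fdiff; last exact: test_periodic (uP.1 L).
rewrite ler_wpM2r//; first by apply: prodr_ge0 => i _; rewrite addr_ge0.
rewrite [leRHS]Normc.normcM mulrC ler_wpM2r ?normc_ge0//.
have h0 := @gstep_gt0 R L.
have c0 : 0 < 4 / gstep L :> R by rewrite divr_gt0.
rewrite Normc.normcM normc_real (gtr0_norm c0).
have := cis_sub1_ge (@gstep_mul_le R L _ (forallP mL j)); rewrite normrM (gtr0_norm h0) => h.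
by rewrite mulrAC ler_pdivlMr// mulrC.
Qed.

(** Four copies of the list of coordinates give the fourth power of [wt]: two make the sum over
    frequencies bounded, the others yield the rate 1/(K+1) of its tail. *)
Lemma dft_decay phi : test_function phi -> exists2 M, 0 <= M & forall L m, in_box L m ->
  Normc.normc (dft L phi m) <= M / wt m ^+ 4.
Proof.
move=> tp; pose e := index_enum 'I_n.
have [M hM] := uniform_decay (e ++ (e ++ (e ++ e))) (usmooth_cst tp).
have h L m : in_box L m -> Normc.normc (dft L phi m) * wt m ^+ 4 <= M.
  by move=> mL; apply: le_trans (hM L m mL); rewrite !big_cat/= -/(wt m) !exprS expr0 mulr1.
exists M.
  by apply: le_trans (h 0%N 0 _); [rewrite mulr_ge0 ?normc_ge0 ?exprn_ge0 ?(le_trans ler01 (wt_ge1 _))|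
    apply/forallP => j; rewrite mxE].
move=> L m mL; rewrite ler_pdivlMr; first exact: h.
by rewrite exprn_gt0// (lt_le_trans ltr01)// wt_ge1.
Qed.

Lemma test_bounded phi : test_function phi -> exists M, forall x, Normc.normc (phi x) <= M.
Proof.
move=> tp; have [M hM] := (usmooth_cst tp).2 [::]; exists (M + M) => x.
by apply: le_trans (normc_le_ReIm _) _; have [h1 h2] := hM 0%N x; exact: lerD.
Qed.

(** The [dft L phi m] are Riemann sums of the normalised Fourier integral; the ultrafilter provides
    a limit without proving that they converge. *)
Definition coef phi m : C := limc (fun L => dft L phi m).

Lemma bddc_dft phi m : test_function phi -> bddc (fun L => dft L phi m).
Proof.
by move=> /test_bounded[M hM]; exists M => L; exact: normc_dft_le.
Qed.

Lemma coef_lin (a b : C) phi psi m : test_function phi -> test_function psi ->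
  coef (fun x => a * phi x + b * psi x) m = a * coef phi m + b * coef psi m.
Proof.
move=> t1 t2; rewrite /coef; under eq_fun do rewrite dft_lin2.
rewrite limc_lin ?limcM//; try exact: bddc_dft.
by apply: bddcM; exact: bddc_dft.
Qed.

Lemma normc_coef_le phi m B : (forall x, Normc.normc (phi x) <= B) ->
  Normc.normc (coef phi m) <= 2 * B.
Proof.
move=> pB; apply: (limc_bound (N := 0)); last by move=> L _; exact: normc_dft_le.
by exists B => L; exact: normc_dft_le.
Qed.

Lemma coef_character m m' : coef (character m) m' = (m == m')%:R.
Proof.
apply: limc_cvg; first by apply: bddc_dft; exact: test_character.
move=> e e0; exists (\sum_j `|m ord0 j - m' ord0 j|)%N => L mL.
rewrite dft_character ?subrr ?Normc.normc0 ?ltW// => j.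
have : (`|m ord0 j - m' ord0 j| <= \sum_j `|m ord0 j - m' ord0 j|)%N.
  by rewrite (bigD1 j)//= leq_addr.
by lia.
Qed.

Lemma gstep_small (e : R) : 0 < e -> exists N, forall L, (N <= L)%N -> gstep L <= e.
Proof.
move=> e0; exists (Num.truncn (2 * pi / e)).+1 => L NL.
rewrite /gstep ler_pdivrMr ?ltr0n// [e * _]mulrC -ler_pdivrMr//.
apply: le_trans (ltW (truncnS_gt _)) _; rewrite ler_nat.
by apply: (leq_trans NL); lia.
Qed.

(** The mean value theorem twice: the quotient is the partial derivative at an intermediate point,
    at distance at most h from x. *)
Lemma forward_difference_bound (g : 'rV[R]_n -> R) j B h x : smooth g -> 0 < h ->
  (forall x, `|partial j (partial j g) x| <= B) ->
  `|partial j g x - (g (x + h *: delta_mx ord0 j) - g x) / h| <= B * h.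
Proof.
move=> sg h0 gB; pose v : 'rV[R]_n := delta_mx ord0 j.
have D (u : R) : is_derive u 1 (fun u => g (x + u *: v)) (partial j g (x + u *: v)).
  by apply: line_is_derive; exact: (sg [::]).2.
have [|c ch] := @MVT_segment R (fun u => g (x + u *: v))
  (fun u => partial j g (x + u *: v)) 0 h (ltW h0) (fun u _ => D u).
  by apply: derivable_within_continuous => u _; have [] := D u.
rewrite scale0r addr0 subr0 => ->; rewrite mulfK ?gt_eqF// distrC.
move: ch; rewrite in_itv/= => /andP[c0 ch].
apply: le_trans (@increment_bound R n (partial j g) j B ((sg [:: j]).2 j) gB x c) _.
rewrite (ger0_norm c0) ler_wpM2l//.
by apply: le_trans (gB x).
Qed.

(** Up to O(h), D_j is a forward difference divided by ih. The transform of that difference has the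
    exact multiplier (e^(ih m_j) - 1)/(ih) = m_j + O(h), so both sides agree in the limit. *)
Lemma coef_Dj j phi m : test_function phi ->
  coef (Dj j phi) m = (m ord0 j)%:~R * coef phi m.
Proof.
move=> tp; have tD := test_Dj j tp; have [[sr si] pp] := tp.
have [M0 hM0] := test_bounded tp.
have [B hB] := (usmooth_cst tp).2 [:: j; j].
rewrite /coef -limcM; last exact: bddc_dft.
apply: limc_eq; [exact: bddc_dft|by apply: bddcM; exact: bddc_dft|].
move=> e e0; pose mj : R := (m ord0 j)%:~R.
(* The errors per unit of h: the first term from the forward difference, the second from the Taylor
   remainder; the 1 ensures positivity. *)
pose A : R := 2 * `|B| + 2 * mj ^+ 2 * `|M0| + 1.
have A0 : 0 < A.
  apply: ltr_wpDl => //; apply: addr_ge0; first by rewrite mulr_ge0.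
  by rewrite mulr_ge0// mulr_ge0// sqr_ge0.
have [N1 h1] := gstep_small (divr_gt0 e0 A0).
have m10 : 0 < (1 + `|mj|)^-1 by rewrite invr_gt0 ltr_pwDl.
have [N2 h2] := gstep_small m10.
exists (maxn N1 N2) => L; rewrite geq_max => /andP[/h1 hL1 /h2 hL2].
set h := gstep L in hL1 hL2 *; have h0 : 0 < h := @gstep_gt0 R L.
(* -i/4: the factor 1/i of [Dj], together with the removal of the 4 built into [fdiff]. *)
pose ii : C := Complex 0 (- (4^-1)).
pose E x := 1 * Dj j phi x + (- ii) * fdiff j L phi x.
have dE : dft L (Dj j phi) m = dft L E m + ii * dft L (fdiff j L phi) m.
  by rewrite /E dft_lin2 mul1r mulNr subrK.
rewrite dE dft_fdiff//.
have -> : dft L E m + ii * ((4 / gstep L)%:C%C * (cis (gstep L * (m ord0 j)%:~R) - 1) * dft L phi m)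
   - (m ord0 j)%:~R * dft L phi m =
   dft L E m + Complex 0 (- h^-1) * (cis (h * mj) - 1 - Complex 0 (h * mj)) * dft L phi m.
  have -> : (m ord0 j)%:~R = mj%:C%C :> C by rewrite -(rmorph_int (real_complex R)).
  rewrite -/h -/mj; move: (dft L E m) (dft L phi m) (cis _) => e1 d1 c.
  rewrite -addrA !mulrA -mulrBl; congr (_ + _ * _).
  have hn0 : h != 0 by rewrite gt_eqF.
  rewrite /ii; case: c => u v; apply/eqP; rewrite eq_complex /=.
  by apply/andP; split; apply/eqP; field.
apply: (@le_trans _ _ (A * h)); last first.
  by rewrite mulrC -ler_pdivlMr.
have hm1 : `|h * mj| <= 1.
  rewrite normrM (gtr0_norm h0).
  have := normr_ge0 mj => mj0.
  apply: le_trans (ler_wpM2r mj0 hL2) _; rewrite mulrC ler_pdivrMr ?ltr_pwDl// mul1r.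
  by rewrite lerDr.
have b1 : Normc.normc (dft L E m) <= 2 * `|B| * h.
  apply: normc_dft_le => x; apply: le_trans (normc_le_ReIm _) _.
  have key (g : 'rV[R]_n -> R) : smooth g -> (forall x, `|foldr partial g [:: j; j] x| <= B) ->
      `|partial j g x - (g (x + h *: delta_mx ord0 j) - g x) / h| <= `|B| * h.
    move=> sg gB; apply: forward_difference_bound => // y.
    exact: le_trans (gB y) (ler_norm B).
  have k1 := key _ si (fun y => (hB 0%N y).2); have k2 := key _ sr (fun y => (hB 0%N y).1).
  have aE : gpoint L (delta_mx ord0 j) = h *: delta_mx ord0 j :> 'rV[R]_n.
    by rewrite /gpoint of_lattice_delta.
  have hn0 : h != 0 by rewrite gt_eqF.
  rewrite (_ : complex.Re (E x) = partial j (im phi) x -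
      (im phi (x + h *: delta_mx ord0 j) - im phi x) / h); last first.
    rewrite /E DjE /fdiff aE /ii -/h.
    set p1 := partial j _ _; set p2 := partial j _ _.
    case: (phi x) (phi (x + _)) => [u v] [u' v'] /=; field; exact: hn0.
  rewrite (_ : complex.Im (E x) = - (partial j (re phi) x -
      (re phi (x + h *: delta_mx ord0 j) - re phi x) / h)); last first.
    rewrite /E DjE /fdiff aE /ii -/h.
    set p1 := partial j _ _; set p2 := partial j _ _.
    case: (phi x) (phi (x + _)) => [u v] [u' v'] /=; field; exact: hn0.
  rewrite normrN; move: k1 k2 => /= k1 k2; lra.
have b2 : Normc.normc (dft L phi m) <= `|M0|.
  by apply: normc_dft_le => x; exact: le_trans (hM0 x) (ler_norm M0).
move: b1 b2; move: (dft L E m) (dft L phi m) => e1 d1 b1 b2.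
apply: le_trans (normcD_le _ _) _; rewrite 2!Normc.normcM.
have -> : Normc.normc (Complex 0 (- h^-1)) = h^-1.
  by rewrite /Normc.normc expr0n/= add0r sqrtr_sqr normrN gtr0_norm// invr_gt0.
have t1 := cis_taylor hm1.
have b3 : h^-1 * Normc.normc (cis (h * mj) - 1 - Complex 0 (h * mj)) <= 2 * mj ^+ 2 * h.
  rewrite mulrC ler_pdivrMr//; apply: le_trans t1 _.
  by rewrite real_normK ?num_real//; nra.
have b4 : h^-1 * Normc.normc (cis (h * mj) - 1 - Complex 0 (h * mj)) *
   Normc.normc d1 <= 2 * mj ^+ 2 * h * `|M0|.
  by apply: ler_pM => //; rewrite ?normc_ge0// mulr_ge0 ?normc_ge0// invr_ge0 ltW.
by apply: le_trans (lerD b1 b4) _; rewrite /A; nra.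
Qed.

(** The subtracted term makes the induction telescope: the two new end terms add 2/(L+2)^2 <=
    2/(L+1) - 2/(L+2). *)
Lemma sum_inv_sq L : \sum_(a < (2 * L).+1) (1 + `|(a : nat)%:R - L%:R|) ^- 2 <= 3 - 2 / L.+1%:R :> R.
Proof.
elim: L => [|L IH].
  rewrite (_ : (2 * 0).+1 = 1%N)// big_ord1 /= subrr normr0 addr0 expr1n invr1; lra.
have -> : (2 * L.+1).+1 = (2 * L).+3 by lia.
rewrite big_ord_recl big_ord_recr /=.
have E (i : 'I_(2 * L).+1) : (1 + `|(bump 0 i)%:R - L.+1%:R|) ^- 2 =
    (1 + `|(i : nat)%:R - L%:R|) ^- 2 :> R.
  by rewrite /bump add1n -!natr1; congr ((1 + `|_|) ^- 2); ring.
under eq_bigr do rewrite E.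
rewrite sub0r normrN (ger0_norm (_ : 0 <= L.+1%:R))//.
have -> : (bump 0 (2 * L).+1)%:R - L.+1%:R = L.+1%:R :> R.
  by rewrite /bump add1n -!natr1 natrM; ring.
rewrite (ger0_norm (_ : 0 <= L.+1%:R))//.
move: IH; set S := \sum_i _; set x : R := L.+1%:R => IH.
have -> : L.+2%:R = 1 + x :> R by rewrite -natr1 addrC.
have x0 : 0 < x by rewrite ltr0n.
suff : (1 + x) ^- 2 <= x^-1 - (1 + x)^-1.
  by move: IH; move: (x^-1) ((1 + x)^-1) ((1 + x) ^- 2) => p q r IH hh; lra.
have -> : x^-1 - (1 + x)^-1 = (x * (1 + x))^-1.
  by field; rewrite !gt_eqF// addr_gt0.
by rewrite lef_pV2 ?posrE ?exprn_gt0 ?mulr_gt0 ?addr_gt0//; nra.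
Qed.

(** The sum factors into n one-dimensional sums, each at most 3 for every L. *)
Lemma sum_wt L : \sum_(g : grid L) (wt (cidx g)) ^- 2 <= 3 ^+ n.
Proof.
have E (g : grid L) : (wt (cidx g)) ^- 2 = \prod_j (1 + `|(g j : nat)%:R - L%:R|) ^- 2.
  rewrite /wt -prodrXl -prodfV; apply: eq_bigr => j _.
  by rewrite mxE rmorphB.
under eq_bigr do rewrite E.
rewrite -(bigA_distr_bigA (fun _ (a : 'I_(2 * L).+1) => (1 + `|(a : nat)%:R - L%:R|) ^- 2 : R)).
rewrite prodr_const card_ord; apply: lerXn2r; rewrite ?nnegrE//.
  by apply: sumr_ge0 => a _; rewrite invr_ge0 exprn_ge0// addr_ge0.
by apply: le_trans (sum_inv_sq L) _; rewrite gerBl divr_ge0.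
Qed.

(** Thanks to the centering, the frequencies of the small grid are among those of the large one,
    with indices shifted by L - K. *)
Lemma sum_in_box (V : zmodType) K L (F : 'rV[int]_n -> V) : (K <= L)%N ->
  \sum_(g : grid L | in_box K (cidx g)) F (cidx g) = \sum_(g : grid K) F (cidx g).
Proof.
move=> KL.
pose io (g : @grid n K) : @grid n L := [ffun j => inord (g j + (L - K))].
pose io' (g : @grid n L) : @grid n K := [ffun j => inord (g j - (L - K))].
have ioE (g : @grid n K) : cidx (io g) = cidx g.
  apply/rowP => j; rewrite !mxE ffunE inordK; first lia.
  by have := ltn_ord (g j); lia.
rewrite (reindex_onto io io'); last first.
  move=> g /forallP gK; apply/ffunP => j; apply: val_inj; rewrite !ffunE /=.
  have := gK j; rewrite mxE ler_norml => /andP[h1 h2].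
  have h3 : (g j <= L + K)%N by move: h2; rewrite lerBlDr -PoszD lez_nat addnC.
  have h4 : (L - K <= g j)%N.
    by move: h1; rewrite lerBrDl lerBlDr -PoszD lez_nat leq_subLR addnC.
  have E1 : (inord (g j - (L - K)) : 'I_(2 * K).+1) = (g j - (L - K))%N :> nat.
    by rewrite inordK//; lia.
  by rewrite E1 subnK// inord_val.
apply: eq_big => [g|g _]; last by rewrite ioE.
rewrite ioE in_box_cidx /=; apply/eqP/ffunP => j; apply: val_inj; rewrite !ffunE /=.
have gj := ltn_ord (g j).
have E1 : (inord (g j + (L - K)) : 'I_(2 * L).+1) = (g j + (L - K))%N :> nat.
  by rewrite inordK//; lia.
by rewrite E1 addnK inord_val.
Qed.

Lemma test_continuity phi (x : 'rV[R]_n) (e : R) : test_function phi -> 0 < e ->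
  exists2 d : R, 0 < d & forall y : 'rV[R]_n, (forall j, `|x ord0 j - y ord0 j| < d) -> Normc.normc (phi x - phi y) <= e.
Proof.
move=> [[sr si] _] e0; have e2 : 0 < e / 2 by rewrite divr_gt0.
have K (g : 'rV[R]_n -> R) : smooth g -> exists2 d : R, 0 < d &
    forall y : 'rV[R]_n, (forall j, `|x ord0 j - y ord0 j| < d) -> `|g x - g y| <= e / 2.
  move=> sg; have cg : g @ x --> g x := (sg [::]).1 x.
  have : \forall y \near x, `|g x - g y| <= e / 2 by move/cvgrPdist_le: cg; apply.
  move=> /nbhs_ballP[d /= d0 dP]; exists d => // y h; apply: dP.
  by split => // i j; rewrite (ord1 i); exact: h.
have [d1 d10 h1] := K _ sr; have [d2 d20 h2] := K _ si.
exists (Num.min d1 d2); first by rewrite lt_min d10.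
move=> y h; apply: le_trans (normc_le_ReIm _) _.
have k1 : `|re phi x - re phi y| <= e / 2.
  by apply: h1 => j; apply: lt_le_trans (h j) _; rewrite ge_min lexx.
have k2 : `|im phi x - im phi y| <= e / 2.
  by apply: h2 => j; apply: lt_le_trans (h j) _; rewrite ge_min lexx orbT.
move: k1 k2; case: (phi x) (phi y) => [? ?] [? ?] /=; lra.
Qed.

(** At a grid point y near x the discrete transform of size L reproduces phi exactly. Frequencies
    outside the box of size K contribute at most M0 3^n / (K+1), whatever L; the limit in L leaves
    the partial sum with the limit coefficients. The outer factor 2 is that of [limc_bound]. *)
Lemma fourier_inversion phi : test_function phi -> exists M, forall K x,
  Normc.normc (phi x - \sum_(g : grid K) coef phi (cidx g) * character (cidx g) x) <=
    M / K.+1%:R.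
Proof.
move=> tp; have [M0 M00 hM] := dft_decay tp; have [B hB] := test_bounded tp.
exists (2 * (M0 * 3 ^+ n + 1)) => K x.
pose z L := \sum_(g : grid K) dft L phi (cidx g) * character (cidx g) x.
have bz : bddc z.
  apply: (@bddc_sum R _ _ (fun g L => dft L phi (cidx g) * character (cidx g) x)) => g.
  under eq_fun do rewrite mulrC; apply: bddcM; exact: bddc_dft.
have zE : limc z = \sum_(g : grid K) coef phi (cidx g) * character (cidx g) x.
  rewrite (@limc_sum R _ _ (fun g L => dft L phi (cidx g) * character (cidx g) x)).
    apply: eq_bigr => g _; under eq_fun do rewrite mulrC.
    by rewrite limcM; [exact: mulrC|exact: bddc_dft].
  by move=> g; under eq_fun do rewrite mulrC; apply: bddcM; exact: bddc_dft.
have -> : phi x - \sum_(g : grid K) coef phi (cidx g) * character (cidx g) x =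
    limc (fun L => -1 * z L + phi x).
  by rewrite limc_lin ?zE ?limc_cst; [rewrite mulN1r addrC| |exact: bddc_cst].
(* Two errors vanish as L grows, from moving phi and from moving the characters between x and y;
   each is allotted half of 1/(K+1). *)
pose e : R := (2 * K.+1%:R)^-1; have e0 : 0 < e by rewrite invr_gt0 mulr_gt0.
have [d d0 hd] := test_continuity x tp e0.
pose A : R := (\sum_(g : @grid n K) `|B| * (2 * \sum_j `|(cidx g ord0 j)%:~R : R|)) + 1.
have A0 : 0 < A.
  by rewrite ltr_wpDl// sumr_ge0// => g _; rewrite mulr_ge0// mulr_ge0// sumr_ge0.
have [N1 h1] := gstep_small (divr_gt0 e0 A0).
have [N2 h2] := gstep_small (divr_gt0 d0 (ltr0n _ 2)).
rewrite -mulrA; apply: (@limc_bound _ _ _ (maxn K (maxn N1 N2))).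
  by apply: bddcD; [exact: bddcM|exact: bddc_cst].
move=> L; rewrite !geq_max => /and3P[KL /h1 hL1 /h2 hL2].
have h0 := @gstep_gt0 R L; set h := gstep L in hL1 hL2 h0.
(* [y] is x rounded down to the grid. *)
pose k : 'rV[int]_n := \row_j Num.floor (x ord0 j / h).
pose y := gpoint L k : 'rV[R]_n.
have xy j : `|x ord0 j - y ord0 j| <= h.
  rewrite !mxE -/h; have f1 := floor_le_tmp (x ord0 j / h); have f2 := floorD1_gt (x ord0 j / h).
  move: f1 f2; rewrite intrD -[1%:~R]/(1 : R) ler_pdivlMr// ltr_pdivrMr//.
  by set f := _%:~R => f1 f2; rewrite ler_norml; apply/andP; split; nra.
have s1 : Normc.normc (phi x - phi y) <= e.
  by apply: hd => j; apply: le_lt_trans (xy j) _; apply: le_lt_trans hL2 _; lra.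
have phiy : phi y = \sum_(g : grid K) dft L phi (cidx g) * character (cidx g) y +
    \sum_(g : grid L | ~~ in_box K (cidx g)) dft L phi (cidx g) * character (cidx g) y.
  rewrite (dft_inversion _ _ (test_periodic tp)) (bigID (fun g => in_box K (cidx g)))/=.
  by congr (_ + _); rewrite -(sum_in_box (fun m => dft L phi m * character m y) KL).
have -> : -1 * z L + phi x = (phi x - phi y) +
    (\sum_(g : grid K) dft L phi (cidx g) * (character (cidx g) y - character (cidx g) x) +
    \sum_(g : grid L | ~~ in_box K (cidx g)) dft L phi (cidx g) * character (cidx g) y).
  have -> : \sum_(g : grid K) dft L phi (cidx g) * (character (cidx g) y - character (cidx g) x) =
      \sum_(g : grid K) dft L phi (cidx g) * character (cidx g) y - z L.
    by rewrite -sumrB; apply: eq_bigr => g _; rewrite mulrBr.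
  rewrite mulN1r {1}phiy; ring.
have s2 : Normc.normc (\sum_(g : grid K) dft L phi (cidx g) *
    (character (cidx g) y - character (cidx g) x)) <= e.
  apply: (@le_trans _ _ (A * h)); last by rewrite mulrC -ler_pdivlMr.
  apply: le_trans (normc_sum _ _ _) _; rewrite /A mulrDl mul1r mulr_suml.
  apply: (@le_trans _ _ (\sum_(g : @grid n K) `|B| * (2 * \sum_j `|(cidx g ord0 j)%:~R : R|) * h)).
    apply: ler_sum => g _; rewrite Normc.normcM -mulrA.
    apply: ler_pM; rewrite ?normc_ge0//.
      by apply: normc_dft_le => t; exact: le_trans (hB t) (ler_norm B).
    rewrite !characterE; apply: le_trans (cis_lip _ _) _; rewrite -mulrA ler_wpM2l//.
    rewrite /dotr -sumrB mulr_suml; apply: le_trans (ler_norm_sum _ _ _) _.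
    apply: ler_sum => j _; rewrite -mulrBl normrM mulrC distrC mxE.
    by rewrite ler_wpM2l.
  by rewrite lerDl ltW.
have s3 : Normc.normc (\sum_(g : grid L | ~~ in_box K (cidx g))
    dft L phi (cidx g) * character (cidx g) y) <= M0 * 3 ^+ n / K.+1%:R.
  apply: le_trans (normc_sum _ _ _) _.
  apply: (@le_trans _ _ (\sum_(g : grid L) M0 / K.+1%:R * (wt (cidx g)) ^- 2)).
    rewrite [leRHS](bigID (fun g => ~~ in_box K (cidx g)))/= -[leLHS]addr0.
    have w0 m : 0 < wt m by rewrite (lt_le_trans ltr01)// wt_ge1.
    apply: lerD; last first.
      by apply: sumr_ge0 => g _; rewrite mulr_ge0 ?divr_ge0// invr_ge0 exprn_ge0// ltW.
    apply: ler_sum => g /forallPn[j]; rewrite -ltNge => gK.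
    rewrite Normc.normcM normc_character mulr1.
    apply: le_trans (hM _ _ (in_box_cidx g)) _.
    have wK : K.+1%:R <= wt (cidx g).
      apply: le_trans (wt_ge_coord _ j); rewrite -natr1 addrC lerD2l -intr_norm.
      by rewrite -[K%:R]/(K%:Z%:~R) ler_int ltW.
    rewrite -mulrA ler_wpM2l// -invfM lef_pV2 ?posrE ?mulr_gt0 ?exprn_gt0//.
    rewrite (_ : wt (cidx g) ^+ 4 = wt (cidx g) ^+ 2 * wt (cidx g) ^+ 2); last by rewrite -exprD.
    rewrite ler_wpM2r ?exprn_ge0 ?(ltW (w0 _))//; apply: le_trans wK _.
    by rewrite expr2 ler_peMl ?wt_ge1// ltW.
  rewrite -mulr_sumr mulrAC ler_wpM2r ?invr_ge0// ler_wpM2l//.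
  exact: sum_wt.
apply: le_trans (normcD_le _ _) _.
apply: le_trans (lerD s1 (normcD_le _ _)) _.
have -> : (M0 * 3 ^+ n + 1) / K.+1%:R = e + (e + M0 * 3 ^+ n / K.+1%:R).
  rewrite /e; have : K.+1%:R != 0 :> R by rewrite pnatr_eq0.
  by move: (K.+1%:R) => k1 k10; field.
by rewrite lerD2l; exact: lerD.
Qed.

End fourier_decay.

(** * Distributions with given Fourier coefficients *)

Section distributions.
Context {R : realType} {n : nat}.
Local Notation C := R[i].
Implicit Types (phi psi : 'rV[R]_n -> C) (m k : 'rV[int]_n) (j : 'I_n).
Implicit Types (alpha : mpoly.multinom n) (b : 'rV[int]_n -> C).

Definition mono m alpha : C := \prod_(j <- enum 'I_n) (m ord0 j)%:~R ^+ alpha j.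

Lemma normc_int (a : int) : Normc.normc (a%:~R : C) = `|a%:~R|.
Proof. by rewrite -(rmorph_int (real_complex R)) normc_real. Qed.

Lemma normcX (x : C) (i : nat) : Normc.normc (x ^+ i) = Normc.normc x ^+ i.
Proof. by elim: i => [|i IH]; rewrite ?Normc.normc1// !exprS Normc.normcM IH. Qed.

Lemma test_iter_Dj j i phi : test_function phi -> test_function (iter i (Dj j) phi).
Proof. by move=> tp; elim: i => //= i; exact: test_Dj. Qed.

Lemma test_multi_iter alpha phi : test_function phi -> test_function (multi_iter Dj alpha phi).
Proof.
by move=> tp; rewrite /multi_iter; elim: (enum 'I_n) => //= j s; exact: test_iter_Dj.
Qed.

Lemma coef_multi_iter alpha phi m : test_function phi ->
  coef (multi_iter Dj alpha phi) m = mono m alpha * coef phi m.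
Proof.
move=> tp; rewrite /multi_iter /mono.
suff [] : test_function (foldr (fun j => iter (alpha j) (Dj j)) phi (enum 'I_n)) /\
  coef (foldr (fun j => iter (alpha j) (Dj j)) phi (enum 'I_n)) m =
  \prod_(j <- enum 'I_n) (m ord0 j)%:~R ^+ alpha j * coef phi m by [].
elim: (enum 'I_n) => [|j s [ts IH]]; first by rewrite big_nil mul1r.
rewrite big_cons -mulrA -IH /=; split; first exact: test_iter_Dj.
elim: (alpha j) => [|i IHi]; first by rewrite mul1r.
by rewrite iterS coef_Dj; [rewrite IHi exprS mulrA|exact: test_iter_Dj].
Qed.

Lemma multi_iter_lin alpha (a c : C) phi psi : test_function phi -> test_function psi ->
  multi_iter Dj alpha (fun x => a * phi x + c * psi x) =
  fun x => a * multi_iter Dj alpha phi x + c * multi_iter Dj alpha psi x.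
Proof.
move=> tp tq; rewrite /multi_iter.
have It i j (f g : 'rV[R]_n -> C) : test_function f -> test_function g ->
    iter i (Dj j) (fun x => a * f x + c * g x) =
    fun x => a * iter i (Dj j) f x + c * iter i (Dj j) g x.
  move=> tf tg; elim: i => //= i ->; apply: Dj_lin.
    by have [] := test_iter_Dj j i tf.
  by have [] := test_iter_Dj j i tg.
suff [_ [_ ->]] : test_function (foldr (fun j => iter (alpha j) (Dj j)) phi (enum 'I_n)) /\
  test_function (foldr (fun j => iter (alpha j) (Dj j)) psi (enum 'I_n)) /\
  foldr (fun j => iter (alpha j) (Dj j)) (fun x => a * phi x + c * psi x) (enum 'I_n) =
  fun x => a * foldr (fun j => iter (alpha j) (Dj j)) phi (enum 'I_n) x +
    c * foldr (fun j => iter (alpha j) (Dj j)) psi (enum 'I_n) x by [].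
elim: (enum 'I_n) => [//|j s [t1 [t2 IH]]] /=.
by rewrite IH It//; split; [|split => //]; exact: test_iter_Dj.
Qed.

Lemma multi_iter_character alpha m :
  multi_iter Dj alpha (character m : 'rV[R]_n -> C) = fun x => mono m alpha * character m x.
Proof.
rewrite /multi_iter /mono; elim: (enum 'I_n) => [|j s IH].
  by apply/funext => x; rewrite big_nil mul1r.
rewrite /= IH big_cons; elim: (alpha j) => [|i IHi].
  by apply/funext => x; rewrite mul1r.
rewrite iterS IHi; set c := _ * \prod_(_ <- s) _.
have tc := test_character m : test_function (character m : 'rV[R]_n -> C).
have := @Dj_lin R n j c 0 _ _ tc.1 tc.1.
rewrite (_ : (fun x => c * character m x + 0 * character m x) = fun x => c * character m x).
  move=> ->; apply/funext => x; rewrite mul0r addr0 Dj_character /c exprS; ring.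
by apply/funext => x; rewrite mul0r addr0.
Qed.

Definition trig_poly (I : Type) (s : seq I) (c : I -> C) (f : I -> 'rV[int]_n) :
    'rV[R]_n -> C := fun x => \sum_(i <- s) c i * character (f i) x.

Lemma trig_poly_cons I (i : I) s c f : trig_poly (i :: s) c f =
  fun x => c i * character (f i) x + 1 * trig_poly s c f x.
Proof. by apply/funext => x; rewrite /trig_poly big_cons mul1r. Qed.

Lemma trig_poly_nil I (c : I -> C) f : trig_poly [::] c f =
  fun x => 0 * character 0 x + 0 * character 0 x.
Proof. by apply/funext => x; rewrite /trig_poly big_nil !mul0r addr0. Qed.

Lemma test_trig_poly I (s : seq I) c f : test_function (trig_poly s c f).
Proof.
elim: s => [|i s IH]; first by rewrite trig_poly_nil; apply: test_lin; exact: test_character.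
by rewrite trig_poly_cons; apply: test_lin => //; exact: test_character.
Qed.

Lemma multi_iter_trig_poly alpha I (s : seq I) c f :
  multi_iter Dj alpha (trig_poly s c f) = trig_poly s (fun i => mono (f i) alpha * c i) f.
Proof.
elim: s => [|i s IH].
  rewrite !trig_poly_nil multi_iter_lin; try exact: test_character.
  by apply/funext => x; rewrite !mul0r.
rewrite !trig_poly_cons multi_iter_lin ?IH; [|exact: test_character|exact: test_trig_poly].
by apply/funext => x; rewrite multi_iter_character mulrA [c i * _]mulrC.
Qed.

Lemma pairing0 (f : periodic_distribution R n) phi : test_function phi ->
  f (fun x => 0 * phi x) = 0.
Proof.
move=> tp; have E := pairing_linear f (-1) tp tp; rewrite mulN1r addNr in E.
by rewrite -[RHS]E; congr (f _); apply/funext => x; rewrite mul0r mulN1r addNr.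
Qed.

Lemma pairing_trig_poly (f : periodic_distribution R n) I (s : seq I) c g :
  f (trig_poly s c g) = \sum_(i <- s) c i * f (character (g i)).
Proof.
elim: s => [|i s IH].
  rewrite big_nil -(pairing0 f (test_character 0)); congr (f _).
  by apply/funext => x; rewrite /trig_poly big_nil mul0r.
rewrite big_cons -IH -(pairing_linear f); [|exact: test_character|exact: test_trig_poly].
by congr (f _); apply/funext => x; rewrite trig_poly_cons mul1r.
Qed.

(** Multi-indices of bounded degree form a finite type, so one sum dominates the constants of all
    seminorms of order at most N. *)
Lemma le_sum_bmultinom N alpha (M : mpoly.multinom n -> R) : (mpoly.mdeg alpha <= N)%N ->
  M alpha <= \sum_(a : mpoly.bmultinom n N.+1) `|M (mpoly.bmnm a)|.
Proof.
move=> aN; have aN' : (mpoly.mdeg alpha < N.+1)%N by [].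
rewrite (bigD1 (mpoly.BMultinom aN'))//= (le_trans (ler_norm _))// lerDl sumr_ge0//.
Qed.

(** Coefficients commute with D^alpha, so inversion applied to each D^alpha phi shows that the
    partial Fourier sums converge in every seminorm; continuity of f then allows termwise
    evaluation. *)
Lemma distribution_fourier (f : periodic_distribution R n) phi : test_function phi ->
  limc (fun K => \sum_(g : grid K) coef phi (cidx g) * f (character (cidx g))) = f phi.
Proof.
move=> tp; have [Kf [N hf]] := pairing_continuous f.
have h alpha : exists M, forall K x,
    Normc.normc (multi_iter Dj alpha phi x - \sum_(g : grid K)
      coef (multi_iter Dj alpha phi) (cidx g) * character (cidx g) x) <= M / K.+1%:R.
  by apply: fourier_inversion; exact: test_multi_iter.
pose M alpha := projT1 (cid (h alpha)).
pose B := \sum_(a : mpoly.bmultinom n N.+1) `|M (mpoly.bmnm a)|.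
have B0 : 0 <= B by exact: sumr_ge0.
pose z K := \sum_(g : grid K) coef phi (cidx g) * f (character (cidx g)).
have key K : Normc.normc (z K - f phi) <= `|Kf * B| / K.+1%:R.
  pose phiK := trig_poly (index_enum (grid K : finType)) (fun g => coef phi (cidx g)) (@cidx n K).
  have tK : test_function phiK by exact: test_trig_poly.
  have zE : z K = f phiK by rewrite pairing_trig_poly.
  have -> : z K - f phi = f (fun x => -1 * phi x + phiK x).
    by rewrite (pairing_linear f)// zE mulN1r addrC.
  apply: (@le_trans _ _ (Kf * (B / K.+1%:R))); last first.
    by rewrite mulrA ler_wpM2r ?invr_ge0// ler_norm.
  apply: hf.
    by have := test_lin (-1) 1 tp tK; congr test_function; apply/funext => x; rewrite mul1r.
  move=> alpha aN x.
  have -> : (fun x => -1 * phi x + phiK x) = fun x => -1 * phi x + 1 * phiK x.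
    by apply/funext => y; rewrite mul1r.
  rewrite multi_iter_lin// mulN1r mul1r -normcN opprD opprK.
  apply: (@le_trans _ _ (M alpha / K.+1%:R)); last first.
    by rewrite ler_wpM2r ?invr_ge0//; exact: le_sum_bmultinom.
  have := projT2 (cid (h alpha)) K x; rewrite -/(M alpha).
  congr (Normc.normc (_ - _) <= _); rewrite multi_iter_trig_poly /trig_poly.
  by apply: eq_bigr => g _; rewrite coef_multi_iter.
apply: limc_cvg.
  exists (Normc.normc (f phi) + `|Kf * B|) => K.
  rewrite -[X in Normc.normc X](subrK (f phi)) addrC.
  apply: le_trans (normcD_le _ _) _; rewrite lerD2l; apply: le_trans (key K) _.
  by rewrite ler_pdivrMr// ler_peMr// ler1n.
move=> e e0; exists (Num.truncn (`|Kf * B| / e)) => K NK.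
apply: le_trans (key K) _; rewrite ler_pdivrMr// [e * _]mulrC -ler_pdivrMr//.
apply: le_trans (ltW (truncnS_gt _)) _; rewrite ler_nat.
exact: leq_ltn_trans NK _.
Qed.

Definition pbdd b := exists (A : R) (q : nat), forall m, Normc.normc (b m) <= A * wt m ^+ q.

Lemma wtN m : wt (- m) = wt m :> R.
Proof. by apply: eq_bigr => j _; rewrite mxE rmorphN normrN. Qed.

Lemma wt_gt0 m : 0 < wt m :> R.
Proof. by rewrite (lt_le_trans ltr01)// wt_ge1. Qed.

Lemma pbddM b b' : pbdd b -> pbdd b' -> pbdd (fun m => b m * b' m).
Proof.
move=> [A [q hA]] [A' [q' hA']]; exists (A * A'); exists (q + q')%N => m.
by rewrite Normc.normcM exprD mulrACA ler_pM ?normc_ge0.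
Qed.

Lemma pbdd_coord j (c : C) : pbdd (fun m => (m ord0 j)%:~R + c).
Proof.
exists (1 + Normc.normc c); exists 1%N => m; apply: le_trans (normcD_le _ _) _.
rewrite normc_int expr1 mulrDl mul1r; apply: lerD.
  by apply: le_trans (wt_ge_coord m j); rewrite lerDr.
by rewrite ler_peMr ?normc_ge0// wt_ge1.
Qed.

(** Unlike in [dft_decay], the constant is explicit in the seminorms of phi, as continuity of a
    functional requires. *)
Lemma coef_decay (q : nat) : exists (N : nat) (c : R), 0 <= c /\ forall phi (M : R),
  test_function phi ->
  (forall alpha, (mpoly.mdeg alpha <= N)%N -> forall x,
    Normc.normc (multi_iter Dj alpha phi x) <= M) ->
  forall m, Normc.normc (coef phi m) <= c * M / wt m ^+ q.
Proof.
exists (n * q)%N; exists (2 ^+ (n * q) * 2); split; first by rewrite mulr_ge0// exprn_ge0.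
move=> phi M tp hM m.
(* q derivatives in every direction with m_j nonzero, none in the others: since 1 + |m_j| <= 2 |m_j|
   for a nonzero integer, |m^alpha| >= (wt m / 2^n)^q. *)
pose alpha : mpoly.multinom n :=
  mpoly.Multinom (mktuple (fun j => if m ord0 j == 0 then 0%N else q)).
have aE j : alpha j = if m ord0 j == 0 then 0%N else q by rewrite /alpha mpoly.mnmE.
have aN : (mpoly.mdeg alpha <= n * q)%N.
  rewrite mpoly.mdegE (@leq_trans (\sum_(j < n) q))//; last by rewrite sum_nat_const card_ord.
  by apply: leq_sum => j _; rewrite aE; case: ifP.
have h1 : wt m ^+ q <= 2 ^+ (n * q) * Normc.normc (mono m alpha) :> R.
  have -> : 2 ^+ (n * q) = (\prod_(j < n) 2) ^+ q :> R by rewrite prodr_const card_ord exprM.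
  rewrite /mono normc_prod big_enum/= -!prodrXl -big_split/=; apply: ler_prod => j _.
  rewrite exprn_ge0 ?addr_ge0//= normcX normc_int aE; case: eqP => [->|/eqP mj].
    by rewrite mulr0z normr0 addr0 expr1n expr0 mulr1 exprn_ege1// ler1n.
  rewrite -exprMn lerXn2r ?nnegrE ?addr_ge0 ?mulr_ge0//.
  have : 1 <= `|(m ord0 j)%:~R| :> R by rewrite -intr_norm -[1]/(1%:~R) ler_int; lia.
  by lra.
rewrite ler_pdivlMr ?exprn_gt0 ?wt_gt0//.
apply: le_trans (ler_wpM2l (normc_ge0 _) h1) _.
rewrite mulrCA -!mulrA ler_wpM2l ?exprn_ge0// mulrC -Normc.normcM -coef_multi_iter//.
by apply: normc_coef_le => x; exact: hM.
Qed.

Definition period : C := ((2 * pi) ^+ n)%:C%C.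

(** Formally the pairing of phi with the sum of b(m) e^(i(m,x)): each character pairs to (2 pi)^n
    times the coefficient of phi at -m, and m is replaced by -m. *)
Definition usum b phi (K : nat) : C :=
  \sum_(g : grid K) b (- cidx g) * (period * coef phi (cidx g)).

Definition ufun b phi : C := limc (usum b phi).

(** Decay of order q + 2: q powers absorb the growth of b, two make the sum bounded independently of
    K. *)
Lemma usum_bound b : pbdd b -> exists (N : nat) (c : R), 0 <= c /\ forall phi (M : R),
  test_function phi ->
  (forall alpha, (mpoly.mdeg alpha <= N)%N -> forall x,
    Normc.normc (multi_iter Dj alpha phi x) <= M) ->
  forall K, Normc.normc (usum b phi K) <= c * M.
Proof.
move=> [A [q hA]]; have [N [c [c0 hc]]] := coef_decay (q + 2).
exists N; exists (`|A| * Normc.normc period * c * 3 ^+ n); split.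
  by rewrite !mulr_ge0 ?normc_ge0// exprn_ge0.
move=> phi M tp hM K; apply: le_trans (normc_sum _ _ _) _.
apply: (@le_trans _ _ (\sum_(g : grid K) `|A| * Normc.normc period * (c * M) * (wt (cidx g)) ^- 2)).
  apply: ler_sum => g _; rewrite !Normc.normcM.
  have h1 : Normc.normc (b (- cidx g)) <= `|A| * wt (cidx g) ^+ q.
    apply: le_trans (hA _) _; rewrite wtN ler_wpM2r ?exprn_ge0 ?(ltW (wt_gt0 _))//.
    exact: ler_norm.
  have h2 := hc phi M tp hM (cidx g).
  apply: le_trans (ler_pM (normc_ge0 _) _ h1 (ler_wpM2l (normc_ge0 period) h2)) _.
    by rewrite mulr_ge0 ?normc_ge0.
  have w0 : wt (cidx g) != 0 :> R by rewrite gt_eqF// wt_gt0.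
  rewrite exprD le_eqVlt; apply/orP; left; apply/eqP; field.
  by rewrite w0 expf_neq0.
rewrite -mulr_sumr; apply: le_trans (_ : _ <= `|A| * Normc.normc period * (c * M) * 3 ^+ n) _.
  (* The sign of c M is read off from the coefficient bound at frequency 0. *)
  have cM : 0 <= c * M.
    apply: le_trans (_ : Normc.normc (coef phi 0) * wt (0 : 'rV[int]_n) ^+ (q + 2) <= _).
      by rewrite mulr_ge0 ?normc_ge0// exprn_ge0//; exact/ltW/wt_gt0.
    by rewrite -ler_pdivlMr ?exprn_gt0 ?wt_gt0//; exact: hc.
  apply: ler_wpM2l; last exact: sum_wt.
  by apply: mulr_ge0 => //; rewrite mulr_ge0 ?normc_ge0.
by rewrite le_eqVlt; apply/orP; left; apply/eqP; ring.
Qed.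

Lemma bddc_usum b phi : pbdd b -> test_function phi -> bddc (usum b phi).
Proof.
move=> /usum_bound[N [c [c0 hc]]] tp.
have h alpha : exists M, forall x, Normc.normc (multi_iter Dj alpha phi x) <= M.
  by apply: test_bounded; exact: test_multi_iter.
pose M alpha := projT1 (cid (h alpha)).
exists (c * \sum_(a : mpoly.bmultinom n N.+1) `|M (mpoly.bmnm a)|).
apply: hc => // alpha aN x; apply: le_trans (le_sum_bmultinom M aN).
exact: projT2 (cid (h alpha)) x.
Qed.

Lemma ufun_lin b (a : C) phi psi : pbdd b -> test_function phi -> test_function psi ->
  ufun b (fun x => a * phi x + psi x) = a * ufun b phi + ufun b psi.
Proof.
move=> pb tp tq; rewrite /ufun -limc_lin; try exact: bddc_usum.
congr limc; apply/funext => K; rewrite /usum mulr_sumr -big_split; apply: eq_bigr => g _.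
have := @coef_lin R n a 1 _ _ (cidx g) tp tq; under eq_fun do rewrite mul1r.
by move=> ->; rewrite /=; ring.
Qed.

Lemma ufun_bound b : pbdd b -> exists (K : R) (N : nat), forall phi (M : R),
  test_function phi ->
  (forall alpha, (mpoly.mdeg alpha <= N)%N -> forall x,
    Normc.normc (multi_iter Dj alpha phi x) <= M) ->
  Normc.normc (ufun b phi) <= K * M.
Proof.
move=> pb; have [N [c [c0 hc]]] := usum_bound pb; exists (2 * c); exists N => phi M tp hM.
rewrite -mulrA; apply: (limc_bound (N := 0)); first exact: bddc_usum.
by move=> K _; exact: hc.
Qed.

Definition udist b (pb : pbdd b) : periodic_distribution R n :=
  @PeriodicDistribution R n (ufun b)
    (fun a phi psi tp tq => ufun_lin a pb tp tq) (ufun_bound pb).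

Lemma cidx_inj K : injective (@cidx n K).
Proof.
move=> g g' e; apply/ffunP => j; apply: val_inj; move/rowP: e => /(_ j).
by rewrite !mxE => /addIr [].
Qed.

Lemma period_neq0 : period != 0.
Proof.
rewrite /period -normc_eq0 normc_real normr_eq0 expf_neq0//.
by rewrite mulf_neq0// gt_eqF// pi_gt0.
Qed.

Lemma ufun_character b m : pbdd b -> ufun b (character (- m)) = period * b m.
Proof.
move=> pb; apply: limc_cvg; first by apply: bddc_usum => //; exact: test_character.
move=> e e0; exists (\sum_j `|m ord0 j|)%N => K mK.
have mK' j : `|m ord0 j| <= K%:Z.
  have : (`|m ord0 j| <= \sum_j `|m ord0 j|)%N by rewrite (bigD1 j)//= leq_addr.
  by lia.
(* The index of the frequency -m, the only one with a nonzero coefficient. *)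
pose g0 : @grid n K := [ffun j => inord `|K%:Z - m ord0 j|%N].
have g0E : cidx g0 = - m.
  apply/rowP => j; have := mK' j.
  have -> : (- m) 0 j = - m ord0 j by rewrite mxE.
  by rewrite mxE ffunE; move: (m ord0 j) => a ha; rewrite inordK; lia.
rewrite /usum (bigD1 g0)//= g0E opprK coef_character eqxx mulr1 big1 ?addr0.
  by rewrite mulrC subrr Normc.normc0 ltW.
move=> g gg0; rewrite coef_character -g0E (inj_eq (@cidx_inj K)) eq_sym (negbTE gg0).
by rewrite !mulr0.
Qed.

Lemma expi_latticeN m : expi_dot (- map_mx intr m) = character (- m) :> ('rV[R]_n -> C).
Proof. by rewrite /character of_latticeN. Qed.

Lemma fourier_coef_udist b (pb : pbdd b) m : fourier_coef (udist pb) m = b m.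
Proof.
rewrite /fourier_coef expi_latticeN /= ufun_character//.
rewrite (_ : ((2 * pi) ^- n)%:C%C = period^-1); last first.
  by rewrite /period -[RHS](fmorphV (real_complex R)).
by rewrite mulKf// period_neq0.
Qed.

(** Continuity of order N tested on characters, whose derivatives of order at most N are bounded by
    the N-th power of [wt]. *)
Lemma pbdd_fourier_coef (f : periodic_distribution R n) : pbdd (fourier_coef f).
Proof.
have [K [N hf]] := pairing_continuous f.
exists (`|(2 * pi) ^- n| * K); exists N => m.
rewrite /fourier_coef expi_latticeN Normc.normcM normc_real -mulrA ler_wpM2l//.
apply: hf; first exact: test_character.
move=> alpha aN x; rewrite multi_iter_character Normc.normcM normc_character mulr1.
rewrite /mono normc_prod big_enum/=.
apply: (@le_trans _ _ (wt m ^+ mpoly.mdeg alpha)); last first.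
  by apply: ler_weXn2l => //; exact: wt_ge1.
rewrite mpoly.mdegE -prodrXr; apply: ler_prod => j _.
rewrite normc_ge0/= normcX normc_int lerXn2r ?nnegrE ?(ltW (wt_gt0 _))//.
rewrite mxE rmorphN normrN; apply: le_trans (wt_ge_coord m j); by rewrite lerDr.
Qed.

Lemma ufun_fourier_coef (f : periodic_distribution R n) phi : test_function phi ->
  ufun (fourier_coef f) phi = f phi.
Proof.
move=> tp; rewrite -(distribution_fourier f tp); congr limc; apply/funext => K.
apply: eq_bigr => g _; rewrite /fourier_coef expi_latticeN opprK.
rewrite (_ : ((2 * pi) ^- n)%:C%C = period^-1); last first.
  by rewrite /period -[RHS](fmorphV (real_complex R)).
by rewrite mulrACA mulVf ?period_neq0// mul1r mulrC.
Qed.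

Variable xi : 'rV[R]_n.

(** The product of u with e^(i(x,xi)) is not periodic, hence no distribution on the torus; it is
    only evaluated at e^(-i(x,xi)) phi with phi periodic, and there coefficients describe it. *)
Definition twisted (T : ('rV[R]_n -> C) -> C) b := forall phi, test_function phi ->
  T (fun x => expi_dot (- xi) x * phi x) = ufun b phi.

(** Moving D_j past e^(-i(x,xi)) gives D_j - xi_j, with multiplier m_j - xi_j on phi. The sign of
    the transposition turns it into (-m_j) + xi_j, which is the new factor at -m, where [usum]
    evaluates b. *)
Lemma twisted_dDj T b j : pbdd b -> twisted T b ->
  twisted (dDj j T) (fun m => ((m ord0 j)%:~R + (xi ord0 j)%:C%C) * b m).
Proof.
move=> pb tw phi tp; rewrite /dDj Dj_expi_mul; last by case: tp.
pose psi := fun x => 1 * Dj j phi x + ((- xi) ord0 j)%:C%C * phi x.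
have tpsi : test_function psi by apply: test_lin => //; exact: test_Dj.
have -> : (fun x => expi_dot (- xi) x * (Dj j phi x + ((- xi) ord0 j)%:C%C * phi x)) =
    fun x => expi_dot (- xi) x * psi x.
  by apply/funext => x; rewrite /psi mul1r.
rewrite tw// -mulN1r /ufun -limcM; last exact: bddc_usum.
congr limc; apply/funext => K; rewrite /usum mulr_sumr; apply: eq_bigr => g _.
rewrite /psi coef_lin//; last exact: test_Dj.
by rewrite coef_Dj// !mxE !rmorphN/=; ring.
Qed.

Lemma twisted_multi_iter T b alpha : pbdd b -> twisted T b ->
  pbdd (fun m => \prod_(j <- enum 'I_n) ((m ord0 j)%:~R + (xi ord0 j)%:C%C) ^+ alpha j * b m) /\
  twisted (multi_iter dDj alpha T)
    (fun m => \prod_(j <- enum 'I_n) ((m ord0 j)%:~R + (xi ord0 j)%:C%C) ^+ alpha j * b m).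
Proof.
move=> pb tw; rewrite /multi_iter; elim: (enum 'I_n) => [|j s [pbs IH]] /=.
  by rewrite (_ : (fun m => _) = b)//; apply/funext => m; rewrite big_nil mul1r.
set bs := fun m => _ in pbs IH; set Ts := foldr _ _ _ in IH *.
have -> : (fun m => \prod_(j <- j :: s) ((m ord0 j)%:~R + (xi ord0 j)%:C%C) ^+ alpha j * b m) =
    fun m => ((m ord0 j)%:~R + (xi ord0 j)%:C%C) ^+ alpha j * bs m.
  by apply/funext => m; rewrite big_cons mulrA.
elim: (alpha j) => [|i [pbi IHi]].
  by rewrite (_ : (fun m => _) = bs)//; apply/funext => m; rewrite mul1r.
have -> : (fun m => ((m ord0 j)%:~R + (xi ord0 j)%:C%C) ^+ i.+1 * bs m) = fun m =>
    ((m ord0 j)%:~R + (xi ord0 j)%:C%C) * (((m ord0 j)%:~R + (xi ord0 j)%:C%C) ^+ i * bs m).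
  by apply/funext => m; rewrite exprS mulrA.
by split; [apply: pbddM => //; exact: pbdd_coord|exact: twisted_dDj].
Qed.

Lemma twisted_base b (pb : pbdd b) : twisted (dmul (expi_dot xi) (udist pb)) b.
Proof.
move=> phi tp; rewrite /dmul /=; congr (ufun b _); apply/funext => x.
rewrite mulrA -[RHS]mul1r; congr (_ * _).
by rewrite -[expi_dot xi x]/(cis (dotr x xi)) -[expi_dot _ x]/(cis (dotr x (- xi))) -cisD dotrNr subrr cis0.
Qed.

Lemma conjugated_udist (P : mpoly.mpoly n C) b (pb : pbdd b) phi : test_function phi ->
  conjugated P xi (udist pb) phi = ufun (fun m => symbol P (xi + of_lattice m) * b m) phi.
Proof.
move=> tp; rewrite /conjugated {1}/dmul /dPD.
have tw alpha := twisted_multi_iter alpha pb (twisted_base pb).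
have E alpha : mpoly.mcoeff alpha P *
      multi_iter dDj alpha (dmul (expi_dot xi) (udist pb)) (fun x => expi_dot (- xi) x * phi x) =
    limc (fun K => mpoly.mcoeff alpha P * usum (fun m =>
      \prod_(j <- enum 'I_n) ((m ord0 j)%:~R + (xi ord0 j)%:C%C) ^+ alpha j * b m) phi K).
  by rewrite (tw alpha).2// limcM//; exact: bddc_usum (tw alpha).1 tp.
rewrite (eq_bigr _ (fun alpha _ => E alpha)) {E}.
rewrite -limc_sum; last by move=> alpha; apply: bddcM; exact: bddc_usum (tw alpha).1 tp.
congr limc; apply/funext => K; rewrite /usum; under eq_bigr do rewrite mulr_sumr.
rewrite exchange_big; apply: eq_bigr => g _ /=.
rewrite symbolE mulr_suml mulr_suml; apply: eq_bigr => alpha _.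
rewrite big_enum/= !mulrA; congr (_ * _ * _ * _ * _); apply: eq_bigr => j _.
by rewrite !mxE (rmorphD (real_complex R)) -(rmorph_int (real_complex R)) [in RHS]addrC.
Qed.

End distributions.

(** * Sobolev estimate and solution of the equation *)

Section sobolev.
Context {R : realType} {n : nat}.
Local Notation C := R[i].

Lemma esum_scale_le (T : choiceType) (c : R) (a : T -> \bar R) : 0 <= c ->
  (forall i, 0 <= a i)%E ->
  (\esum_(i in [set: T]) (c%:E * a i) <= c%:E * \esum_(i in [set: T]) a i)%E.
Proof.
move=> c0 a0; apply: ge_ereal_sup => _ [A fA <-].
rewrite -ge0_mule_fsumr//; apply: lee_wpmul2l; first by rewrite lee_fin.
by apply: ereal_sup_ubound; exists A.
Qed.

(** Squaring the hypothesis turns the power s/2 of the bracket into the power s by which the two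
    Sobolev weights differ. The constant is 1/c, in the form in which it leaves the square root. *)
Lemma sobolev_norm_le (rho s c : R) (T T' : ('rV[R]_n -> C) -> C) : 0 < c ->
  (forall m, c * bracket m `^ (- (s / 2)) * Normc.normc (fourier_coef T m) <=
    Normc.normc (fourier_coef T' m)) ->
  (sobolev_norm rho T <= ((c ^- 2) `^ 2^-1)%:E * sobolev_norm (rho + s) T')%E.
Proof.
move=> c0 h; rewrite /sobolev_norm.
have e0 (t : R) (U : ('rV[R]_n -> C) -> C) : (0 <= \esum_(m in [set: 'rV[int]_n])
    (Normc.normc (fourier_coef U m) ^+ 2 * (1 + \sum_j (m ord0 j)%:~R ^+ 2) `^ t)%:E)%E.
  by apply: esum_ge0 => m _; rewrite lee_fin mulr_ge0 ?powR_ge0 ?sqr_ge0.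
rewrite -poweR_EFin -poweRM ?lee_fin ?invr_ge0 ?exprn_ge0 ?(ltW c0)//.
apply: gt0_ler_poweR; rewrite ?invr_ge0// ?in_itv/= ?leey ?andbT ?e0//.
  by rewrite mule_ge0// lee_fin invr_ge0 exprn_ge0// ltW.
apply: le_trans (esum_scale_le _ _); last 2 first.
- by rewrite invr_ge0 exprn_ge0// ltW.
- by move=> m; rewrite lee_fin mulr_ge0 ?powR_ge0 ?sqr_ge0.
apply: le_esum => m _; rewrite -EFinM lee_fin -/(bracket m).
have b0 : 0 < bracket m :> R by rewrite (lt_le_trans ltr01)// bracket_ge1.
set u := Normc.normc (fourier_coef T m); set v := Normc.normc (fourier_coef T' m).
have u0 : 0 <= u by exact: normc_ge0.
have := h m; rewrite -/u -/v => huv.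
rewrite powRD; last by rewrite (gt_eqF b0) implybT.
have hs : bracket m `^ s = (bracket m `^ (s / 2)) ^+ 2 :> R.
  by rewrite -powR_mulrn ?powR_ge0// -powRrM; congr (_ `^ _); field.
rewrite hs; set y := bracket m `^ (s / 2).
have y0 : 0 < y by rewrite powR_gt0.
have {}huv : c * u <= v * y.
  by move: huv; rewrite powRN -/y mulrAC ler_pdivrMr.
rewrite (_ : c ^- 2 * _ = (v * y / c) ^+ 2 * bracket m `^ rho); last by field; rewrite gt_eqF.
rewrite ler_wpM2r ?powR_ge0// lerXn2r ?nnegrE//; first by apply: le_trans u0 _; rewrite ler_pdivlMr// mulrC.
by rewrite ler_pdivlMr// mulrC.
Qed.

(** Rests on 1 + |m|^2 <= (n + 1) wt(m)^2; the real exponent a is rounded up, as [pbdd] asks for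
    natural powers. *)
Lemma pbdd_inv_symbol (P : mpoly.mpoly n C) (xi : 'rV[R]_n) (c a : R) : 0 < c -> 0 <= a ->
  (forall m, c * bracket m `^ (- a) <= symbol_weight P (xi + of_lattice m)) ->
  pbdd (fun m => (symbol P (xi + of_lattice m))^-1).
Proof.
move=> c0 a0 h; pose k := (Num.truncn a).+1.
exists (c^-1 * (n.+1%:R) ^+ k); exists (2 * k)%N => m.
have b1 : 1 <= bracket m :> R := bracket_ge1 m.
have b0 : 0 < bracket m :> R := lt_le_trans ltr01 b1.
rewrite Normc.normcV; apply: (@le_trans _ _ (c^-1 * bracket m `^ a)).
  rewrite -[X in _ * X]invrK -powRN -invfM lef_pV2 ?posrE ?mulr_gt0 ?powR_gt0//.
  by apply: lt_le_trans (h m); rewrite mulr_gt0 ?powR_gt0.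
rewrite -mulrA ler_wpM2l ?invr_ge0 ?(ltW c0)//.
apply: (@le_trans _ _ (bracket m ^+ k)).
  by rewrite -powR_mulrn ?(ltW b0)//; apply: ler_powR => //; exact/ltW/truncnS_gt.
rewrite exprM -exprMn lerXn2r ?nnegrE ?mulr_ge0 ?exprn_ge0 ?(ltW (wt_gt0 _)) ?(ltW b0)//.
have w1 := wt_ge1 (R := R) m.
rewrite /bracket -natr1 mulrDl mul1r addrC; apply: lerD; last by rewrite exprn_ege1.
apply: (@le_trans _ _ (\sum_(j < n) wt m ^+ 2)).
  apply: ler_sum => j _; rewrite -real_normK ?num_real// lerXn2r ?nnegrE ?(ltW (wt_gt0 _))//.
  by apply: le_trans (wt_ge_coord m j); rewrite lerDr.
by rewrite sumr_const card_ord mulr_natl.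
Qed.

End sobolev.

Theorem theorem1 (R : realType) (n : nat) (hn : (1 <= n)%N)
    (P : mpoly.mpoly n R[i]) (hP : P != 0) :
  (exists p : R, 1 <= p /\ muckenhoupt p (symbol_weight P)) /\
  forall p rho : R, 1 <= p -> muckenhoupt p (symbol_weight P) ->
    let s := n%:R * p in
    0 < s /\
    exists S : set 'rV[R]_n,
      [/\ measurable S, S `<=` unit_cube,
          lebesgue_rV n S = lebesgue_rV n unit_cube &
          forall xi0, S xi0 ->
          exists C : R, forall f : periodic_distribution R n,
            in_sobolev (rho + s) f ->
            exists u : periodic_distribution R n,
              [/\ in_sobolev rho u,
                  eq_distribution (conjugated P xi0 u) f &
                  (sobolev_norm rho u <= C%:E * sobolev_norm (rho + s) f)%E]].
Proof.
split; first exact: muckenhoupt_symbol.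
move=> p rho p1 mp s.
have s0 : 0 < s by rewrite mulr_gt0 ?ltr0n// (lt_le_trans ltr01).
(* [S] and the constant c come from P and p alone; rho enters only through the Sobolev weights. *)
split => //; have [S [mS sS lS hS]] := small_divisors hn hP p1 mp.
exists S; split => // xi0 /hS[c [c0 hc]].
exists ((c ^- 2) `^ 2^-1) => f fs.
have Pn0 m : symbol P (xi0 + of_lattice m) != 0.
  rewrite -normc_eq0 gt_eqF//; apply: lt_le_trans (hc m).
  by rewrite mulr_gt0// powR_gt0// (lt_le_trans ltr01)// bracket_ge1.
have pinv : pbdd (fun m => (symbol P (xi0 + of_lattice m))^-1).
  by apply: (pbdd_inv_symbol c0 _ hc); rewrite divr_ge0// ltW.
have pb := pbddM (pbdd_fourier_coef f) pinv.
have le : (sobolev_norm rho (udist pb) <=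
    ((c ^- 2) `^ 2^-1)%:E * sobolev_norm (rho + s) f)%E.
  apply: sobolev_norm_le => // m; rewrite fourier_coef_udist Normc.normcM Normc.normcV mulrCA.
  rewrite -[leRHS]mulr1 ler_wpM2l ?normc_ge0// ler_pdivrMr ?mul1r.
    exact: hc.
  by rewrite lt_neqAle normc_ge0 eq_sym normc_eq0 Pn0.
exists (udist pb); split => //.
- apply: le_lt_trans le _; move: fs; rewrite /in_sobolev => fs.
  by rewrite lte_mul_pinfty// lee_fin powR_ge0.
- move=> phi tp; rewrite conjugated_udist// -(ufun_fourier_coef f tp).
  by congr (ufun _ phi); apply/funext => m; rewrite mulrCA mulfV ?mulr1.
Qed.
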